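(* There exist absolute constants $0<c\le C<\infty$ such that for all positive integers $n,k$, all $\lambda>0$, and every symmetric gauge function $\tau$ on $\mathbb{R}^k$ with associated unitarily invariant norm $\|\cdot\|_\tau$ on $\mathbb{R}^{k\times k}$, the following holds. Suppose one observes an $n\times k$ data matrix $X$ whose rows are independently drawn from $N(0,\Sigma)$, with $\Sigma\in\Xi(k,\lambda)$ unknown. Then $$c\left(\frac{k}{n}\wedge 1\right)\lambda^2\tau^2(\mathbf 1)\ \le\ \inf_{\widetilde\Sigma}\ \sup_{\Sigma\in\Xi(k,\lambda)}\mathbb{E}\|\widetilde\Sigma-\Sigma\|_\tau^2\ \le\ C\left(\frac{k}{n}\wedge 1\right)\lambda^2\tau^2(\mathbf 1),$$ where the infimum is over all estimators $\widetilde\Sigma=\widetilde\Sigma(X)$ and $\mathbf 1$ is the all-one vector in $\mathbb{R}^k$.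
   Context: $a\wedge b=\min\{a,b\}$. $\Xi(k,\lambda)$ is the set of $k\times k$ symmetric positive semi-definite matrices $\Sigma$ with operator (spectral) norm at most $\lambda$. A symmetric gauge function on $\mathbb{R}^k$ is a norm on $\mathbb{R}^k$ invariant under permutations and sign changes of coordinates, and $\|A\|_\tau=\tau(\sigma(A))$, where $\sigma(A)$ is the vector of ordered singular values of $A\in\mathbb{R}^{k\times k}$; every unitarily invariant norm on $\mathbb{R}^{k\times k}$ is of this form. An estimator is a measurable function of the observation. *)

(* Defs.v *)
From HB Require Import structures.
From mathcomp Require Import all_boot all_order perm all_algebra.
From mathcomp Require Import all_classical all_reals all_analysis.
From mathcomp Require Import measurable_realfun ring lra.
From mathcomp Require sesquilinear spectral complex.

Set Implicit Arguments.
Unset Strict Implicit.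
Unset Printing Implicit Defensive.

Import Order.TTheory GRing.Theory Num.Theory.
Import numFieldNormedType.Exports.
Local Open Scope classical_set_scope.
Local Open Scope ring_scope.

(* Matrices carry the sigma-algebra generated by their entries, which is the
   Borel sigma-algebra of R^(m x n). *)

Definition measure_mx_display : measure_display.
Proof. exact: default_measure_display. Qed.

Section measurable_matrix.
Context {R : realType} (m n : nat).

Definition mx_entry_preimages : set (set 'M[R]_(m, n)) :=
  [set A | exists i j (B : set R), measurable B /\
     A = (fun M : 'M[R]_(m, n) => M i j) @^-1` B].

Let mx_set0 : <<s mx_entry_preimages >> set0.
Proof. exact: sigma_algebra0. Qed.

Let mx_setC A : <<s mx_entry_preimages >> A -> <<s mx_entry_preimages >> (~` A).
Proof. by move=> sA; rewrite -setTD; exact: sigma_algebraCD. Qed.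

Let mx_bigcup (F : (set 'M[R]_(m, n))^nat) :
  (forall i, <<s mx_entry_preimages >> (F i)) ->
  <<s mx_entry_preimages >> (\bigcup_i (F i)).
Proof. exact: sigma_algebra_bigcup. Qed.

HB.instance Definition _ := @isMeasurable.Build measure_mx_display 'M[R]_(m, n)
  <<s mx_entry_preimages >> mx_set0 mx_setC mx_bigcup.

Lemma measurable_mx_entry i j :
  measurable_fun [set: 'M[R]_(m, n)] (fun M => M i j).
Proof.
move=> _ B mB; rewrite setTI; apply: sub_sigma_algebra.
by exists i, j, B.
Qed.

Lemma measurable_fun_mxP d (T : measurableType d) (f : T -> 'M[R]_(m, n)) :
  measurable_fun setT f <-> forall i j, measurable_fun setT (fun x => f x i j).
Proof.
split=> [mf i j|mf].
  exact: (measurableT_comp (measurable_mx_entry i j) mf).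
apply: (@measurability _ _ _ _ _ _ mx_entry_preimages) => //.
move=> _ [_ [i [j [B [mB ->]]]] <-]; exact: (mf i j measurableT B mB).
Qed.

End measurable_matrix.

Section iid.
Context d (T : measurableType d) (R : realType).

Definition cons_tuple n (x : T * n.-tuple T) : n.+1.-tuple T :=
  [tuple of x.1 :: x.2].

Let measurable_cons_tuple n : measurable_fun setT (@cons_tuple n).
Proof. exact: measurable_cons. Qed.

HB.instance Definition _ n := isMeasurableFun.Build _ _ _ _ (@cons_tuple n)
  (@measurable_cons_tuple n).

(* The n-fold product measure: the law of n independent draws from P. *)
Fixpoint iid (P : probability T R) n : probability (n.-tuple T) R :=
  match n with
  | 0 => \d_ [tuple]
  | n.+1 => distribution (P \x iid P n)%E (@cons_tuple n)
  end.

Lemma iid_rectangle (P : probability T R) n (A : 'I_n -> set T) :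
  (forall i, measurable (A i)) ->
  iid P n [set t | forall i, A i (tnth t i)] = (\prod_(i < n) P (A i))%E.
Proof.
elim: n A => [|n IHn] A mA.
  rewrite big_ord0 /= diracE mem_set// => -[].
  by case.
rewrite big_ord_recl -IHn//= /distribution /pushforward.
rewrite -product_measure1E//; last first.
  rewrite (_ : [set t | _] = \bigcap_(i in [set: 'I_n])
      ((fun t : n.-tuple T => tnth t i) @^-1` A (lift ord0 i))).
    apply: fin_bigcap_measurable => [|i _]; first exact: finite_finset.
    by rewrite -[X in measurable X]setTI; exact: measurable_tnth.
  by apply/seteqP; split=> t /= h i; [move=> _|]; exact: h.
congr (_ _); apply/seteqP; split=> -[x t]/=.
  by move=> h; split=> [|i]; [have := h ord0 | have := h (lift ord0 i)];
    rewrite ?tnthS.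
move=> [h0 h] i; case: (unliftP ord0 i) => [j ->|->//].
by rewrite tnthS; exact: h.
Qed.

End iid.

Definition psd (R : realType) k (S : 'M[R]_k) : Prop :=
  S^T = S /\ forall x : 'cV[R]_k, 0 <= (x^T *m S *m x) 0 0.

(* Lower triangular factorization with nonnegative diagonal; it is unique only
   when S is positive definite. *)
Definition is_cholesky (R : realType) k (S L : 'M[R]_k) : Prop :=
  [/\ is_trig_mx L, forall i, 0 <= L i i & L *m L^T = S].

Lemma cholesky_exists (R : realType) k (S : 'M[R]_k) :
  psd S -> exists L, is_cholesky S L.
Proof.
elim: k S => [|k IHk] S.
  move=> _; exists 0; split; [|by case|].
    by apply/is_trig_mxP => -[].
  by apply/matrixP => -[].
rewrite -[k.+1]/(1 + k)%N in S *.
move=> [symS posS].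
pose a := S 0 0; pose v := dlsubmx S; pose T := drsubmx S.
have defS : S = block_mx a%:M v^T v T.
  rewrite -[LHS]submxK; congr block_mx => //.
    by apply/matrixP => i j; rewrite !ord1 !mxE /a mulr1n; congr (S _ _); apply/val_inj.
  by rewrite /v trmx_dlsub symS.
have symT : T^T = T by rewrite /T trmx_drsub symS.
have quad (t : R) (y : 'cV[R]_k) :
    0 <= t ^+ 2 * a + (t * (v^T *m y) 0 0) *+ 2 + (y^T *m T *m y) 0 0.
  have := posS (col_mx t%:M y).
  rewrite defS tr_col_mx tr_scalar_mx mul_row_block mul_row_col !mulmxDl.
  rewrite -!scalar_mxM !mul_scalar_mx -!scalemxAl.
  have -> : y^T *m v *m t%:M = t *: (v^T *m y).
    by rewrite mul_mx_scalar -[X in _ *: X]trmxK trmx_mul trmxK [in LHS](mx11_scalar (v^T *m y)) tr_scalar_mx -mx11_scalar.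
  rewrite [X in 0 <= X](_ : _ = t ^+ 2 * a + (t * (v^T *m y) 0 0) *+ 2 + (y^T *m T *m y) 0 0) //.
  rewrite [LHS]mxE [X in X + _]mxE [X in _ + X]mxE.
  rewrite [(t * a * t)%:M 0 0]mxE eqxx mulr1n [(t *: (v^T *m y)) 0 0]mxE.
  by ring.
have a_ge0 : 0 <= a.
  have := quad 1 0; rewrite trmx0 !mulmx0 mxE mulr0 mul0rn !addr0 expr1n mul1r //.
have v0 : a = 0 -> v = 0.
  move=> a0.
  have vy0 (y : 'cV[R]_k) : (v^T *m y) 0 0 = 0.
    apply/eqP/negP => /negP vy; have := quad (- ((y^T *m T *m y) 0 0 + 1) / ((v^T *m y) 0 0 *+ 2)) y.
    rewrite a0 mulr0 add0r -mulrnAr mulfVK ?mulrn_eq0//.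
    by rewrite leNgt => /negP; apply; lra.
  have : \sum_i v i 0 ^+ 2 = 0.
    by rewrite -[RHS](vy0 v) mxE; apply: eq_bigr => i _; rewrite [v^T 0 i]mxE expr2.
  move/eqP; rewrite psumr_eq0 => [|i _]; last exact: sqr_ge0.
  move/allP => h; apply/matrixP => i j; rewrite ord1 [RHS]mxE.
  by have := h i (mem_index_enum _); rewrite /= sqrf_eq0 => /eqP.
pose b := Num.sqrt a.
have bb : b * b = a by rewrite -expr2 sqr_sqrtr.
have [w bw w0] : exists2 w, b *: w = v & (b = 0 -> w = 0).
  exists (b^-1 *: v) => [|->]; last by rewrite invr0 scale0r.
  rewrite scalerA; have [b0|b_neq0] := eqVneq b 0; last by rewrite mulfV// scale1r.
  by rewrite v0 ?scaler0// -bb b0 mul0r.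
have [L' [trigL' diagL' defL']] : exists L', is_cholesky (T - w *m w^T) L'.
  apply: IHk; split; first by rewrite linearB /= trmx_mul trmxK symT.
  move=> y; have := quad (- b^-1 * (w^T *m y) 0 0) y.
  rewrite -[in (v^T *m y)]bw linearZ /= -scalemxAl [(b *: (w^T *m y)) 0 0]mxE.
  rewrite mulmxBr mulmxBl [X in _ -> 0 <= X]mxE [X in _ -> 0 <= _ + X]mxE.
  have -> : (y^T *m (w *m w^T) *m y) 0 0 = (w^T *m y) 0 0 ^+ 2.
    have e : y^T *m w = w^T *m y.
      by rewrite -[LHS]trmxK trmx_mul trmxK; apply/matrixP => i j; rewrite !ord1 mxE.
    by rewrite mulmxA e -mulmxA mxE big_ord1 expr2.
  set z := (w^T *m y) 0 0; set q := (y^T *m T *m y) 0 0; rewrite -bb.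
  have [b0|b_neq0] := eqVneq b 0.
    have -> : z = 0 by rewrite /z w0// trmx0 mul0mx mxE.
    by rewrite b0; lra.
  rewrite (_ : _ + _ = q - z ^+ 2) //; by field.
exists (block_mx b%:M 0 w L'); split.
- rewrite is_trig_block_mx // eqxx trigL' /= andbT.
  by apply/is_trig_mxP => i j; rewrite !ord1.
- move=> i; case: (split_ordP i) => j ->.
    by rewrite block_mxEul !ord1 mxE eqxx mulr1n sqrtr_ge0.
  by rewrite block_mxEdr.
- rewrite tr_block_mx mulmx_block tr_scalar_mx trmx0 !mulmx0 !mul0mx !addr0.
  have bwT : b *: w^T = v^T by rewrite -bw linearZ.
  rewrite -scalar_mxM bb mul_scalar_mx mul_mx_scalar bw bwT defL'.
  by rewrite addrC subrK defS.
Qed.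


Definition cholesky (R : realType) k (S : 'M[R]_k) : 'M[R]_k :=
  xget 0 [set L | is_cholesky S L].

Lemma choleskyP (R : realType) k (S : 'M[R]_k) :
  psd S -> is_cholesky S (cholesky S).
Proof. by move=> /cholesky_exists; exact: xgetPex. Qed.

Section gaussian.
Context {R : realType} (k : nat) (S : 'M[R]_k).

Definition gaussian_map (z : k.-tuple (measurableTypeR R)) : 'rV[R]_k :=
  (\row_i tnth z i) *m (cholesky S)^T.

Let measurable_gaussian_map : measurable_fun setT gaussian_map.
Proof.
apply/measurable_fun_mxP => i j.
rewrite (_ : (fun z => _) = fun z : k.-tuple (measurableTypeR R) =>
    \sum_(l < k) tnth z l * (cholesky S)^T l j); last first.
  by apply/funext => z; rewrite !mxE; apply: eq_bigr => l _; rewrite mxE.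
apply: measurable_sum => l; apply: measurable_funM => //.
exact: (@measurable_tnth _ (measurableTypeR R)).
Qed.

HB.instance Definition _ :=
  isMeasurableFun.Build _ _ _ _ gaussian_map measurable_gaussian_map.

(* N(0, S), on row vectors: the law of z L^T, where L L^T = S and z has
   independent standard normal coordinates. This covers singular S, and the law
   depends on the factor L only through L L^T. *)
Definition gaussian : probability 'rV[R]_k R :=
  distribution (iid (normal_prob 0 1) k) gaussian_map.

End gaussian.

Section gaussian_sample.
Context {R : realType} (n k : nat).

Definition mx_of_rows (x : n.-tuple 'rV[R]_k) : 'M[R]_(n, k) :=
  \matrix_(i, j) tnth x i 0 j.

Let measurable_mx_of_rows : measurable_fun setT mx_of_rows.
Proof.
apply/measurable_fun_mxP => i j.
rewrite (_ : (fun x => _) = (fun v : 'rV[R]_k => v 0 j) \o (fun x => tnth x i)).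
  apply: measurableT_comp; first exact: measurable_mx_entry.
  exact: measurable_tnth.
by apply/funext => x; rewrite /= mxE.
Qed.

HB.instance Definition _ :=
  isMeasurableFun.Build _ _ _ _ mx_of_rows measurable_mx_of_rows.

Definition gaussian_sample (S : 'M[R]_k) : probability 'M[R]_(n, k) R :=
  distribution (iid (gaussian S) n) mx_of_rows.

End gaussian_sample.
Arguments gaussian_sample {R} n {k} S.

Definition l2norm (R : realType) k (x : 'cV[R]_k) : R :=
  Num.sqrt (\sum_i x i 0 ^+ 2).

Definition op_norm (R : realType) k (A : 'M[R]_k) : R :=
  sup [set l2norm (A *m x) | x in [set x : 'cV[R]_k | l2norm x <= 1]].

Definition Xi (R : realType) (k : nat) (lambda : R) : set 'M[R]_k :=
  [set S | psd S /\ op_norm S <= lambda].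
Arguments Xi {R} k lambda.

Record symmetric_gauge (R : realType) k (tau : 'rV[R]_k -> R) : Prop := {
  gauge_triangle : forall x y : 'rV[R]_k, tau (x + y) <= tau x + tau y ;
  gauge_scale : forall (a : R) (x : 'rV[R]_k), tau (a *: x) = `|a| * tau x ;
  gauge_eq0 : forall x : 'rV[R]_k, tau x = 0 -> x = 0 ;
  gauge_perm : forall (s : 'S_k) (x : 'rV[R]_k), tau (col_perm s x) = tau x ;
  gauge_sign : forall (e : 'I_k -> bool) (x : 'rV[R]_k),
    tau (\row_j ((-1) ^+ e j * x 0 j)) = tau x
}.

(* s lists in nonincreasing order the square roots of the eigenvalues of A^T A,
   counted with multiplicity. *)
Definition is_singular_values (R : realType) k (A : 'M[R]_k) (s : 'rV[R]_k) :=
  [/\ forall i, 0 <= s 0 i,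
      forall i j : 'I_k, (i <= j)%N -> s 0 j <= s 0 i
    & char_poly (A^T *m A) = \prod_i ('X - (s 0 i ^+ 2)%:P)].

Section sym_char_poly.
Import sesquilinear spectral complex.
Local Notation toC R := (real_complex R).

Lemma sym_char_poly_split (R : realType) k (S : 'M[R]_k) :
  S^T = S -> exists d : 'rV[R]_k, char_poly S = \prod_i ('X - (d 0 i)%:P).
Proof.
move=> symS; pose SC := map_mx (toC R) S.
have hermS : SC \is hermsymmx.
  apply/is_hermitianmxP; rewrite expr0 scale1r; apply/matrixP => i j.
  rewrite !mxE -{1}symS mxE; apply/esym; exact: conjc_real.
have /orthomx_spectralP defS := hermitian_normalmx hermS.
have /mxOverP dreal := hermitian_spectral_diag_real hermS.
set P := spectralmx SC in defS; set dC := spectral_diag SC in defS dreal.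
exists (\row_i complex.Re (dC 0 i)).
apply: (@map_poly_inj _ _ (toC R)).
rewrite map_char_poly -/SC.
have -> : char_poly SC = char_poly (diag_mx dC).
  have uP : P \in unitmx := spectral_unit SC.
  rewrite /char_poly /char_poly_mx {1}defS.
  pose PX := map_mx (@polyC _) P.
  pose PXi := map_mx (@polyC _) (invmx P).
  have PXV : PXi *m PX = 1%:M by rewrite -map_mxM mulVmx// map_mx1.
  rewrite (_ : _ - _ = PXi *m ('X%:M - map_mx (@polyC _) (diag_mx dC)) *m PX).
    by rewrite !det_mulmx mulrAC -det_mulmx PXV det1 mul1r.
  by rewrite mulmxBr mulmxBl !map_mxM mul_mx_scalar -scalemxAl PXV scalemx1.
rewrite char_poly_trig ?diag_mx_is_trig// rmorph_prod; apply: eq_bigr => i _.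
rewrite rmorphB /= map_polyX map_polyC /= !mxE eqxx mulr1n.
by congr ('X - _%:P); rewrite RRe_real.
Qed.
End sym_char_poly.

Lemma singular_values_exist (R : realType) k (A : 'M[R]_k) :
  exists s, is_singular_values A s.
Proof.
have [|d defd] := @sym_char_poly_split R k (A^T *m A).
  by rewrite trmx_mul trmxK.
have d_ge0 i : 0 <= d 0 i.
  have : eigenvalue (A^T *m A) (d 0 i).
    by rewrite eigenvalue_root_char defd (bigD1 i)//= rootM root_XsubC eqxx.
  move=> /eigenvalueP[v Av v_neq0].
  have sq m (u : 'rV[R]_m) : (u *m u^T) 0 0 = \sum_j u 0 j ^+ 2.
    by rewrite mxE; apply: eq_bigr => j _; rewrite mxE expr2.
  have sq_ge0 m (u : 'rV[R]_m) : 0 <= (u *m u^T) 0 0.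
    by rewrite sq sumr_ge0// => j _; exact: sqr_ge0.
  have v_gt0 : 0 < (v *m v^T) 0 0.
    rewrite lt0r sq_ge0 andbT sq psumr_eq0 => [|j _]; last exact: sqr_ge0.
    apply: contra v_neq0 => /allP v0; apply/eqP/rowP => j; rewrite mxE.
    by have := v0 j (mem_index_enum _); rewrite /= sqrf_eq0 => /eqP.
  rewrite -(pmulr_lge0 _ v_gt0).
  have <- : (v *m A^T *m (v *m A^T)^T) 0 0 = d 0 i * (v *m v^T) 0 0.
    by rewrite trmx_mul trmxK mulmxA -[v *m A^T *m A]mulmxA Av -scalemxAl mxE.
  exact: sq_ge0.
pose t := sort (fun x y : R => y <= x) (codom (fun i => Num.sqrt (d 0 i))).
have size_t : size t = k by rewrite size_sort size_codom card_ord.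
exists (\row_i nth 0 t i); split => [i|i j ij|].
- rewrite mxE; have : nth 0 t i \in t by rewrite mem_nth ?size_t.
  by rewrite mem_sort => /codomP[j ->]; exact: sqrtr_ge0.
- rewrite !mxE; apply: (sorted_leq_nth (leT := fun x y : R => y <= x)) => //.
  + by move=> y x z yx zy; exact: le_trans zy yx.
  + by apply: sort_sorted => x y; exact: le_total.
  + by rewrite inE size_t.
  + by rewrite inE size_t.
- rewrite defd; under [RHS]eq_bigr do rewrite mxE.
  rewrite -(big_mkord xpredT (fun i => 'X - (t`_i ^+ 2)%:P)).
  rewrite -[X in \prod_(0 <= i < X) _]size_t.
  rewrite -(big_nth 0 xpredT (fun x => 'X - (x ^+ 2)%:P)).
  rewrite (perm_big _ (permEl (perm_sort _ _))) /= big_map enumT.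
  by apply: eq_bigr => i _; rewrite sqr_sqrtr.
Qed.

Definition singular_values (R : realType) k (A : 'M[R]_k) : 'rV[R]_k :=
  xget 0 [set s | is_singular_values A s].

Lemma singular_valuesP (R : realType) k (A : 'M[R]_k) :
  is_singular_values A (singular_values A).
Proof. by have := singular_values_exist A; exact: xgetPex. Qed.

Definition ui_norm (R : realType) k (tau : 'rV[R]_k -> R) (A : 'M[R]_k) : R :=
  tau (singular_values A).

Section minimax.
Context {R : realType} (n k : nat) (lambda : R) (tau : 'rV[R]_k -> R).

Definition risk (delta : 'M[R]_(n, k) -> 'M[R]_k) (S : 'M[R]_k) : \bar R :=
  'E_(gaussian_sample n S)[fun X => ui_norm tau (delta X - S) ^+ 2].

Definition minimax_risk : \bar R :=
  ereal_inf [set ereal_sup [set risk delta S | S in Xi k lambda] |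
    delta in [set delta : 'M[R]_(n, k) -> 'M[R]_k | measurable_fun setT delta]].

End minimax.
Arguments minimax_risk {R} n {k} lambda tau.

(* Main.v *)
Require Import Defs.
From mathcomp Require Import all_boot all_order all_algebra.
From mathcomp Require Import all_classical all_reals all_analysis.
From mathcomp Require Import measurable_realfun perm zify ring lra.

(** Upper bound: [ui_norm tau A] is at most [tau 1] times the operator norm of
    [A].  For [k >= n] the estimator [0] suffices; for [k < n] the operator norm of
    the error of the sample covariance is controlled by its quadratic form on a net
    of at most [exp (18 k)] points of the unit ball, where that form has exponential
    moments.

    Lower bound: averaging over permutations gives
    [ui_norm tau A >= tau 1 / k * |tr (A^T B)|] whenever [B] has operator norm at
    most one.  Take [S_w = v^2 (1 + d N_w) (1 + d N_w)^T], where [N_w] has independent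
    random signs in its lower left block and is zero elsewhere, and pair the error
    with the symmetrised sign matrix recentred at its posterior mean.  This linear
    functional has operator norm of order [sqrt k], provided that [w] is restricted to
    the sign patterns, a majority by the net argument, for which the sign matrix does.
    The pairing then splits into two-point problems, one for each sign, as in Assouad's
    lemma; since [N_w^2 = 0], [1 + d N_w] acts as a shift and the Hellinger affinities
    are explicit Gaussian integrals.  For [k = 1] two variances are compared. *)

Set Implicit Arguments.
Unset Strict Implicit.
Unset Printing Implicit Defensive.

Import Order.TTheory GRing.Theory Num.Theory.
Import numFieldNormedType.Exports.
Local Open Scope classical_set_scope.
Local Open Scope ring_scope.

(** * Integration *)

(** The lower bound must survive an arbitrary estimator [A]. Centring the signs at their posterior
    mean makes the contribution of [A] cancel once the pairing is averaged over the posterior;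
    posterior variances remain, and the overlap of the densities of two patterns differing in one
    sign bounds them from below whatever the posterior mean is. Of order k^2 signs, divided by the
    norm sqrt k of the functional and by the factor k of the duality, give an error of order lambda
    * d * sqrt k. Hence [d] is of order sqrt (min (k / n) 1 / k), which meets two constraints at
    once: n d^2 <= 1 keeps the affinity of n observations above 1/2, and d sqrt k bounded makes the
    perturbation a contraction, so that [S_w] stays in the class. Gaussian laws are defined through
    a chosen Cholesky factor. The perturbation is therefore lower triangular: uniqueness of the
    factor then makes the law of the sample explicit. The loss is built from chosen singular values
    and is handled only through comparison with measurable functions. *)

Section monotone.
Import HBNNSimple.

(** The supremum over simple functions below the integrand is monotone, whether the integrand is
    measurable or not; this is how the loss is compared with measurable bounds. *)
Lemma ge0_le_integral_nm d (T : measurableType d) (R : realType)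
    (mu : {measure set T -> \bar R}) (f g : T -> \bar R) :
  (forall x, 0 <= f x)%E -> (forall x, f x <= g x)%E ->
  (\int[mu]_x f x <= \int[mu]_x g x)%E.
Proof.
move=> f0 fg; have g0 x : (0 <= g x)%E := le_trans (f0 x) (fg x).
rewrite !ge0_integralTE//; apply: ereal_sup_le => _ /= [h hf <-].
exists h => // x; exact: le_trans (hf x) (fg x).
Qed.

End monotone.

Section density.
Local Open Scope ereal_scope.
Context d (T : measurableType d) (R : realType).
Variables (mu nu : {measure set T -> \bar R}) (p : T -> R).
Hypotheses (mp : measurable_fun setT p) (p0 : forall x, (0 <= p x)%R).
Hypothesis nuE : forall A, measurable A -> nu A = \int[mu]_(x in A) (p x)%:E.

Import HBNNSimple.

Lemma ge0_integral_density (f : T -> \bar R) :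
  measurable_fun setT f -> (forall x, 0 <= f x) ->
  \int[nu]_x f x = \int[mu]_x (f x * (p x)%:E).
Proof.
move=> mf f0; pose h := nnsfun_approx measurableT mf.
have hf x : EFin \o h ^~ x @ \oo --> f x by exact: cvg_nnsfun_approx.
have -> : \int[nu]_x f x = limn (fun n => \int[nu]_x (h n x)%:E).
  rewrite -monotone_convergence//.
  - by apply: eq_integral => y _; apply/esym/cvg_lim => //; exact: hf.
  - by move=> n; exact/measurable_EFinP/measurable_funP.
  - by move=> n y _; rewrite lee_fin.
  - by move=> y _ m n mn; rewrite lee_fin; exact/lefP/nd_nnsfun_approx.
have -> : \int[mu]_x (f x * (p x)%:E) =
    limn (fun n => \int[mu]_x ((h n x)%:E * (p x)%:E)).
  rewrite -monotone_convergence//.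
  - apply: eq_integral => y _; apply/esym/cvg_lim => //.
    by apply: cvgeZr => //; exact: hf.
  - move=> n; apply: emeasurable_funM; last exact/measurable_EFinP.
    exact/measurable_EFinP/measurable_funP.
  - by move=> n y _; rewrite mule_ge0 ?lee_fin.
  - by move=> y _ m n mn; rewrite lee_wpmul2r ?lee_fin//; exact/lefP/nd_nnsfun_approx.
congr (limn _); apply/funext => n.
under eq_integral do rewrite fimfunE -fsumEFin//.
rewrite ge0_integral_fsum//; last 2 first.
- by move=> y; exact/measurable_EFinP/measurable_funM.
- by move=> y x _; rewrite nnfun_muleindic_ge0.
under [RHS]eq_integral => x _.
  rewrite fimfunE -fsumEFin// ge0_mule_fsuml; last first.
    by move=> y; rewrite nnfun_muleindic_ge0.
  over.
rewrite ge0_integral_fsum//; last 2 first.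
- move=> y; apply: emeasurable_funM; last exact/measurable_EFinP.
  exact/measurable_EFinP/measurable_funM.
- by move=> y x _; rewrite mule_ge0 ?lee_fin// -lee_fin nnfun_muleindic_ge0.
apply: eq_fsbigr => r /[!inE] -[t _ <-].
under [LHS]eq_integral do rewrite EFinM.
under [RHS]eq_integral do rewrite EFinM -muleA.
rewrite !ge0_integralZl//; last 5 first.
- by apply: emeasurable_funM; exact/measurable_EFinP.
- by move=> x _; rewrite mule_ge0 ?lee_fin.
- by rewrite lee_fin.
- exact/measurable_EFinP.
- by rewrite lee_fin.
rewrite integral_indic// setIT nuE// integral_mkcond; congr (_ * _).
by apply: eq_integral => x _; rewrite epatch_indic muleC.
Qed.

End density.

Section affine.
Local Open Scope ereal_scope.
Context (R : realType).
Local Notation mu := (@lebesgue_measure R).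

(** The pushforward of Lebesgue measure under x |-> a x + b, multiplied by a, gives each half-open
    interval its length, hence is Lebesgue measure. *)
Lemma ge0_integral_pos_affine (a b : R) (f : R -> \bar R) : (0 < a)%R ->
  measurable_fun setT f -> (forall x, 0 <= f x) ->
  \int[mu]_x f x = a%:E * \int[mu]_x f (a * x + b)%R.
Proof.
move=> a0 mf f0; pose g (x : measurableTypeR R) : measurableTypeR R := (a * x + b)%R.
have mg : measurable_fun setT g.
  by apply: measurable_funD => //; exact: measurable_funM.
pose na : {nonneg R} := NngNum (ltW a0).
pose nu := measure_function_pushforward__canonical__measure_function_Measure mu mg.
transitivity (\int[mscale na nu]_x f x).
  apply: eq_measure_integral => /= A mA _.
  apply: lebesgue_measure_unique => //= _ [[u v]] _ <-.
  rewrite /mscale /= /pushforward.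
  rewrite (_ : _ @^-1` _ =
      [set` Interval (BRight ((u - b) / a)%R) (BRight ((v - b) / a)%R)]); last first.
    apply/seteqP; split => x /=; rewrite !in_itv/= /g.
      by rewrite ltr_pdivrMr// ler_pdivlMr// => /andP[h1 h2]; apply/andP; split; lra.
    by rewrite ltr_pdivrMr// ler_pdivlMr// => /andP[h1 h2]; apply/andP; split; lra.
  rewrite !lebesgue_measure_itv/= !lte_fin ltr_pM2r ?invr_gt0// ltrD2r.
  case: ifP => _; last by rewrite mule0.
  by rewrite -EFinB -EFinM -mulrBl mulrCA mulfV ?gt_eqF// mulr1 [in RHS]opprB addrA subrK EFinB.
rewrite ge0_integral_mscale//; congr (_ * _).
by rewrite ge0_integral_pushforward.
Qed.

Lemma ge0_integral_opp (f : R -> \bar R) :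
  measurable_fun setT f -> (forall x, 0 <= f x) ->
  \int[mu]_x f x = \int[mu]_x f (- x)%R.
Proof.
move=> mf f0.
transitivity (\int[pushforward mu (-%R : _ -> measurableTypeR R)]_x f x).
  by apply: eq_measure_integral => /= A mA _; exact/esym/lebesgue_measureN.
by rewrite ge0_integral_pushforward.
Qed.

End affine.

(** * The standard normal distribution *)

Section std_normal.
Local Open Scope ereal_scope.
Context (R : realType).
Local Notation mu := (@lebesgue_measure R).
Local Notation gam := (normal_prob (0 : R) 1).
Implicit Types (f : R -> \bar R) (b m t w s : R).

Let phi (x : R) : R := normal_pdf 0 1 x.

Let phiE x : phi x = (normal_peak 1 * expR (- (x ^+ 2 / 2)))%R.
Proof.
by rewrite /phi normal_pdfE ?oner_neq0// /normal_fun subr0 expr1n mulNr.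
Qed.

Let integral_gam f : measurable_fun setT f -> (forall x, 0 <= f x) ->
  \int[gam]_x f x = \int[mu]_x (f x * (phi x)%:E).
Proof.
move=> mf f0; apply: ge0_integral_density => //.
- exact: measurable_normal_pdf.
- by move=> x; exact: normal_pdf_ge0.
Qed.

(** The weight is the likelihood ratio of N(0, b^-2) with respect to N(0, 1). *)
Lemma integral_normal_scale b f : (0 < b)%R ->
  measurable_fun setT f -> (forall x, 0 <= f x) ->
  \int[gam]_x f (x / b)%R =
  \int[gam]_x (f x * (b * expR ((1 - b ^+ 2) / 2 * x ^+ 2))%:E).
Proof.
move=> b0 mf f0.
have mb : measurable_fun setT (fun x : R => b * expR ((1 - b ^+ 2) / 2 * x ^+ 2))%R.
  apply: measurable_funM => //; apply: measurableT_comp => //.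
  by apply: measurable_funM => //; exact: measurable_funX.
have mphi : measurable_fun setT phi by exact: measurable_normal_pdf.
have mfb : measurable_fun setT (fun x : R => f (x / b)%R).
  by apply: (measurableT_comp mf); exact: measurable_funM.
rewrite !integral_gam//; last 2 first.
- by apply: emeasurable_funM => //; exact/measurable_EFinP.
- by move=> x; rewrite mule_ge0// lee_fin mulr_ge0 ?expR_ge0// ltW.
rewrite (@ge0_integral_pos_affine _ b 0)//; last 2 first.
- by apply: emeasurable_funM => //; exact/measurable_EFinP.
- by move=> x; rewrite mule_ge0// lee_fin normal_pdf_ge0.
rewrite -ge0_integralZl//; last 3 first.
- apply: (measurableT_comp (f := fun x : R => f (x / b)%R * (phi x)%:E)).
    by apply: emeasurable_funM => //; exact/measurable_EFinP.
  by apply: measurable_funD => //; exact: measurable_funM.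
- by move=> x _; rewrite mule_ge0// lee_fin normal_pdf_ge0.
- by rewrite lee_fin ltW.
apply: eq_integral => x _.
rewrite addr0 mulrAC mulfV ?gt_eqF// mul1r muleCA -!muleA -!EFinM; congr (_ * _%:E).
rewrite !phiE; set y := (x : R).
have -> : (- ((b * y) ^+ 2 / 2) = (1 - b ^+ 2) / 2 * y ^+ 2 + - (y ^+ 2 / 2))%R by field.
by rewrite expRD; ring.
Qed.

(** The Cameron-Martin formula on the line; a constant [f] gives the moment generating function. *)
Lemma integral_normal_shift m f :
  measurable_fun setT f -> (forall x, 0 <= f x) ->
  \int[gam]_x f (x + m)%R = \int[gam]_x (f x * (expR (x * m - m ^+ 2 / 2))%:E).
Proof.
move=> mf f0.
have mb : measurable_fun setT (fun x : R => expR (x * m - m ^+ 2 / 2))%R.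
  apply: measurableT_comp => //.
  by apply: measurable_funB => //; exact: measurable_funM.
have mphi : measurable_fun setT phi by exact: measurable_normal_pdf.
have mfb : measurable_fun setT (fun x : R => f (x + m)%R).
  by apply: (measurableT_comp mf); exact: measurable_funD.
rewrite !integral_gam//; last 2 first.
- by apply: emeasurable_funM => //; exact/measurable_EFinP.
- by move=> x; rewrite mule_ge0// lee_fin expR_ge0.
rewrite (@ge0_integral_pos_affine _ 1 (- m))//; last 2 first.
- by apply: emeasurable_funM => //; exact/measurable_EFinP.
- by move=> x; rewrite mule_ge0// lee_fin normal_pdf_ge0.
rewrite mul1e; apply: eq_integral => x _.
rewrite mul1r subrK -!muleA -!EFinM; congr (_ * _%:E).
rewrite !phiE; set y := (x : R).
have -> : (- ((y - m) ^+ 2 / 2) = (y * m - m ^+ 2 / 2) + - (y ^+ 2 / 2))%R by field.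
by rewrite expRD; ring.
Qed.

Lemma integral_normal_opp f :
  measurable_fun setT f -> (forall x, 0 <= f x) ->
  \int[gam]_x f (- x)%R = \int[gam]_x f x.
Proof.
move=> mf f0.
have mphi : measurable_fun setT phi by exact: measurable_normal_pdf.
have mfb : measurable_fun setT (fun x : R => f (- x)%R) by exact: measurableT_comp.
rewrite !integral_gam// ge0_integral_opp//; last 2 first.
- by apply: emeasurable_funM => //; exact/measurable_EFinP.
- by move=> x; rewrite mule_ge0// lee_fin normal_pdf_ge0.
by apply: eq_integral => x _; rewrite opprK !phiE sqrrN.
Qed.

Let integral1 : \int[gam]_x 1 = 1.
Proof. by rewrite integral_cst// mul1e; exact: probability_setT. Qed.

Lemma normal_mgf t : \int[gam]_x (expR (t * x))%:E = (expR (t ^+ 2 / 2))%:E.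
Proof.
have m1 : measurable_fun setT (fun x : R => expR (x * t - t ^+ 2 / 2))%R.
  apply: measurableT_comp => //.
  by apply: measurable_funB => //; exact: measurable_funM.
have := @integral_normal_shift t (cst 1) (measurable_cst _) (fun=> lee01).
rewrite integral1.
under [in RHS]eq_integral do rewrite mul1e.
move=> e; rewrite -[RHS]mule1 e -ge0_integralZl//; last first.
  exact/measurable_EFinP.
by apply: eq_integral => x _; rewrite -EFinM -expRD; congr (expR _)%:E; ring.
Qed.

Lemma normal_exp_sqr b : (0 < b)%R ->
  \int[gam]_x (expR ((1 - b ^+ 2) / 2 * x ^+ 2))%:E = (b^-1)%:E.
Proof.
move=> b0.
have m1 : measurable_fun setT (fun x : R => expR ((1 - b ^+ 2) / 2 * x ^+ 2))%R.
  apply: measurableT_comp => //.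
  by apply: measurable_funM => //; exact: measurable_funX.
have := @integral_normal_scale b (cst 1) b0 (measurable_cst _) (fun=> lee01).
rewrite integral1.
under [in RHS]eq_integral do rewrite mul1e EFinM.
rewrite ge0_integralZl//; last 2 first.
- exact/measurable_EFinP.
- by rewrite lee_fin ltW.
by move=> e; rewrite -[RHS]mule1 e muleA -EFinM mulVf ?gt_eqF// mul1e.
Qed.

(** Squeezed through exp y >= 1 + y: the exact integral of exp ((1 - b^2) / 2 * x^2) bounds the
    moment by 2 / (b * (1 + b)), from above for b < 1 and from below for b > 1, and b tends to 1. *)
Lemma normal_second_moment : \int[gam]_x (x ^+ 2)%:E = 1.
Proof.
set v := (X in X = _).
have msq : measurable_fun setT (fun x : R => (x ^+ 2)%:E).
  by apply/measurable_EFinP; exact: measurable_funX.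
have v0 : 0 <= v by apply: integral_ge0 => x _; rewrite lee_fin sqr_ge0.
have lin (c : R) : (0 <= c)%R -> \int[gam]_x (1 + c * x ^+ 2)%:E = 1 + c%:E * v.
  move=> c0; under eq_integral do rewrite EFinD EFinM.
  rewrite ge0_integralD//; last 2 first.
  - by move=> x _; rewrite mule_ge0 ?lee_fin ?sqr_ge0.
  - exact: measurable_funeM.
  rewrite integral1 ge0_integralZl// => x _.
  by rewrite lee_fin sqr_ge0.
have mexp (b : R) : measurable_fun setT (fun x : R => (expR ((1 - b ^+ 2) / 2 * x ^+ 2))%:E).
  apply/measurable_EFinP; apply: measurableT_comp => //.
  by apply: measurable_funM => //; exact: measurable_funX.
have ub (b : R) : (0 < b < 1)%R -> v <= (2 / (b * (1 + b)))%:E.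
  move=> /andP[b0 b1].
  have c0 : (0 < (1 - b ^+ 2) / 2)%R.
    by rewrite divr_gt0// subr_gt0 expr_lt1// ltW.
  have : 1 + ((1 - b ^+ 2) / 2)%:E * v <= b^-1%:E.
    rewrite -lin; last exact: ltW.
    rewrite -(normal_exp_sqr b0); apply: ge0_le_integral_nm => x; rewrite lee_fin.
      by rewrite addr_ge0// mulr_ge0 ?sqr_ge0// ltW.
    exact: expR_ge1Dx.
  case: (v) v0 => [r| |]//=; last by rewrite gt0_muley ?lte_fin// addey.
  rewrite !lee_fin => r0 h; rewrite ler_pdivlMr ?mulr_gt0 ?addr_gt0//.
  have : (b * (1 + (1 - b ^+ 2) / 2 * r) <= 1)%R by rewrite mulrC -ler_pdivlMr// div1r.
  move=> {}h; rewrite -(@ler_pM2l _ (1 - b)%R) ?subr_gt0//.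
  have : (b * (1 - b ^+ 2) * r <= 2 * (1 - b))%R by lra.
  by rewrite (_ : b * _ * r = (1 - b) * (r * (b * (1 + b))))%R; [lra|ring].
have lb (b : R) : (1 < b)%R -> (2 / (b * (1 + b)))%:E <= v.
  move=> b1; have b0 : (0 < b)%R by apply: lt_trans b1.
  have c0 : (0 < (b ^+ 2 - 1) / 2)%R.
    by rewrite divr_gt0// subr_gt0 expr_gt1// ltW.
  have : 1 <= ((b ^+ 2 - 1) / 2)%:E * v + b^-1%:E.
    rewrite -(normal_exp_sqr b0) -ge0_integralZl//; last 2 first.
    - by move=> x _; rewrite lee_fin sqr_ge0.
    - by rewrite lee_fin ltW.
    rewrite -ge0_integralD//; last 3 first.
    - by move=> x _; apply: mule_ge0; rewrite lee_fin ?sqr_ge0// ltW.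
    - exact: measurable_funeM.
    - exact: mexp.
    rewrite -[leLHS]integral1; apply: ge0_le_integral_nm => x; first exact: (@lee01 R).
    rewrite -EFinM -EFinD lee_fin.
    by have := expR_ge1Dx ((1 - b ^+ 2) / 2 * x ^+ 2); lra.
  case: (v) v0 => [r| |]//=; last by move=> _ _; rewrite leey.
  rewrite !lee_fin => r0 h; rewrite ler_pdivrMr ?mulr_gt0 ?addr_gt0//.
  have : (b <= b * ((b ^+ 2 - 1) / 2 * r + b^-1))%R by rewrite ler_peMr// ltW.
  rewrite mulrDr mulfV ?gt_eqF// => {}h.
  rewrite -(@ler_pM2l _ (b - 1)%R) ?subr_gt0//.
  have : (2 * (b - 1) <= b * (b ^+ 2 - 1) * r)%R by lra.
  by rewrite (_ : b * _ * r = (b - 1) * (r * (b * (1 + b))))%R; [lra|ring].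
apply/eqP; rewrite eq_le; apply/andP; split.
(* b = 1/2 shows that the moment is finite; a finite value r > 1 is then refuted at b = 1 - e. *)
- have ub2 : v <= (2 / (2^-1 * (1 + 2^-1)))%:E by apply: ub; apply/andP; split; lra.
  move: ub ub2.
  case: (v) v0 => [r| |]//= r0 ub _; rewrite lee_fin leNgt; apply/negP => r1.
  pose e : R := (Num.min (1 / 2) ((r - 1) / (4 * r)))%R.
  have e0 : (0 < e)%R by rewrite lt_min; apply/andP; split; [lra|rewrite divr_gt0//; lra].
  have e1 : (e <= 1 / 2)%R by rewrite ge_min lexx.
  have e2 : (e * (4 * r) <= r - 1)%R.
    by rewrite -ler_pdivlMr ?ge_min ?lexx ?orbT//; lra.
  have := ub (1 - e)%R; rewrite lee_fin ler_pdivlMr; last by rewrite mulr_gt0//; lra.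
  by move=> /(_ _)/wrap[]; [apply/andP; split; lra|nra].
- move: lb.
  case: (v) v0 => [r| |]//= r0 lb; last by rewrite leey.
  rewrite lee_fin leNgt; apply/negP => r1; rewrite lee_fin in r0.
  pose e : R := ((1 - r) / 4)%R.
  have e0 : (0 < e)%R by rewrite divr_gt0// subr_gt0.
  have e1 : (e <= 1 / 4)%R by rewrite /e; lra.
  have := lb (1 + e)%R; rewrite lee_fin ler_pdivrMr; last by rewrite mulr_gt0//; lra.
  by move=> /(_ _)/wrap[]; [lra|rewrite /e; nra].
Qed.

(** Adding the integral to its image under x |-> - x cancels the cross term, so that only
    nonnegative functions are integrated. *)
Lemma normal_second_moment_affine w s :
  \int[gam]_x ((w * x + s) ^+ 2)%:E = (w ^+ 2 + s ^+ 2)%:E.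
Proof.
have mf : forall c : R, measurable_fun setT (fun x : R => ((c * x + s) ^+ 2)%:E).
  by move=> c; apply/measurable_EFinP; apply: measurable_funX; apply: measurable_funD => //.
have sq_ge0 (x : R) : 0 <= (x ^+ 2)%:E by rewrite lee_fin sqr_ge0.
have msq : measurable_fun setT (fun x : R => (x ^+ 2)%:E).
  by apply/measurable_EFinP; exact: measurable_funX.
have h : \int[gam]_x ((w * x + s) ^+ 2)%:E + \int[gam]_x ((w * x + s) ^+ 2)%:E =
    (2 * (w ^+ 2 + s ^+ 2))%:E.
  rewrite -[X in _ + X](integral_normal_opp (mf w))//.
  rewrite -ge0_integralD//; [|exact: mf|exact: (measurableT_comp (mf w))].
  transitivity (\int[gam]_x ((2 * w ^+ 2)%:E * (x ^+ 2)%:E + (2 * s ^+ 2)%:E)).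
    by apply: eq_integral => x _; rewrite -EFinD -EFinM -EFinD; congr EFin; ring.
  rewrite ge0_integralD//; last 3 first.
  - by move=> x _; rewrite mule_ge0// lee_fin mulr_ge0// sqr_ge0.
  - exact: measurable_funeM.
  - by move=> x _; rewrite lee_fin mulr_ge0// sqr_ge0.
  rewrite ge0_integralZl//; last by rewrite lee_fin mulr_ge0// sqr_ge0.
  rewrite normal_second_moment mule1 integral_cst//.
  rewrite [X in _ * X](_ : _ = 1); last exact: (@probability_setT _ _ _ gam).
  by rewrite mule1 -EFinD; congr EFin; ring.
move: h; have : 0 <= \int[gam]_x ((w * x + s) ^+ 2)%:E by exact: integral_ge0.
case: (integral _ _ _) => [r| |]//= _.
by rewrite -EFinD => -[] h; congr EFin; lra.
Qed.

End std_normal.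

(** * Independent samples *)

Section iid_integral.
Local Open Scope ereal_scope.
Context d (T : measurableType d) (R : realType).
Implicit Types P Q : probability T R.

Lemma measurable_cons_tuple2 n :
  measurable_fun setT (fun z : T * n.-tuple T => Defs.cons_tuple z).
Proof. by apply: (@measurable_cons _ _ _ _ fst n snd). Qed.

Lemma measurable_cons_tuple_r n (x : T) :
  measurable_fun setT (fun t : n.-tuple T => Defs.cons_tuple (x, t)).
Proof. by apply: (@measurable_cons _ _ _ _ (cst x) n id). Qed.

Lemma tnth_cons_tuple0 n (x : T) (t : n.-tuple T) :
  tnth (Defs.cons_tuple (x, t)) ord0 = x.
Proof. by []. Qed.

Lemma tnth_cons_tupleS n (x : T) (t : n.-tuple T) i :
  tnth (Defs.cons_tuple (x, t)) (lift ord0 i) = tnth t i.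
Proof. by rewrite tnthS. Qed.

Lemma integral_iid0 P (F : 0.-tuple T -> \bar R) :
  measurable_fun setT F -> \int[iid P 0]_t F t = F [tuple].
Proof.
move=> mF; transitivity (\int[\d_ [tuple]]_t F t) => //.
by rewrite integral_dirac// diracE mem_set// mul1e.
Qed.

Lemma integral_iidS P n (F : n.+1.-tuple T -> \bar R) :
  measurable_fun setT F -> (forall t, 0 <= F t) ->
  \int[iid P n.+1]_t F t = \int[P]_x \int[iid P n]_t F (Defs.cons_tuple (x, t)).
Proof.
move=> mF F0.
transitivity (\int[distribution (P \x iid P n) (@Defs.cons_tuple _ T n)]_t F t) => //.
rewrite ge0_integral_distribution// fubini_tonelli1//; last first.
  by move=> z; exact: F0.
exact: (measurableT_comp mF (@measurable_cons_tuple2 n)).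
Qed.

Lemma measurable_integral_iid_cons P n (F : n.+1.-tuple T -> \bar R) :
  measurable_fun setT F -> (forall t, 0 <= F t) ->
  measurable_fun setT (fun x => \int[iid P n]_t F (Defs.cons_tuple (x, t))).
Proof.
move=> mF F0.
apply: (@measurable_fun_fubini_tonelli_F _ _ _ _ _ (iid P n)
  (fun z => F (Defs.cons_tuple z))) => //.
exact: (measurableT_comp mF (@measurable_cons_tuple2 n)).
Qed.

Lemma measurable_prod_tnth n (f : 'I_n -> T -> R) :
  (forall i, measurable_fun setT (f i)) ->
  measurable_fun setT (fun t : n.-tuple T => \prod_(i < n) f i (tnth t i))%R.
Proof.
move=> mf; apply: measurable_prod => i _.
exact: (measurableT_comp (mf i) (@measurable_tnth _ T n i)).
Qed.

Lemma integral_iid_prod P n (f : 'I_n -> T -> R) :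
  (forall i, measurable_fun setT (f i)) -> (forall i x, 0 <= f i x)%R ->
  \int[iid P n]_t (\prod_(i < n) f i (tnth t i))%:E =
  \prod_(i < n) \int[P]_x (f i x)%:E.
Proof.
elim: n f => [|n IHn] f mf f0.
  rewrite integral_iid0 ?big_ord0//.
  by apply/measurable_EFinP; exact: measurable_prod_tnth.
rewrite integral_iidS; last 2 first.
- by apply/measurable_EFinP; exact: measurable_prod_tnth.
- by move=> t; rewrite lee_fin prodr_ge0.
rewrite big_ord_recl -IHn//.
set c := (X in _ = _ * X).
rewrite muleC -ge0_integralZl//; last 3 first.
- exact/measurable_EFinP.
- by move=> x _; rewrite lee_fin.
- by apply: integral_ge0 => t _; rewrite lee_fin prodr_ge0.
apply: eq_integral => x _.
rewrite muleC -ge0_integralZl//; last 3 first.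
- by apply/measurable_EFinP; exact: (measurable_prod_tnth (fun i => mf (lift ord0 i))).
- by move=> t _; rewrite lee_fin prodr_ge0.
- by rewrite lee_fin.
apply: eq_integral => t _; rewrite big_ord_recl -EFinM tnth_cons_tuple0.
by congr (_ * _)%:E; apply: eq_bigr => i _; rewrite tnth_cons_tupleS.
Qed.

Lemma integral_iid_density P Q (f : T -> R) n (F : n.-tuple T -> \bar R) :
  measurable_fun setT f -> (forall x, 0 <= f x)%R ->
  (forall G : T -> \bar R, measurable_fun setT G -> (forall x, 0 <= G x) ->
    \int[P]_x G x = \int[Q]_x (G x * (f x)%:E)) ->
  measurable_fun setT F -> (forall t, 0 <= F t) ->
  \int[iid P n]_t F t =
  \int[iid Q n]_t (F t * (\prod_(i < n) f (tnth t i))%:E).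
Proof.
move=> mf f0 PQ.
have mp k : measurable_fun setT (fun t : k.-tuple T => \prod_(i < k) f (tnth t i))%R.
  exact: (measurable_prod_tnth (fun=> mf)).
elim: n F => [|n IHn] F mF F0.
  rewrite !integral_iid0 ?big_ord0 ?mule1//.
  by apply: emeasurable_funM => //; apply/measurable_EFinP; exact: mp.
rewrite !integral_iidS//; last 2 first.
- by apply: emeasurable_funM => //; apply/measurable_EFinP; exact: mp.
- by move=> t; rewrite mule_ge0// lee_fin prodr_ge0.
rewrite PQ; last 2 first.
- exact: measurable_integral_iid_cons.
- by move=> x; exact: integral_ge0.
apply: eq_integral => x _.
have mFx : measurable_fun setT (fun t : n.-tuple T => F (Defs.cons_tuple (x, t))).
  exact: (measurableT_comp mF (@measurable_cons_tuple_r n x)).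
rewrite IHn// muleC -ge0_integralZl//; last 3 first.
- by apply: emeasurable_funM => //; apply/measurable_EFinP; exact: mp.
- by move=> t _; rewrite mule_ge0// lee_fin prodr_ge0.
- by rewrite lee_fin.
apply: eq_integral => t _; rewrite big_ord_recl tnth_cons_tuple0 EFinM muleCA.
by congr (_ * (_ * _%:E)); apply: eq_bigr => i _; rewrite tnth_cons_tupleS.
Qed.

End iid_integral.

(** * Gaussian vectors *)

Section exp_bounds.
Context (R : realType).
Implicit Types x y u q t : R.

(** The terms 1 + y are kept exact, so that for a centred variable the linear one integrates to
    zero. *)
Lemma expR_le_quad y : expR y <= 1 + y + y ^+ 2 * expR `|y|.
Proof.
have [y0|y0] := lerP 0 y.
  have h1 : 1 - y <= expR (- y) by exact: expR_ge1Dx.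
  have e0 := expR_gt0 y.
  have h2 : expR y * expR (- y) = 1 by rewrite -expRD subrr expR0.
  have h3 : expR y * (1 - y) <= 1 by rewrite -[leRHS]h2 ler_pM2l.
  have h4 : y * (expR y * (1 - y)) <= y * 1 by apply: ler_wpM2l.
  by rewrite (ger0_norm y0); lra.
pose v := - y; have v0 : 0 < v by rewrite /v oppr_gt0.
have -> : y = - v by rewrite /v opprK.
have h1 : 1 + v <= expR v by exact: expR_ge1Dx.
have e1 : 1 <= expR v by lra.
have h2 : expR v * expR (- v) = 1 by rewrite -expRD subrr expR0.
have e0 := expR_gt0 (- v).
have h3 : (1 + v) * expR (- v) <= 1 by rewrite -[leRHS]h2 ler_pM2r.
have h4 : expR (- v) <= 1 - v + v ^+ 2.
  rewrite -(@ler_pM2l _ (1 + v)); last by lra.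
  by apply: le_trans h3 _; nra.
rewrite sqrrN; apply: le_trans h4 _; rewrite lerD2l ler_peMr ?sqr_ge0//.
by rewrite normrN (gtr0_norm v0).
Qed.

Lemma sqr_le_4expR x : 0 <= x -> x ^+ 2 <= 4 * expR x.
Proof.
move=> x0; have h : 1 + x / 2 <= expR (x / 2) by exact: expR_ge1Dx.
have e : expR x = expR (x / 2) * expR (x / 2) by rewrite -expRD; congr expR; lra.
have : (1 + x / 2) * (1 + x / 2) <= expR x by rewrite e ler_pM//; lra.
have := sqr_ge0 x; nra.
Qed.

Lemma expR_half_le2 : expR (2^-1 : R) <= 2.
Proof.
have h : 1 - 2^-1 <= expR (- 2^-1 : R) by exact: expR_ge1Dx.
have h2 : expR (2^-1 : R) * expR (- 2^-1) = 1 by rewrite -expRD subrr expR0.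
have e0 := expR_gt0 (2^-1 : R); nra.
Qed.

Lemma expR1_le4 : expR (1 : R) <= 4.
Proof.
have -> : (1 : R) = 2^-1 + 2^-1 by lra.
have := expR_half_le2; have := expR_gt0 (2^-1 : R); rewrite expRD; nra.
Qed.

(** Sub-Gaussian bound for a random sign, with 4 where the sharp exponent has 1/2. For |x| <= 1 the
    linear terms of the two quadratic bounds cancel; beyond that |x| <= 4 x^2. *)
Lemma cosh_le x : expR x + expR (- x) <= 2 * expR (4 * x ^+ 2).
Proof.
have [x1|x1] := lerP `|x| 1.
  have := expR_le_quad x; have := expR_le_quad (- x); rewrite normrN sqrrN => h1 h2.
  have h3 : expR `|x| <= 4 by apply: le_trans expR1_le4; rewrite ler_expR.
  have h4 := @expR_ge1Dx _ (4 * x ^+ 2).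
  have := sqr_ge0 x; nra.
have x2 : `|x| <= 4 * x ^+ 2 by rewrite -real_normK ?num_real//; nra.
rewrite mulr_natl mulr2n lerD// ler_expR (le_trans _ x2)//.
  exact: ler_norm.
by rewrite -normrN ler_norm.
Qed.

(** Meant for [u] the square of a normal variable and [q] its mean. Since |t| <= 1/8, the remainder
    is absorbed by exp (u / 4), which is still integrable; 512 = 64 * 4 * 2 collects the losses in u
    + 1 = 8 v, in v^2 <= 4 exp v and in exp (2 v) <= 2 exp (u / 4). *)
Lemma expR_centered u q t : 0 <= u -> 0 <= q <= 1 -> `|t| <= 8^-1 ->
  expR (t * (u - q)) <= 1 + t * (u - q) + 512 * t ^+ 2 * expR (u / 4).
Proof.
move=> u0 /andP[q0 q1] t8; apply: le_trans (expR_le_quad _) _; rewrite lerD2l.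
have uq : `|u - q| <= u + 1 by rewrite ler_norml; apply/andP; split; lra.
pose v := (u + 1) / 8.
have v0 : 0 <= v by rewrite /v; lra.
have h1 : `|t * (u - q)| <= v.
  by rewrite normrM /v mulrC ler_pM.
have h2 : (u - q) ^+ 2 <= (u + 1) ^+ 2.
  by rewrite -real_normK ?num_real// lerXn2r ?nnegrE//; lra.
have h3 := sqr_le_4expR v0.
have h4 : expR `|t * (u - q)| <= expR v by rewrite ler_expR.
have h5 : expR v * expR v <= 2 * expR (u / 4).
  rewrite -expRD (_ : v + v = u / 4 + 4^-1); last by rewrite /v; lra.
  rewrite expRD mulrC ler_wpM2r ?expR_ge0//.
  by apply: le_trans expR_half_le2; rewrite ler_expR; lra.
rewrite [in leLHS]exprMn -[leLHS]mulrA (mulrC 512) -[leRHS]mulrA ler_wpM2l ?sqr_ge0//.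
have h6 : (u + 1) ^+ 2 = 64 * v ^+ 2 by rewrite /v; field.
apply: (@le_trans _ _ (64 * (4 * expR v) * expR v)); last by lra.
rewrite ler_pM ?sqr_ge0 ?expR_ge0//; lra.
Qed.

End exp_bounds.

Lemma integral_cst_probability d (T : measurableType d) (R : realType)
    (P : probability T R) (c : \bar R) : (\int[P]__ c = c)%E.
Proof.
rewrite integral_cst// [X in (_ * X)%E](_ : _ = 1%E) ?mule1//.
exact: (@probability_setT _ _ _ P).
Qed.

Section gaussian_vector.
Local Open Scope ereal_scope.
Context (R : realType).
Local Notation gam := (normal_prob (0 : R) 1).
Local Notation tup k := (k.-tuple (measurableTypeR R)).

Lemma measurable_lin k (w : 'I_k -> R) :
  measurable_fun setT (fun z : tup k => \sum_(i < k) w i * tnth z i)%R.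
Proof.
apply: measurable_sum => i; apply: measurable_funM => //.
exact: (@measurable_tnth _ (measurableTypeR R)).
Qed.

Lemma gauss_second_moment k (s : R) (w : 'I_k -> R) :
  \int[iid gam k]_z ((s + \sum_(i < k) w i * tnth z i) ^+ 2)%:E =
  (s ^+ 2 + \sum_(i < k) w i ^+ 2)%:E.
Proof.
elim: k s w => [|k IHk] s w.
  rewrite integral_iid0 ?big_ord0 ?addr0 ?big_ord0 ?addr0//.
  apply/measurable_EFinP/measurable_funX/measurable_funD => //.
  exact: measurable_lin.
rewrite integral_iidS; last 2 first.
- apply/measurable_EFinP/measurable_funX/measurable_funD => //.
  exact: measurable_lin.
- by move=> t; rewrite lee_fin sqr_ge0.
transitivity (\int[gam]_x (((w ord0 * x + s) ^+ 2)%:E +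
    (\sum_(i < k) w (lift ord0 i) ^+ 2)%:E)).
  apply: eq_integral => x _; rewrite -EFinD.
  have -> : (w ord0 * x + s = s + w ord0 * x)%R by rewrite addrC.
  rewrite -(IHk _ (fun i => w (lift ord0 i))).
  apply: eq_integral => t _; rewrite big_ord_recl tnth_cons_tuple0 addrA.
  by under eq_bigr do rewrite tnth_cons_tupleS.
have sge0 : (0 <= \sum_(i < k) w (lift ord0 i) ^+ 2)%R.
  by apply: sumr_ge0 => i _; rewrite sqr_ge0.
rewrite ge0_integralD//; last 2 first.
- by move=> x _; rewrite lee_fin sqr_ge0.
- apply/measurable_EFinP/measurable_funX/measurable_funD => //.
rewrite normal_second_moment_affine integral_cst//.
rewrite [X in _ * X](_ : _ = 1); last exact: (@probability_setT _ _ _ gam).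
by rewrite mule1 -EFinD big_ord_recl; congr EFin; ring.
Qed.

Lemma gauss_mgf k (a : R) (w : 'I_k -> R) :
  \int[iid gam k]_z (expR (a * \sum_(i < k) w i * tnth z i))%:E =
  (expR (a ^+ 2 / 2 * \sum_(i < k) w i ^+ 2))%:E.
Proof.
transitivity (\int[iid gam k]_z (\prod_(i < k) expR (a * w i * tnth z i))%:E).
  apply: eq_integral => z _; rewrite mulr_sumr expR_sum; congr EFin.
  by apply: eq_bigr => i _; rewrite mulrA.
rewrite (integral_iid_prod gam (f := fun i x => expR (a * w i * x)))//; last first.
  by move=> i; apply: measurableT_comp => //; exact: measurable_funM.
rewrite mulr_sumr expR_sum -prodEFin; apply: eq_bigr => i _.
by rewrite normal_mgf; congr (expR _)%:E; field.
Qed.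

Lemma gauss_exp_sqr k (w : 'I_k -> R) : (\sum_(i < k) w i ^+ 2 <= 1)%R ->
  \int[iid gam k]_z (expR ((\sum_(i < k) w i * tnth z i) ^+ 2 / 4))%:E <= 2%:E.
Proof.
move=> w1; pose c : R := Num.sqrt 2^-1.
have c2 : (c ^+ 2 = 2^-1)%R by rewrite sqr_sqrtr.
have c0 : (0 < c)%R by rewrite sqrtr_gt0.
pose S (z : tup k) : R := (\sum_(i < k) w i * tnth z i)%R.
have mS : measurable_fun setT S by exact: measurable_lin.
(* [exp (s^2/4)] is the Laplace transform of a normal variable at [s / sqrt 2] *)
apply: (@le_trans _ _ (\int[iid gam k]_z \int[gam]_x (expR (c * S z * x))%:E)).
  apply: ge0_le_integral_nm => z; first by rewrite lee_fin expR_ge0.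
  by rewrite normal_mgf exprMn c2 lee_fin ler_expR /S; lra.
have mE : measurable_fun setT (fun p : tup k * measurableTypeR R =>
    (expR (c * S p.1 * p.2))%:E).
  apply/measurable_EFinP; apply: measurableT_comp => //.
  apply: measurable_funM => //; apply: measurable_funM => //.
  exact: measurableT_comp.
have := @fubini_tonelli _ _ _ _ _ (iid gam k) gam _ mE (fun=> expR_ge0 _).
rewrite /fubini_F /fubini_G /= => ->.
(* Here (1 - c^2) / 2 = 1/4, so the last integral is 1 / c = sqrt 2. *)
apply: (@le_trans _ _ (\int[gam]_x (expR ((1 - c ^+ 2) / 2 * x ^+ 2))%:E)).
  apply: ge0_le_integral_nm => x.
    by apply: integral_ge0 => z _; rewrite lee_fin expR_ge0.
  rewrite (eq_integral (fun z => (expR (c * x * S z))%:E)); last first.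
    by move=> z _; congr (expR _)%:E; ring.
  rewrite gauss_mgf exprMn c2 lee_fin ler_expR.
  have := sqr_ge0 x; nra.
rewrite normal_exp_sqr// lee_fin invf_ple ?posrE//.
by rewrite leNgt; apply/negP => c1; nra.
Qed.

(** Integrated over [z], the linear term of [expR_centered] vanishes because [q] is the mean of S^2,
    and the bound 2 of [gauss_exp_sqr] turns 512 into 1024. *)
Lemma gauss_centered_sqr_mgf k (w : 'I_k -> R) (t : R) :
  (\sum_(i < k) w i ^+ 2 <= 1)%R -> (`|t| <= 8^-1)%R ->
  \int[iid gam k]_z
     (expR (t * ((\sum_(i < k) w i * tnth z i) ^+ 2 - \sum_(i < k) w i ^+ 2)))%:E
  <= (expR (1024 * t ^+ 2))%:E.
Proof.
move=> w1 t8; set q : R := (\sum_(i < k) w i ^+ 2)%R.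
have q0 : (0 <= q)%R by apply: sumr_ge0 => i _; exact: sqr_ge0.
pose S (z : tup k) : R := (\sum_(i < k) w i * tnth z i)%R.
have mS : measurable_fun setT S by exact: measurable_lin.
have mS2 : measurable_fun setT (fun z => (S z ^+ 2)%:E).
  exact/measurable_EFinP/measurable_funX.
have mES : measurable_fun setT (fun z => (expR (S z ^+ 2 / 4))%:E).
  apply/measurable_EFinP; apply: measurableT_comp => //.
  by apply: measurable_funM => //; exact: measurable_funX.
have mET : measurable_fun setT (fun z => (expR (t * (S z ^+ 2 - q)))%:E).
  apply/measurable_EFinP; apply: measurableT_comp => //.
  by apply: measurable_funM => //; apply: measurable_funB => //; exact: measurable_funX.
have ES2 : \int[iid gam k]_z (S z ^+ 2)%:E = q%:E.
  rewrite -[in RHS](add0r q) -[X in (X + q)%R](expr0n _ 2) -gauss_second_moment.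
  by apply: eq_integral => z _; rewrite add0r.
have EES := gauss_exp_sqr w1.
(* Positive and negative parts of [t]: terms of negative sign are moved to the other side of the
   inequality, so that both sides integrate nonnegative functions. *)
pose a : R := (Num.max t 0)%R; pose b : R := (Num.max (- t) 0)%R.
have a0 : (0 <= a)%R by rewrite le_max lexx orbT.
have b0 : (0 <= b)%R by rewrite le_max lexx orbT.
have tab : (t = a - b)%R by rewrite /a /b; case: (lerP t 0) => ?; case: (lerP (- t) 0) => ?; lra.
have [d dE d0] : exists2 d : R, (d = 512 * t ^+ 2)%R & (0 <= d)%R.
  by exists (512 * t ^+ 2)%R; [reflexivity|have := sqr_ge0 t; lra].
pose LHS z := (expR (t * (S z ^+ 2 - q)))%:E + (a * q)%:E + b%:E * (S z ^+ 2)%:E.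
pose RHS z := (1 + b * q)%:E + a%:E * (S z ^+ 2)%:E
   + d%:E * (expR (S z ^+ 2 / 4))%:E.
have S20 z : 0 <= (S z ^+ 2)%:E by rewrite lee_fin sqr_ge0.
have aq0 : 0 <= (a * q)%:E by rewrite lee_fin mulr_ge0.
have bq0 : 0 <= (1 + b * q)%:E by rewrite lee_fin addr_ge0// mulr_ge0.
have aS0 z : 0 <= a%:E * (S z ^+ 2)%:E by rewrite mule_ge0.
have bS0 z : 0 <= b%:E * (S z ^+ 2)%:E by rewrite mule_ge0.
have maS : measurable_fun setT (fun z => a%:E * (S z ^+ 2)%:E) by exact: measurable_funeM.
have mbS : measurable_fun setT (fun z => b%:E * (S z ^+ 2)%:E) by exact: measurable_funeM.
have cst_int (c : R) : \int[iid gam k]__ c%:E = c%:E.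
  exact: integral_cst_probability.
have E0 z : 0 <= (expR (t * (S z ^+ 2 - q)))%:E by rewrite lee_fin expR_ge0.
have hLR : \int[iid gam k]_z LHS z <= \int[iid gam k]_z RHS z.
  apply: ge0_le_integral_nm => z.
    by apply: adde_ge0; [apply: adde_ge0; [exact: E0|exact: aq0]|exact: bS0].
  rewrite /LHS /RHS -!EFinM -!EFinD lee_fin.
  have := @expR_centered _ (S z ^+ 2) q t (sqr_ge0 _) _ t8.
  rewrite q0 w1 -dE => /(_ isT); set e1 := expR _; set e2 := expR _.
  have -> : (t * (S z ^+ 2 - q) = a * S z ^+ 2 - a * q - b * S z ^+ 2 + b * q)%R.
    by rewrite tab; ring.
  by lra.
have hL : \int[iid gam k]_z LHS z = \int[iid gam k]_z (expR (t * (S z ^+ 2 - q)))%:E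
     + ((a * q)%:E + (b * q)%:E).
  rewrite /LHS ge0_integralD//; last 2 first.
  - by move=> z _; apply: adde_ge0; [exact: E0|exact: aq0].
  - exact: emeasurable_funD.
  by rewrite ge0_integralD// cst_int ge0_integralZl// ES2 -addeA -EFinM.
have hR : \int[iid gam k]_z RHS z <= (1 + b * q + a * q + 1024 * t ^+ 2)%:E.
  have e40 z : 0 <= d%:E * (expR (S z ^+ 2 / 4))%:E.
    by apply: mule_ge0; rewrite lee_fin// expR_ge0.
  have me4 : measurable_fun setT (fun z => d%:E * (expR (S z ^+ 2 / 4))%:E).
    exact: measurable_funeM.
  have maS' : measurable_fun setT (fun z => (1 + b * q)%:E + a%:E * (S z ^+ 2)%:E).
    exact: emeasurable_funD.
  have aS0' z : 0 <= (1 + b * q)%:E + a%:E * (S z ^+ 2)%:E by apply: adde_ge0.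
  rewrite /RHS ge0_integralD// ge0_integralD// cst_int !ge0_integralZl//.
  rewrite ES2 -EFinM -EFinD.
  rewrite [leRHS]EFinD; apply: leeD => //.
  rewrite (_ : 1024 * _ = d * 2)%R; last by rewrite dE; ring.
  by rewrite EFinM lee_wpmul2l.
rewrite hL in hLR; have := le_trans hLR hR.
set I := integral _ _ _; have : 0 <= I by apply: integral_ge0 => z _; rewrite lee_fin expR_ge0.
case: I => [r| |]//= _; rewrite -!EFinD !lee_fin => h.
by apply: le_trans (expR_ge1Dx _); lra.
Qed.

End gaussian_vector.

(** * Shifts of a Gaussian vector by a triangular map *)

Section gaussian_shift.
Local Open Scope ereal_scope.
Context (R : realType).
Local Notation gam := (normal_prob (0 : R) 1).
Local Notation tup k := (k.-tuple (measurableTypeR R)).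

Definition shift_by k (m : 'I_k -> R) (N : 'I_k -> 'I_k -> R) (z : tup k) (i : 'I_k) : R :=
  (m i + \sum_(l < k) N i l * tnth z l)%R.

Definition shift_tuple k (m : 'I_k -> R) (N : 'I_k -> 'I_k -> R) (z : tup k) : tup k :=
  [tuple (tnth z i + shift_by m N z i)%R | i < k].

(** The Cameron-Martin density for a shift that itself depends on the point. *)
Definition shift_density k (m : 'I_k -> R) (N : 'I_k -> 'I_k -> R) (z : tup k) : R :=
  expR (\sum_(i < k) (tnth z i * shift_by m N z i - shift_by m N z i ^+ 2 / 2)).

Lemma measurable_shift_by k (m : 'I_k -> R) N i :
  measurable_fun setT (fun z : tup k => shift_by m N z i).
Proof. by apply: measurable_funD => //; exact: measurable_lin. Qed.

Lemma measurable_shift_tuple k (m : 'I_k -> R) N :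
  measurable_fun setT (@shift_tuple k m N).
Proof.
apply/measurable_fun_tnthP => i.
rewrite (_ : _ \o _ = fun z : tup k => (tnth z i + shift_by m N z i)%R); last first.
  by apply/funext => z /=; rewrite tnth_mktuple.
apply: measurable_funD; last exact: measurable_shift_by.
exact: (@measurable_tnth _ (measurableTypeR R)).
Qed.

Lemma measurable_shift_density k (m : 'I_k -> R) N :
  measurable_fun setT (@shift_density k m N).
Proof.
apply: measurableT_comp => //; apply: measurable_sum => i.
have ms := measurable_shift_by m N i.
apply: measurable_funB.
  apply: measurable_funM => //.
  exact: (@measurable_tnth _ (measurableTypeR R)).
by apply: measurable_funM => //; exact: measurable_funX.
Qed.

Lemma shift_density_gt0 k (m : 'I_k -> R) N z : (0 < @shift_density k m N z)%R.
Proof. exact: expR_gt0. Qed.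

(** Strict triangularity makes the shift of the first coordinate constant; once that coordinate is
    fixed, it enters the remaining shift only through the constant term [m']. By N m = 0 this term
    is the same before and after the shift of the first coordinate, which is why the density may
    evaluate the shift at the image point; N N = 0 passes the condition N m = 0 on to [N'] and
    [m']. *)
Lemma gauss_shift k (m : 'I_k -> R) (N : 'I_k -> 'I_k -> R) (F : tup k -> \bar R) :
  (forall i l : 'I_k, (i <= l)%N -> N i l = 0%R) ->
  (forall i l : 'I_k, N i l * m l = 0)%R ->
  (forall i l p : 'I_k, N i l * N l p = 0)%R ->
  measurable_fun setT F -> (forall z, 0 <= F z) ->
  \int[iid gam k]_z F (shift_tuple m N z) =
  \int[iid gam k]_z (F z * (shift_density m N z)%:E).
Proof.
elim: k m N F => [|k IHk] m N F Nlow Nm NN mF F0.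
  apply: eq_integral => z _.
  by rewrite /shift_density big_ord0 expR0 mule1; congr F; apply: eq_from_tnth => -[].
pose N' (i l : 'I_k) := N (lift ord0 i) (lift ord0 l).
pose m' (x : R) (i : 'I_k) : R := (m (lift ord0 i) + N (lift ord0 i) ord0 * x)%R.
have N0l l : N ord0 l = 0%R by apply: Nlow.
have sby0 x (t : tup k) : shift_by m N (Defs.cons_tuple (x, t)) ord0 = m ord0.
  by rewrite /shift_by big1 ?addr0// => l _; rewrite N0l mul0r.
have sbyS x (t : tup k) i :
    shift_by m N (Defs.cons_tuple (x, t)) (lift ord0 i) = shift_by (m' x) N' t i.
  rewrite /shift_by big_ord_recl tnth_cons_tuple0 /m' addrA; congr (_ + _)%R.
  by apply: eq_bigr => l _; rewrite tnth_cons_tupleS.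
have Em0 x : m' (x + m ord0)%R = m' x.
  by apply/funext => i; rewrite /m' mulrDr Nm addr0.
have stc x (t : tup k) : shift_tuple m N (Defs.cons_tuple (x, t)) =
    Defs.cons_tuple ((x + m ord0)%R, shift_tuple (m' x) N' t).
  apply: eq_from_tnth => i; rewrite tnth_mktuple.
  case: (unliftP ord0 i) => [j ->|->].
    by rewrite !tnth_cons_tupleS tnth_mktuple sbyS.
  by rewrite !tnth_cons_tuple0 sby0.
have sdc x (t : tup k) : shift_density m N (Defs.cons_tuple (x, t)) =
    (expR (x * m ord0 - m ord0 ^+ 2 / 2) * shift_density (m' x) N' t)%R.
  rewrite /shift_density big_ord_recl tnth_cons_tuple0 sby0 expRD.
  by congr (_ * expR _)%R; apply: eq_bigr => i _; rewrite tnth_cons_tupleS sbyS.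
have mFs : measurable_fun setT (fun z => F (shift_tuple m N z)).
  exact: (measurableT_comp mF (@measurable_shift_tuple k.+1 m N)).
have md := @measurable_shift_density k.+1 m N.
have mFd : measurable_fun setT (fun z => F z * (shift_density m N z)%:E).
  by apply: emeasurable_funM => //; exact/measurable_EFinP.
have Fd0 z : 0 <= F z * (shift_density m N z)%:E.
  by rewrite mule_ge0// lee_fin ltW// shift_density_gt0.
rewrite !integral_iidS//.
pose H (y : R) := \int[iid gam k]_t
  (F (Defs.cons_tuple (y, t)) * (shift_density (m' y) N' t)%:E).
have HE x : \int[iid gam k]_t F (shift_tuple m N (Defs.cons_tuple (x, t))) =
    H (x + m ord0)%R.
  under eq_integral do rewrite stc.
  have c1 (i l : 'I_k) : (i <= l)%N -> N' i l = 0%R by move=> il; apply: Nlow.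
  have c2 i l : (N' i l * m' x l = 0)%R.
    by rewrite /m' mulrDr [X in (X + _)%R]Nm add0r mulrA [X in (X * _)%R]NN mul0r.
  have c3 i l p : (N' i l * N' l p = 0)%R by apply: NN.
  pose G (t : tup k) := F (Defs.cons_tuple ((x + m ord0)%R, t)).
  have mG : measurable_fun setT G.
    exact: (measurableT_comp mF (@measurable_cons_tuple_r _ _ _ _)).
  have := IHk (m' x) N' G c1 c2 c3 mG (fun=> F0 _).
  by rewrite /H Em0.
under eq_integral do rewrite HE.
have H0 y : 0 <= H y.
  by apply: integral_ge0 => t _; rewrite mule_ge0// lee_fin ltW// shift_density_gt0.
have RE x : \int[iid gam k]_t (F (Defs.cons_tuple (x, t)) *
      (shift_density m N (Defs.cons_tuple (x, t)))%:E) =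
    H x * (expR (x * m ord0 - m ord0 ^+ 2 / 2))%:E.
  rewrite /H muleC -ge0_integralZl//.
  - by apply: eq_integral => t _; rewrite sdc EFinM muleCA.
  - apply: emeasurable_funM.
      exact: (measurableT_comp mF (@measurable_cons_tuple_r _ _ _ _)).
    by apply/measurable_EFinP; exact: measurable_shift_density.
  - by move=> t _; rewrite mule_ge0// lee_fin ltW// shift_density_gt0.
(* [H] differs from an inner Tonelli integral by a positive measurable factor only. *)
have mH : measurable_fun setT H.
  have mRE := measurable_integral_iid_cons gam mFd Fd0.
  rewrite (_ : H = fun x => (expR (- (x * m ord0 - m ord0 ^+ 2 / 2)))%:E *
      \int[iid gam k]_t (F (Defs.cons_tuple (x, t)) *
      (shift_density m N (Defs.cons_tuple (x, t)))%:E)); last first.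
    by apply/funext => x; rewrite RE muleCA -EFinM -expRD addNr expR0 mule1.
  apply: emeasurable_funM => //; apply/measurable_EFinP.
  apply: measurableT_comp => //; apply: measurableT_comp => //.
  by apply: measurable_funB => //; exact: measurable_funM.
by rewrite integral_normal_shift//; apply: eq_integral => x _; rewrite RE.
Qed.

End gaussian_shift.

(** * Linear algebra *)

Section euclidean.
Context (R : realType).

Definition dot k (u v : 'cV[R]_k) : R := (u^T *m v) 0 0.

Lemma dotE k (u v : 'cV[R]_k) : dot u v = \sum_i u i 0 * v i 0.
Proof. by rewrite /dot mxE; apply: eq_bigr => i _; rewrite mxE. Qed.

Lemma dotC k (u v : 'cV[R]_k) : dot u v = dot v u.
Proof. by rewrite !dotE; apply: eq_bigr => i _; rewrite mulrC. Qed.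

Lemma dotDl k (u v w : 'cV[R]_k) : dot (u + v) w = dot u w + dot v w.
Proof. by rewrite /dot linearD mulmxDl mxE. Qed.

Lemma dotZl k a (u v : 'cV[R]_k) : dot (a *: u) v = a * dot u v.
Proof. by rewrite /dot linearZ -scalemxAl mxE. Qed.

Lemma dotDr k (u v w : 'cV[R]_k) : dot u (v + w) = dot u v + dot u w.
Proof. by rewrite dotC dotDl !(dotC u). Qed.

Lemma dotZr k a (u v : 'cV[R]_k) : dot u (a *: v) = a * dot u v.
Proof. by rewrite dotC dotZl dotC. Qed.

Lemma dotNl k (u v : 'cV[R]_k) : dot (- u) v = - dot u v.
Proof. by rewrite -scaleN1r dotZl mulN1r. Qed.

Lemma dotNr k (u v : 'cV[R]_k) : dot u (- v) = - dot u v.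
Proof. by rewrite dotC dotNl dotC. Qed.

Lemma dot_mulmx k l (A : 'M[R]_(k, l)) u v : dot u (A *m v) = dot (A^T *m u) v.
Proof. by rewrite /dot trmx_mul trmxK mulmxA. Qed.

Lemma dot_sqrE k (u : 'cV[R]_k) : dot u u = \sum_i u i 0 ^+ 2.
Proof. by rewrite dotE; apply: eq_bigr => i _; rewrite expr2. Qed.

Lemma dot_ge0 k (u : 'cV[R]_k) : 0 <= dot u u.
Proof. by rewrite dot_sqrE sumr_ge0// => i _; exact: sqr_ge0. Qed.

Lemma dot_eq0 k (u : 'cV[R]_k) : dot u u = 0 -> u = 0.
Proof.
rewrite dot_sqrE => /eqP; rewrite psumr_eq0 => [/allP u0|i _]; last exact: sqr_ge0.
apply/matrixP => i j; rewrite ord1 mxE.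
by have := u0 i (mem_index_enum _); rewrite /= sqrf_eq0 => /eqP.
Qed.

Lemma cauchy_schwarz k (u v : 'cV[R]_k) : dot u v ^+ 2 <= dot u u * dot v v.
Proof.
have [v0|v_neq0] := eqVneq (dot v v) 0.
  by rewrite v0 mulr0 (dot_eq0 v0) /dot mulmx0 mxE expr0n.
have vgt0 : 0 < dot v v by rewrite lt0r v_neq0 dot_ge0.
have := dot_ge0 (dot v v *: u + (- dot u v) *: v).
rewrite !(dotDl, dotDr, dotZl, dotZr) (dotC v u) => h.
rewrite -subr_ge0 -(pmulr_rge0 _ vgt0); apply: le_trans h _.
by rewrite le_eqVlt; apply/orP; left; apply/eqP; ring.
Qed.

(** Polarisation: the forms at x + y and x - y are subtracted, and their bounds add up by the
    parallelogram identity. *)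
Lemma sym_quad_bilinear k (A : 'M[R]_k) q : A^T = A ->
  (forall x, `|dot x (A *m x)| <= q * dot x x) ->
  forall x y, 2 * `|dot y (A *m x)| <= q * (dot x x + dot y y).
Proof.
move=> symA qA.
have bil x y : 2 * dot y (A *m x) <= q * (dot x x + dot y y).
  have := qA (x + y); have := qA (x - y).
  rewrite !mulmxDr mulmxN !(dotDl, dotDr, dotNl, dotNr).
  have -> : dot x (A *m y) = dot y (A *m x) by rewrite dot_mulmx symA dotC.
  rewrite (dotC y x) !ler_norml => /andP[h1 h2] /andP[h3 h4]; lra.
move=> x y; have h1 := bil x y; have := bil x (- y).
rewrite !(dotNl, dotNr) opprK => h2.
by case: (ger0P (dot y (A *m x))) => _; lra.
Qed.

(** The bilinear bound is tested at y = q^-1 A x, the choice that balances its two sides. *)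
Lemma sym_quad_op k (A : 'M[R]_k) q : A^T = A -> 0 <= q ->
  (forall x, `|dot x (A *m x)| <= q * dot x x) ->
  forall x, dot (A *m x) (A *m x) <= q ^+ 2 * dot x x.
Proof.
move=> symA q0 qA x.
have bil y : 2 * dot y (A *m x) <= q * (dot x x + dot y y).
  by apply: le_trans (sym_quad_bilinear symA qA x y); rewrite ler_wpM2l// ler_norm.
have [q_eq0|q_neq0] := eqVneq q 0.
  by have := bil (A *m x); rewrite q_eq0 expr0n !mul0r; lra.
have qgt0 : 0 < q by rewrite lt0r q_neq0.
have := bil (q^-1 *: (A *m x)); rewrite !(dotZl, dotZr) => h.
have : q * (2 * (q^-1 * dot (A *m x) (A *m x))) <=
    q * (q * (dot x x + q^-1 * (q^-1 * dot (A *m x) (A *m x)))).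
  by rewrite ler_pM2l.
rewrite (_ : q * (2 * _) = 2 * dot (A *m x) (A *m x)); last by field.
rewrite (_ : q * (q * _) = q ^+ 2 * dot x x + dot (A *m x) (A *m x)); last by field.
by lra.
Qed.

End euclidean.

(** * The spectral theorem for real symmetric matrices *)

Section spectral.
Context (R : realType).

(** The reflection along v - e_0 exchanges the unit vectors e_0 and v; for v = e_0 the identity
    serves. *)
Lemma householder k (v : 'cV[R]_(1 + k)) : dot v v = 1 ->
  exists2 H : 'M[R]_(1 + k), H *m H^T = 1%:M & H *m delta_mx 0 0 = v.
Proof.
move=> v1; pose e : 'cV[R]_(1 + k) := delta_mx 0 0.
have ve : dot v e = v 0 0 by rewrite /dot -colE mxE mxE.
have ee : dot e e = 1 by rewrite /dot -colE mxE mxE /e mxE !eqxx.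
pose w := v - e; pose s := dot w w.
have sE : s = 2 * (1 - v 0 0).
  rewrite /s /w !(dotDl, dotDr, dotNl, dotNr) v1 ee (dotC e v) ve; ring.
have we : dot w e = v 0 0 - 1 by rewrite /w dotDl dotNl ve ee.
have [s0|s_neq0] := eqVneq s 0.
  exists 1%:M; first by rewrite trmx1 mulmx1.
  by rewrite mul1mx; apply/esym/eqP; rewrite -subr_eq0; apply/eqP/dot_eq0.
pose c := 2 / s; exists (1%:M - c *: (w *m w^T)).
  have -> : (1%:M - c *: (w *m w^T))^T = 1%:M - c *: (w *m w^T).
    by rewrite [LHS]raddfB /= trmx1 [X in _ - X]linearZ /= trmx_mul trmxK.
  rewrite mulmxBl mul1mx mulmxBr mulmx1 -scalemxAl -scalemxAr.
  rewrite -[w *m w^T *m _]mulmxA [w^T *m (w *m _)]mulmxA (mx11_scalar (w^T *m w)).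
  rewrite mul_scalar_mx -scalemxAr -/(dot w w) -/s !scalerA.
  rewrite (_ : c * (c * s) = c + c); last by rewrite /c; field.
  by rewrite scalerDl opprB addrK subrK.
rewrite mulmxBl mul1mx -scalemxAl -mulmxA (mx11_scalar (w^T *m _)) -/e -/(dot w e).
rewrite mul_mx_scalar scalerA we (_ : c * _ = -1); last first.
  by rewrite /c; field: sE; rewrite sE in s_neq0 *.
by rewrite scaleN1r opprK /w addrC subrK.
Qed.

Lemma sym_block_first_col k (T : 'M[R]_(1 + k)) a : T^T = T ->
  (forall i, T i 0 = a *+ (i == 0)) -> T = block_mx a%:M 0 0 (drsubmx T).
Proof.
move=> symT T0; have l0 : lshift k (0 : 'I_1) = 0 :> 'I_(1 + k) by exact: val_inj.
have T0' i : T 0 i = a *+ (i == 0) by rewrite -{1}symT mxE T0.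
rewrite -[LHS]submxK; congr block_mx; apply/matrixP => i j;
  rewrite ?ord1 !mxE ?[in lshift _ _]ord1 ?l0.
- by rewrite T0 !eqxx.
- by rewrite T0'.
- by rewrite T0.
Qed.

(** Deflation: the split characteristic polynomial supplies an eigenvector, a reflection moves it to
    the first basis vector, and symmetry clears the first row together with the first column. *)
Lemma sym_spectral k (S : 'M[R]_k) : S^T = S ->
  exists (Q : 'M[R]_k) (d : 'rV[R]_k), Q *m Q^T = 1%:M /\ S = Q^T *m diag_mx d *m Q.
Proof.
elim: k S => [|k IHk] S.
  by exists 1%:M, 0; split; apply/matrixP => -[].
rewrite -[k.+1]/(1 + k)%N in S *; move=> symS.
have [d defd] := sym_char_poly_split symS.
have /eigenvalueP[u Su u_neq0] : eigenvalue S (d 0 0).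
  by rewrite eigenvalue_root_char defd (bigD1 0)//= rootM root_XsubC eqxx.
set a := d 0 0 in Su.
have Sut : S *m u^T = a *: u^T by rewrite -[S]symS -trmx_mul Su linearZ.
have ugt0 : 0 < dot u^T u^T.
  rewrite lt0r dot_ge0 andbT; apply: contra u_neq0 => /eqP/dot_eq0 /(congr1 trmx).
  by rewrite trmxK trmx0 => ->.
pose v := (Num.sqrt (dot u^T u^T))^-1 *: u^T.
have v1 : dot v v = 1.
  rewrite /v dotZl dotZr mulrA -invfM -expr2 sqr_sqrtr ?mulVf ?gt_eqF//.
  exact: ltW.
have Sv : S *m v = a *: v by rewrite /v -scalemxAr Sut !scalerA mulrC.
have [H HH He] := householder v1.
have HtH : H^T *m H = 1%:M by exact: mulmx1C.
pose T := H^T *m S *m H.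
have symT : T^T = T by rewrite /T !trmx_mul trmxK symS mulmxA.
have Te : T *m delta_mx 0 0 = a *: delta_mx 0 0 :> 'cV_(1 + k).
  by rewrite /T -!mulmxA He Sv -scalemxAr -He mulmxA HtH mul1mx.
have T00 i : T i 0 = a *+ (i == 0).
  by have /matrixP/(_ i 0) := Te; rewrite -colE !mxE eqxx andbT mulr_natr.
have defT := sym_block_first_col symT T00.
have [Q [d' [QQ defQ]]] := IHk (drsubmx T) (etrans (trmx_drsub _) (congr1 _ symT)).
exists (block_mx 1%:M 0 0 Q *m H^T), (row_mx a%:M d'); split.
  rewrite trmx_mul trmxK mulmxA -[_ *m H^T *m H]mulmxA HtH mulmx1.
  rewrite tr_block_mx !trmx0 trmx1 mulmx_block !mulmx0 !mul0mx !addr0 !add0r mulmx1 QQ.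
  by rewrite -scalar_mx_block.
rewrite trmx_mul trmxK diag_mx_row tr_block_mx !trmx0 trmx1.
rewrite !mulmxA -[H *m _ *m _]mulmxA mulmx_block -[H *m _ *m _]mulmxA mulmx_block.
rewrite !(mulmx0, mul0mx, addr0, add0r, mulmx1, mul1mx) -defQ.
rewrite (_ : diag_mx a%:M = a%:M); last first.
  by apply/matrixP => i j; rewrite !ord1 !mxE.
by rewrite -defT /T !mulmxA HH mul1mx -mulmxA HH mulmx1.
Qed.

Lemma char_poly_orthogonal k (Q : 'M[R]_k) d : Q *m Q^T = 1%:M ->
  char_poly (Q^T *m diag_mx d *m Q) = \prod_i ('X - (d 0 i)%:P).
Proof.
move=> QQ; have QtQ : Q^T *m Q = 1%:M by exact: mulmx1C.
rewrite -[RHS](_ : char_poly (diag_mx d) = _); last first.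
  rewrite char_poly_trig ?diag_mx_is_trig//; apply: eq_bigr => i _.
  by rewrite mxE eqxx mulr1n.
pose PQ := map_mx (@polyC _) Q; pose PQt := map_mx (@polyC _) Q^T.
have PP : PQt *m PQ = 1%:M by rewrite -map_mxM QtQ map_mx1.
rewrite /char_poly /char_poly_mx.
rewrite (_ : _ - map_mx _ (_ *m _) = PQt *m ('X%:M - map_mx (@polyC _) (diag_mx d)) *m PQ).
  by rewrite !det_mulmx mulrAC -det_mulmx PP det1 mul1r.
by rewrite mulmxBr mulmxBl !map_mxM mul_mx_scalar -scalemxAl PP scalemx1.
Qed.

End spectral.

(** * Symmetric gauges and unitarily invariant norms *)

Section gauge.
Context (R : realType) (k : nat) (tau : 'rV[R]_k -> R).
Hypothesis tauP : symmetric_gauge tau.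

Lemma gauge0 : tau 0 = 0.
Proof. by rewrite -(scale0r (0 : 'rV_k)) (gauge_scale tauP) normr0 mul0r. Qed.

Lemma gauge_ge0 x : 0 <= tau x.
Proof.
have := gauge_triangle tauP x (- x); rewrite subrr gauge0.
by rewrite -scaleN1r (gauge_scale tauP) normrN1 mul1r; lra.
Qed.

Lemma gauge_sum I (s : seq I) (F : I -> 'rV[R]_k) :
  tau (\sum_(i <- s) F i) <= \sum_(i <- s) tau (F i).
Proof.
elim/big_rec2: _ => [|i y x _ h]; first by rewrite gauge0.
by apply: le_trans (gauge_triangle tauP _ _) _; rewrite lerD2l.
Qed.

(** The shrunk vector is a convex combination of [x] and of [x] with its coordinate [i] negated. *)
Lemma gauge_shrink i t (x : 'rV[R]_k) : 0 <= t <= 1 ->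
  tau (\row_j ((if j == i then t else 1) * x 0 j)) <= tau x.
Proof.
move=> /andP[t0 t1].
pose y : 'rV[R]_k := \row_j ((-1) ^+ (j == i) * x 0 j).
rewrite (_ : \row_j _ = ((1 + t) / 2) *: x + ((1 - t) / 2) *: y); last first.
  by apply/rowP => j; rewrite !mxE; case: eqP => _; rewrite ?expr1 ?expr0; field.
apply: le_trans (gauge_triangle tauP _ _) _.
rewrite !(gauge_scale tauP) !ger0_norm; [|lra|lra].
by rewrite (gauge_sign tauP (fun j => j == i) x); lra.
Qed.

(** The all-one vector is shrunk to x / q one coordinate at a time: [y m] has the first m
    coordinates done. If q <= 0, either x = 0 or there are no coordinates. *)
Lemma gauge_le_cube q (x : 'rV[R]_k) : (forall i, 0 <= x 0 i <= q) ->
  tau x <= q * tau (const_mx 1).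
Proof.
move=> xq; have [q0|q0] := lerP q 0.
  have -> : x = q *: const_mx 1.
    by apply/rowP => i; rewrite !mxE; have /andP[] := xq i; lra.
  rewrite (gauge_scale tauP); have [k0|/eqP] := eqVneq q 0; first by rewrite k0 normr0.
  move=> qn; have -> : const_mx 1 = 0 :> 'rV[R]_k; last by rewrite gauge0 !mulr0.
  by apply/rowP => i; have /andP[] := xq i; lra.
pose y m : 'rV[R]_k := \row_j (if (j < m)%N then x 0 j / q else 1).
have yS (i : 'I_k) : y i.+1 = \row_j ((if j == i then x 0 i / q else 1) * y i 0 j).
  apply/rowP => j; rewrite !mxE ltnS leq_eqVlt.
  have [->|ji] := eqVneq j i; first by rewrite eqxx ltnn mulr1.
  by rewrite -[_ == _ :> nat]/(j == i) (negbTE ji) mul1r.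
have h m : (m <= k)%N -> tau (y m) <= tau (const_mx 1).
  elim: m => [_|m IH mk].
    by rewrite le_eqVlt; apply/orP; left; apply/eqP; congr tau; apply/rowP => j; rewrite !mxE.
  apply: le_trans (IH (ltnW mk)); rewrite (yS (Ordinal mk)).
  apply: gauge_shrink; rewrite divr_ge0 ?ler_pdivrMr ?mul1r ?(ltW q0)//.
    by have /andP[] := xq (Ordinal mk).
  by have /andP[] := xq (Ordinal mk).
have -> : x = q *: y k.
  by apply/rowP => j; rewrite !mxE ltn_ord mulrCA mulfV ?mulr1// gt_eqF.
by rewrite (gauge_scale tauP) gtr0_norm// ler_pM2l// h.
Qed.

End gauge.

(** The cyclic shifts of [x] add up to the constant vector whose entries are the sum of [x], and all
    of them have the same gauge. *)
Lemma gauge_average (R : realType) k (tau : 'rV[R]_k -> R) (x : 'rV[R]_k) :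
  symmetric_gauge tau -> (forall i, 0 <= x 0 i) ->
  tau (const_mx 1) * \sum_i x 0 i <= k%:R * tau x.
Proof.
case: k tau x => [|k] tau x tauP x0.
  by rewrite big_ord0 mulr0 mul0r.
pose s (r : 'I_k.+1) : 'S_k.+1 := perm (@addIr _ r).
have -> : k.+1%:R * tau x = \sum_(r : 'I_k.+1) tau (col_perm (s r) x).
  under eq_bigr do rewrite (gauge_perm tauP).
  by rewrite sumr_const card_ord mulr_natl.
apply: le_trans (gauge_sum tauP _ _).
rewrite (_ : \sum_r _ = (\sum_i x 0 i) *: const_mx 1).
  by rewrite (gauge_scale tauP) ger0_norm ?sumr_ge0// mulrC.
apply/rowP => j; rewrite summxE !mxE mulr1 [RHS](reindex_inj (@addrI _ j)).
by apply: eq_bigr => r _; rewrite mxE permE.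
Qed.

(** Squares of singular values are eigenvalues of A^T A, so every singular value is at most [q], and
    the gauge is monotone on the cube. *)
Lemma ui_norm_le (R : realType) k (tau : 'rV[R]_k -> R) (A : 'M[R]_k) q :
  symmetric_gauge tau -> 0 <= q ->
  (forall x, dot (A *m x) (A *m x) <= q ^+ 2 * dot x x) ->
  ui_norm tau A <= q * tau (const_mx 1).
Proof.
move=> tauP q0 Aq; have [s0 _ cp] := singular_valuesP A.
apply: (gauge_le_cube tauP) => i; rewrite s0/=.
set s := singular_values A 0 i.
have /eigenvalueP[v Av v_neq0] : eigenvalue (A^T *m A) (s ^+ 2).
  by rewrite eigenvalue_root_char cp (bigD1 i)//= rootM root_XsubC eqxx.
have vgt0 : 0 < dot v^T v^T.
  rewrite lt0r dot_ge0 andbT; apply: contra v_neq0 => /eqP/dot_eq0 /(congr1 trmx).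
  by rewrite trmxK trmx0 => ->.
have := Aq v^T.
have -> : dot (A *m v^T) (A *m v^T) = s ^+ 2 * dot v^T v^T.
  by rewrite /dot trmx_mul trmxK -mulmxA [A^T *m (A *m _)]mulmxA mulmxA Av -scalemxAl mxE.
by rewrite ler_pM2r// ler_sqr// nnegrE// s0.
Qed.

(** The trace is computed in an orthonormal eigenbasis q_i of A^T A: it is the sum of the products
    of A q_i and B q_i, where A q_i has length sqrt d_i and B q_i length at most b. The d_i are the
    squared singular values up to order, both being the roots of the characteristic polynomial of
    A^T A. *)
Lemma trace_duality (R : realType) k (A B : 'M[R]_k) b : 0 <= b ->
  (forall x, dot (B *m x) (B *m x) <= b ^+ 2 * dot x x) ->
  \tr (A^T *m B) <= b * \sum_i singular_values A 0 i.
Proof.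
move=> b0 Bb; have [s0 _ cp] := singular_valuesP A.
have [Q [d [QQ defAA]]] : exists (Q : 'M[R]_k) (d : 'rV[R]_k),
    Q *m Q^T = 1%:M /\ A^T *m A = Q^T *m diag_mx d *m Q.
  by apply: sym_spectral; rewrite trmx_mul trmxK.
have QtQ : Q^T *m Q = 1%:M by exact: mulmx1C.
have colM (M : 'M[R]_k) i : dot (M *m (Q^T *m delta_mx i 0)) (M *m (Q^T *m delta_mx i 0)) =
    (Q *m (M^T *m M) *m Q^T) i i.
  rewrite /dot !trmx_mul trmxK trmx_delta !mulmxA -!rowE.
  by rewrite -colE mxE -!row_mul mxE.
have sums : \sum_i singular_values A 0 i = \sum_i Num.sqrt (d 0 i).
  have : \prod_i ('X - (singular_values A 0 i ^+ 2)%:P) = \prod_i ('X - (d 0 i)%:P).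
    by rewrite -cp defAA char_poly_orthogonal.
  rewrite -(big_map (fun i => singular_values A 0 i ^+ 2) xpredT (fun x => 'X - x%:P)).
  rewrite -(big_map (fun i => d 0 i) xpredT (fun x => 'X - x%:P)).
  move/prod_XsubC_eq => /(perm_big _) h.
  have := h R +%R 0 xpredT (fun x => Num.sqrt x).
  rewrite !big_map /= => <-; apply: eq_bigr => i _.
  by rewrite sqrtr_sqr ger0_norm.
rewrite sums mulr_sumr.
have -> : \tr (A^T *m B) = \sum_i dot (A *m (Q^T *m delta_mx i 0)) (B *m (Q^T *m delta_mx i 0)).
  rewrite -[LHS]mulr1 -[A^T *m B]mulmx1 -QtQ mulmxA mxtrace_mulC /mxtrace mulr1.
  apply: eq_bigr => i _.
  rewrite /dot !trmx_mul trmxK trmx_delta !mulmxA -!rowE.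
  by rewrite -colE [RHS]mxE -!row_mul [RHS]mxE.
apply: ler_sum => i _; set q := Q^T *m delta_mx i 0.
have qq : dot q q = 1.
  rewrite -[q]mul1mx colM trmx1 mulmx1 mulmx1 QQ mxE eqxx //.
have Aq : dot (A *m q) (A *m q) = d 0 i.
  rewrite colM defAA !mulmxA QQ mul1mx -mulmxA QQ mulmx1 mxE eqxx mulr1n //.
have Bq : dot (B *m q) (B *m q) <= b ^+ 2 by have := Bb q; rewrite qq mulr1.
have di0 : 0 <= d 0 i by rewrite -Aq dot_ge0.
have := cauchy_schwarz (A *m q) (B *m q); rewrite Aq => h.
apply: le_trans (ler_norm _) _.
rewrite -(@ler_sqr _ _ (b * _)) ?nnegrE ?mulr_ge0 ?sqrtr_ge0//.
rewrite real_normK ?num_real// exprMn sqr_sqrtr// (mulrC (b ^+ 2)).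
by apply: le_trans h _; rewrite ler_wpM2l.
Qed.

Lemma ui_norm_ge (R : realType) k (tau : 'rV[R]_k -> R) (A B : 'M[R]_k) b :
  symmetric_gauge tau -> 0 <= b ->
  (forall x, dot (B *m x) (B *m x) <= b ^+ 2 * dot x x) ->
  tau (const_mx 1) * \tr (A^T *m B) <= k%:R * b * ui_norm tau A.
Proof.
move=> tauP b0 Bb; have [s0 _ _] := singular_valuesP A.
apply: (@le_trans _ _ (tau (const_mx 1) * (b * \sum_i singular_values A 0 i))).
  by rewrite ler_wpM2l ?(gauge_ge0 tauP)// trace_duality.
rewrite mulrCA -mulrA (mulrCA k%:R) ler_wpM2l//.
exact: gauge_average.
Qed.

Lemma ui_norm_ge0 (R : realType) k (tau : 'rV[R]_k -> R) (A : 'M[R]_k) :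
  symmetric_gauge tau -> 0 <= ui_norm tau A.
Proof. by move=> tauP; exact: gauge_ge0. Qed.

(** * A net of the unit ball *)

Section net.
Context (R : realType).

Variable k : nat.

(* The net is the set of points of [(4 sqrt k)^-1 Z^k] in the unit ball, coded by the
   signs and the magnitudes of the integer coordinates. *)
Let code := {ffun 'I_k -> bool * 'I_(4 * k).+1}.

Definition net : {set code} := finset (fun f : code => (\sum_i (f i).2 ^ 2 <= 16 * k)%N).

Definition netpt (f : code) : 'cV[R]_k :=
  \col_i ((-1) ^+ (f i).1 * (f i).2%:R / (4 * Num.sqrt k%:R)).

Lemma sum_geometric_half_le n : \sum_(m < n) (2^-1 : R) ^+ m <= 2.
Proof.
suff : \sum_(m < n) (2^-1 : R) ^+ m = 2 - 2 * 2^-1 ^+ n.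
  by move=> ->; rewrite gerBl mulr_ge0// exprn_ge0// invr_ge0.
elim: n => [|n IHn]; first by rewrite big_ord0 expr0 mulr1 subrr.
by rewrite big_ord_recr/= IHn exprS; field.
Qed.

Lemma expR1_ge2 : 2 <= expR 1 :> R.
Proof. by have := expR_ge1Dx (1 : R); lra. Qed.

(** The indicator of the constraint is at most the product over coordinates of exp (16 - m_i^2). The
    sum over all codes then factors, and each factor, signs included, is at most 4 exp 16 <= exp 18
    because exp (- m^2) <= 2^-m. *)
Lemma net_card : #|net|%:R <= expR (18 * k%:R) :> R.
Proof.
rewrite -sum1_card natr_sum.
apply: (@le_trans _ _ (\sum_(f : code) \prod_(i < k) expR (16 - ((f i).2 ^ 2)%:R))).
  rewrite big_mkcond/=; apply: ler_sum => f _; rewrite inE.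
  case: ifP => [fN|_]; last by apply: prodr_ge0 => i _; exact: expR_ge0.
  rewrite -expR_sum -[leLHS]expR0 ler_expR sumrB sumr_const card_ord -natr_sum.
  rewrite subr_ge0 -mulrnA -mulr_natr mul1r ler_nat; exact: fN.
rewrite -(bigA_distr_bigA (fun _ (p : bool * 'I_(4 * k).+1) => expR (16 - (p.2 ^ 2)%:R))).
rewrite prodr_const card_ord mulrC expRM_natl lerXn2r ?nnegrE ?expR_ge0 ?sumr_ge0//.
  rewrite -(pair_bigA _ (fun (_ : bool) (m : 'I_(4 * k).+1) => expR (16 - (m ^ 2)%:R))) /=.
  rewrite big_const card_bool /= addr0.
  have h : \sum_(m < (4 * k).+1) expR (16 - (m ^ 2)%:R) <= expR 16 * 2 :> R.
    apply: (@le_trans _ _ (\sum_(m < (4 * k).+1) expR 16 * (2^-1) ^+ m)).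
      apply: ler_sum => m _; rewrite expRD ler_pM2l ?expR_gt0//.
      rewrite exprVn expRN lef_pV2 ?posrE ?expR_gt0 ?exprn_gt0//.
      apply: (@le_trans _ _ (expR 1 ^+ m)); first by rewrite lerXn2r ?nnegrE ?expR_ge0 ?expR1_ge2.
      rewrite -expRM_natl ler_expR mulr1 ler_nat.
      by case: (m : nat) => // p; rewrite -mulnn leq_pmull.
    by rewrite -mulr_sumr ler_pM2l ?expR_gt0// sum_geometric_half_le.
  have e2 : 4 <= expR 2 :> R.
    have -> : (2 : R) = 1 + 1 by lra.
    by rewrite expRD; have := expR1_ge2; nra.
  apply: (@le_trans _ _ (expR 16 * 2 + expR 16 * 2)); first exact: lerD.
  have -> : (18 : R) = 16 + 2 by lra.
  by rewrite [leRHS]expRD; have := expR_gt0 (16 : R); nra.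
Qed.

Hypothesis k0 : (0 < k)%N.

Let r : R := 4 * Num.sqrt k%:R.
Let r_gt0 : 0 < r. Proof. by rewrite mulr_gt0// sqrtr_gt0 ltr0n. Qed.
Let r2 : r ^+ 2 = 16 * k%:R.
Proof. by rewrite exprMn sqr_sqrtr ?ler0n//; lra. Qed.
Let r_le : r <= (4 * k)%:R.
Proof.
rewrite -ler_sqr ?nnegrE ?ler0n ?(ltW r_gt0)// r2 -natrX -natrM ler_nat.
by rewrite expnMn leq_mul// -mulnn leq_pmull.
Qed.

Lemma netpt_dot_le1 f : f \in net -> dot (netpt f) (netpt f) <= 1.
Proof.
rewrite inE => fN; rewrite dot_sqrE.
rewrite (_ : \sum_i _ = (\sum_i (f i).2 ^ 2)%N%:R / r ^+ 2); last first.
  rewrite natr_sum mulr_suml; apply: eq_bigr => i _.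
  by rewrite mxE -/r expr_div_n exprMn sqrr_sign mul1r natrX.
by rewrite ler_pdivrMr ?exprn_gt0// mul1r r2 -natrM ler_nat.
Qed.

(** Coordinates are rounded towards zero: the lengths do not grow, so the rounded point stays in the
    ball, and each coordinate moves by at most 1 / (4 sqrt k). *)
Lemma net_approx (x : 'cV[R]_k) : dot x x <= 1 ->
  exists2 f, f \in net & dot (x - netpt f) (x - netpt f) <= 16^-1.
Proof.
move=> x1; pose a i := `|x i 0| * r.
have a0 i : 0 <= a i by rewrite mulr_ge0// ltW.
have xi1 i : `|x i 0| <= 1.
  rewrite -(@ler_sqr _ _ 1) ?nnegrE// real_normK ?num_real// expr1n (le_trans _ x1)//.
  by rewrite dot_sqrE (bigD1 i)//= lerDl sumr_ge0// => j _; exact: sqr_ge0.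
have am i : (Num.truncn (a i) < (4 * k).+1)%N.
  rewrite ltnS -(ler_nat R); apply: le_trans r_le.
  by apply: (@le_trans _ _ (a i)); [rewrite truncn_le| rewrite /a ler_piMl// ltW].
pose f : code := [ffun i => (x i 0 < 0, Ordinal (am i))].
have fm i : ((f i).2 : nat) = Num.truncn (a i) by rewrite ffunE.
have ma i : (Num.truncn (a i))%:R <= a i by rewrite truncn_le.
exists f.
  rewrite inE -(ler_nat R) natr_sum natrM -r2.
  apply: (@le_trans _ _ (\sum_i (a i) ^+ 2)).
    by apply: ler_sum => i _; rewrite fm natrX lerXn2r ?nnegrE.
  rewrite (_ : \sum_i _ = r ^+ 2 * dot x x); first by rewrite ler_piMr// sqr_ge0.
  rewrite dot_sqrE mulr_sumr; apply: eq_bigr => i _.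
  by rewrite /a exprMn real_normK ?num_real// mulrC.
rewrite dot_sqrE.
apply: (@le_trans _ _ (\sum_(i < k) (r ^+ 2)^-1)); last first.
  rewrite sumr_const card_ord r2 -[leLHS]mulr_natr invfM divfK//.
  by rewrite pnatr_eq0 -lt0n.
apply: ler_sum => i _.
have -> : (x - netpt f) i 0 = (-1) ^+ (x i 0 < 0)%R * ((a i - (Num.truncn (a i))%:R) / r).
  rewrite !mxE -/r fm ffunE /= mulrBl /a mulfK ?gt_eqF// mulrBr -mulrA; congr (_ - _).
  by rewrite mulr_sign; case: ltP => h; [rewrite ltr0_norm ?opprK|rewrite ger0_norm].
rewrite exprMn sqrr_sign mul1r expr_div_n ler_pdivrMr ?exprn_gt0// mulVf ?gt_eqF ?exprn_gt0//.
rewrite expr_le1 ?subr_ge0//.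
by rewrite lerBlDr nat1r ltW// truncnS_gt.
Qed.

(** Let [q] be the supremum of the form over the ball and [t] its maximum over the net. Passing from
    a point to its approximation changes the form by at most 5/8 q, so q <= t + 5/8 q, and 8/3 is
    rounded up to 3. *)
Lemma sym_quad_net (A : 'M[R]_k) : A^T = A ->
  exists2 f, f \in net &
    forall x, `|dot x (A *m x)| <= 3 * `|dot (netpt f) (A *m netpt f)| * dot x x.
Proof.
move=> symA; pose Q x := `|dot x (A *m x)|.
pose B := [set Q x | x in [set x : 'cV[R]_k | dot x x <= 1]].
have [f0 f0N _] : exists2 f, f \in net & dot (0 - netpt f) (0 - netpt f) <= 16^-1.
  by apply: net_approx; rewrite /dot mulmx0 mxE.
have [f fN fmax] : exists2 f, f \in net & forall g, g \in net -> Q (netpt g) <= Q (netpt f).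
  by case: (arg_maxP (fun f => Q (netpt f)) f0N) => f fN h; exists f.
exists f => //; set t := `|_|; have t0 : 0 <= t by exact: normr_ge0.
have Bub : has_sup B.
  split; first by exists (Q 0), 0 => //=; rewrite /dot mulmx0 mxE.
  exists (\sum_i \sum_j `|A i j|) => _ [x x1 <-].
  have xi1 i : `|x i 0| <= 1.
    rewrite -(@ler_sqr _ _ 1) ?nnegrE// real_normK ?num_real// expr1n (le_trans _ x1)//.
    by rewrite dot_sqrE (bigD1 i)//= lerDl sumr_ge0// => j _; exact: sqr_ge0.
  rewrite /Q dotE (le_trans (ler_norm_sum _ _ _))//; apply: ler_sum => i _.
  rewrite normrM (le_trans (ler_piMl _ (xi1 i)))// mxE (le_trans (ler_norm_sum _ _ _))//.
  by apply: ler_sum => j _; rewrite normrM ler_piMr.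
pose q := sup B.
have qx x : Q x <= q * dot x x.
  have [x0|x_neq0] := eqVneq (dot x x) 0.
    by rewrite (dot_eq0 x0) /Q mulmx0 /dot mulmx0 mxE normr0 mulr0.
  have xgt0 : 0 < dot x x by rewrite lt0r x_neq0 dot_ge0.
  pose c := (Num.sqrt (dot x x))^-1.
  have c2 : c ^+ 2 = (dot x x)^-1 by rewrite exprVn sqr_sqrtr// ltW.
  have : Q (c *: x) <= q.
    apply: ub_le_sup; first by case: Bub.
    by exists (c *: x) => //=; rewrite dotZl dotZr mulrA -expr2 c2 mulVf.
  rewrite /Q -scalemxAr dotZl dotZr mulrA -expr2 c2 normrM gtr0_norm ?invr_gt0//.
  by rewrite ler_pdivrMl// mulrC.
have q0 : 0 <= q.
  apply: (@le_trans _ _ (Q 0)); first exact: normr_ge0.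
  by apply: ub_le_sup; [case: Bub|exists 0 => //=; rewrite /dot mulmx0 mxE].
have qt : q <= t + 5 / 8 * q.
  apply: ge_sup; first by case: Bub.
  move=> _ [x x1 <-]; rewrite /= in x1; have [g gN xg] := net_approx x1.
  set y := netpt g in xg; have y1 := netpt_dot_le1 gN; rewrite -/y in y1.
  have Qy : Q y <= t by exact: fmax.
  (* The factors 1/2 and 2 balance the long vector x + y against the short x - y: with |x - y|^2 <=
     1/16 the sum of squares is at most 1 + 15/64 <= 5/4. *)
  have bil := sym_quad_bilinear symA qx (2^-1 *: (x + y)) (2 *: (x - y)).
  have par : dot (x + y) (x + y) + dot (x - y) (x - y) = 2 * dot x x + 2 * dot y y.
    by rewrite !(dotDl, dotDr, dotNl, dotNr); ring.
  have := dot_ge0 (x - y) => u0.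
  have xy : dot x (A *m x) = dot y (A *m y) + dot (x - y) (A *m (x + y)).
    rewrite mulmxDr !(dotDl, dotDr, dotNl, dotNr).
    have -> : dot x (A *m y) = dot y (A *m x) by rewrite dot_mulmx symA dotC.
    ring.
  rewrite /Q xy (le_trans (ler_normD _ _))// lerD//.
  move: bil; rewrite -scalemxAr !(dotZl, dotZr) mulrA mulfV// mul1r => bil.
  have : q * (2^-1 * (2^-1 * dot (x + y) (x + y)) + 2 * (2 * dot (x - y) (x - y))) <= q * (5 / 4).
    by apply: ler_wpM2l => //; lra.
  by lra.
move=> x; apply: le_trans (qx x) _; rewrite ler_wpM2r ?dot_ge0//; lra.
Qed.

End net.

(** * Gaussian samples *)

Section gaussian_integral.
Local Open Scope ereal_scope.
Context (R : realType).
Local Notation gam := (normal_prob (0 : R) 1).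

Lemma integral_gaussian k (S : 'M[R]_k) (F : 'rV[R]_k -> \bar R) :
  measurable_fun setT F -> (forall x, 0 <= F x) ->
  \int[gaussian S]_x F x = \int[iid gam k]_z F (gaussian_map S z).
Proof. by move=> mF F0; rewrite ge0_integral_distribution. Qed.

Lemma integral_gaussian_sample n k (S : 'M[R]_k) (F : 'M[R]_(n, k) -> \bar R) :
  measurable_fun setT F -> (forall x, 0 <= F x) ->
  \int[gaussian_sample n S]_X F X =
  \int[iid (gaussian S) n]_t F (mx_of_rows t).
Proof. by move=> mF F0; rewrite ge0_integral_distribution. Qed.

End gaussian_integral.

(** * Operator bounds on the class [Xi] *)

Section Xi.
Context (R : realType) (k : nat).

Lemma l2normE (x : 'cV[R]_k) : l2norm x = Num.sqrt (dot x x).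
Proof. by rewrite /l2norm dot_sqrE. Qed.

Lemma Xi_op (lambda : R) S : 0 <= lambda -> Xi k lambda S ->
  forall x : 'cV[R]_k, dot (S *m x) (S *m x) <= lambda ^+ 2 * dot x x.
Proof.
move=> l0 [_ opS] x.
have [x0|x_neq0] := eqVneq (dot x x) 0.
  by rewrite (dot_eq0 x0) mulmx0 /dot mulmx0 mxE mulr0.
have xgt0 : 0 < dot x x by rewrite lt0r x_neq0 dot_ge0.
pose c := (Num.sqrt (dot x x))^-1.
have c2 : c ^+ 2 = (dot x x)^-1 by rewrite exprVn sqr_sqrtr// ltW.
pose B := [set l2norm (S *m x) | x in [set x : 'cV[R]_k | l2norm x <= 1]].
have ubB : has_ubound B.
  exists (Num.sqrt (\sum_i (\sum_j `|S i j|) ^+ 2)) => _ [y /= y1 <-].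
  have yi1 i : `|y i 0| <= 1.
    rewrite -(@ler_sqr _ _ 1) ?nnegrE// real_normK ?num_real// expr1n.
    apply: (@le_trans _ _ (dot y y)).
      by rewrite dot_sqrE (bigD1 i)//= lerDl sumr_ge0// => j _; exact: sqr_ge0.
    by rewrite -(sqr_sqrtr (dot_ge0 y)) -l2normE expr_le1 ?sqrtr_ge0.
  rewrite l2normE ler_wsqrtr// dot_sqrE; apply: ler_sum => i _.
  rewrite -[leLHS]real_normK ?num_real// lerXn2r ?nnegrE ?sumr_ge0//.
  rewrite mxE (le_trans (ler_norm_sum _ _ _))//.
  by apply: ler_sum => j _; rewrite normrM ler_piMr.
have : l2norm (S *m (c *: x)) <= lambda.
  apply: le_trans opS; apply: ub_le_sup => //; exists (c *: x) => //=.
  by rewrite l2normE dotZl dotZr mulrA -expr2 c2 mulVf// sqrtr1.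
rewrite l2normE -scalemxAr dotZl dotZr mulrA -expr2 c2 => h.
rewrite mulrC -ler_pdivrMl// -(@sqr_sqrtr _ (_^-1 * _)).
  by rewrite lerXn2r ?nnegrE ?sqrtr_ge0.
by rewrite mulr_ge0 ?dot_ge0// invr_ge0 ltW.
Qed.

Lemma Xi_quad (lambda : R) S : 0 <= lambda -> Xi k lambda S ->
  forall x : 'cV[R]_k, dot x (S *m x) <= lambda * dot x x.
Proof.
move=> l0 SX x; apply: le_trans (ler_norm _) _.
rewrite -(@ler_sqr _ _ (lambda * _)) ?nnegrE ?mulr_ge0 ?dot_ge0//.
rewrite real_normK ?num_real// (le_trans (cauchy_schwarz _ _))//.
by rewrite exprMn mulrC [leRHS]mulrA ler_wpM2r ?dot_ge0// Xi_op.
Qed.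

Lemma Xi_intro (lambda : R) (S : 'M[R]_k) : 0 <= lambda -> psd S ->
  (forall x, dot (S *m x) (S *m x) <= lambda ^+ 2 * dot x x) -> Xi k lambda S.
Proof.
move=> l0 pS hS; split=> //; apply: ge_sup.
  by exists (l2norm (S *m 0)), 0 => //=; rewrite l2normE /dot mulmx0 mxE sqrtr0.
move=> _ [x /= x1 <-]; rewrite l2normE -(ger0_norm l0) -sqrtr_sqr ler_wsqrtr//.
apply: le_trans (hS x) _; rewrite ler_piMr ?sqr_ge0//.
by rewrite -(sqr_sqrtr (dot_ge0 x)) -l2normE expr_le1 ?sqrtr_ge0.
Qed.

End Xi.

(** * Exponential moments of the sample covariance *)

Section upper.
Local Open Scope ereal_scope.
Context (R : realType).
Local Notation gam := (normal_prob (0 : R) 1).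

Lemma measurable_rowdot k (y : 'cV[R]_k) :
  measurable_fun setT (fun x : 'rV[R]_k => ((x *m y) 0 0)%R).
Proof.
rewrite (_ : (fun x => _) = (fun x : 'rV[R]_k => \sum_j x 0 j * y j 0)%R); last first.
  by apply/funext => x; rewrite mxE.
apply: measurable_sum => j; apply: measurable_funM => //.
exact: measurable_mx_entry.
Qed.

Lemma gaussian_centered_sqr_mgf k (S : 'M[R]_k) (lambda t : R) (y : 'cV[R]_k) :
  (0 < lambda)%R -> Xi k lambda S -> (dot y y <= 1)%R -> (`|t| <= 8^-1)%R ->
  \int[gaussian S]_x
    (expR (t * (((x *m y) 0 0 ^+ 2 - dot y (S *m y)) / lambda)))%:E <=
  (expR (1024 * t ^+ 2))%:E.
Proof.
move=> l0 SX y1 t8; have [pS _] := SX; have [_ _ LL] := choleskyP pS.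
set L := cholesky S in LL.
have sl0 : (0 < Num.sqrt lambda)%R by rewrite sqrtr_gt0.
have sl2 : (Num.sqrt lambda ^+ 2 = lambda)%R by rewrite sqr_sqrtr// ltW.
(* The observation paired with [y] is a linear form in the standard normal coordinates with
   coefficients L^T y; divided by sqrt lambda, their squares add up to at most 1. *)
pose w (i : 'I_k) : R := ((L^T *m y) i 0 / Num.sqrt lambda)%R.
have w2 : (\sum_i w i ^+ 2 = dot y (S *m y) / lambda)%R.
  rewrite -LL -mulmxA dot_mulmx dot_sqrE mulr_suml; apply: eq_bigr => i _.
  by rewrite /w expr_div_n sl2.
have w1 : (\sum_i w i ^+ 2 <= 1)%R.
  rewrite w2 ler_pdivrMr// mul1r (le_trans (Xi_quad (ltW l0) SX y))//.
  by rewrite ler_piMr// ltW.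
rewrite integral_gaussian//; last first.
  apply/measurable_EFinP; apply: measurableT_comp => //.
  apply: measurable_funM => //; apply: measurable_funM => //.
  apply: measurable_funB => //; apply: measurable_funX.
  exact: measurable_rowdot.
apply: le_trans (gauss_centered_sqr_mgf w1 t8).
rewrite le_eqVlt; apply/orP; left; apply/eqP.
apply: eq_integral => z _; congr (expR (_ * _))%:E.
rewrite w2 mulrBl; congr (_ - _)%R.
rewrite -sl2 -expr_div_n; congr (_ ^+ 2)%R.
rewrite /gaussian_map -/L -mulmxA mxE mulr_suml; apply: eq_bigr => i _.
rewrite [X in (X * _ / _)%R]mxE /w -mulrA mulrC; reflexivity.
Qed.

Definition sample_cov n k (X : 'M[R]_(n, k)) : 'M[R]_k := (n%:R^-1 *: (X^T *m X))%R.

Lemma measurable_sample_cov n k : measurable_fun setT (@sample_cov n k).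
Proof.
apply/measurable_fun_mxP => i j.
rewrite (_ : (fun X => _) =
    (fun X : 'M[R]_(n, k) => n%:R^-1 * \sum_l X l i * X l j)%R); last first.
  by apply/funext => X; rewrite !mxE; congr (_ * _)%R; apply: eq_bigr => l _; rewrite mxE.
apply: measurable_funM => //; apply: measurable_sum => l.
by apply: measurable_funM; exact: measurable_mx_entry.
Qed.

Lemma measurable_sample_cov_quad n k (S : 'M[R]_k) y :
  measurable_fun setT (fun X : 'M[R]_(n, k) => dot y ((sample_cov X - S) *m y)).
Proof.
rewrite (_ : (fun X => _) = (fun X : 'M[R]_(n, k) =>
    \sum_i y i 0 * \sum_j (sample_cov X i j - S i j) * y j 0)%R); last first.
  apply/funext => X; rewrite dotE; apply: eq_bigr => i _; rewrite mxE; congr (_ * _)%R.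
  by apply: eq_bigr => j _; rewrite !mxE.
apply: measurable_sum => i; apply: measurable_funM => //.
apply: measurable_sum => j; apply: measurable_funM => //.
apply: measurable_funB => //.
by have /measurable_fun_mxP := @measurable_sample_cov n k; exact.
Qed.

Lemma sample_cov_quad n k (X : 'M[R]_(n, k)) (S : 'M[R]_k) y : (0 < n)%N ->
  (dot y ((sample_cov X - S) *m y) =
   n%:R^-1 * \sum_i ((row i X *m y) 0 0 ^+ 2 - dot y (S *m y)))%R.
Proof.
move=> n0; rewrite mulmxBl dotDr dotNr sumrB sumr_const card_ord mulrBr.
congr (_ - _)%R; last by rewrite -[(dot y _ *+ n)%R]mulr_natl mulKf// pnatr_eq0 -lt0n.
rewrite /sample_cov -scalemxAl dotZr -mulmxA dot_mulmx trmxK dot_sqrE.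
by congr (_ * _)%R; apply: eq_bigr => i _; rewrite -row_mul [in RHS]mxE.
Qed.

Lemma sample_cov_mgf n k (S : 'M[R]_k) (lambda t : R) (y : 'cV[R]_k) :
  (0 < n)%N -> (0 < lambda)%R -> Xi k lambda S -> (dot y y <= 1)%R ->
  (`|t| <= 8^-1)%R ->
  \int[gaussian_sample n S]_X
    (expR (t * n%:R / lambda * dot y ((sample_cov X - S) *m y)))%:E <=
  (expR (1024 * t ^+ 2 * n%:R))%:E.
Proof.
move=> n0 l0 SX y1 t8.
pose f (x : 'rV[R]_k) := expR (t * (((x *m y) 0 0 ^+ 2 - dot y (S *m y)) / lambda))%R.
have mf : measurable_fun setT f.
  apply: measurableT_comp => //.
  apply: measurable_funM => //; apply: measurable_funM => //.
  apply: measurable_funB => //; apply: measurable_funX.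
  exact: measurable_rowdot.
have nn0 : (n%:R != 0 :> R)%R by rewrite pnatr_eq0 -lt0n.
rewrite integral_gaussian_sample//; last first.
  apply/measurable_EFinP; apply: measurableT_comp => //.
  apply: measurable_funM => //.
  exact: measurable_sample_cov_quad.
have -> : \int[iid (gaussian S) n]_x
    (expR (t * n%:R / lambda * dot y ((sample_cov (mx_of_rows x) - S) *m y)))%:E =
    \int[iid (gaussian S) n]_x (\prod_(i < n) f (tnth x i))%:E.
  apply: eq_integral => x _; rewrite sample_cov_quad// /f -expR_sum.
  congr (expR _)%:E; rewrite -mulr_sumr -mulr_suml.
  have rowE i : row i (mx_of_rows x) = tnth x i by apply/rowP => j; rewrite !mxE.
  under eq_bigr do rewrite rowE.
  by field; rewrite nn0 gt_eqF.
rewrite (integral_iid_prod (gaussian S) (f := fun=> f))//; last first.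
  by move=> i x; exact: expR_ge0.
have := gaussian_centered_sqr_mgf l0 SX y1 t8.
rewrite -[(fun x => _)]/(EFin \o f) => hle.
have h0 : 0 <= \int[gaussian S]_x (f x)%:E.
  by apply: integral_ge0 => x _; rewrite lee_fin expR_ge0.
rewrite (mulrC _ n%:R) expRM_natl.
move: hle h0 => /=; case: (\int[_]_x _) => [r| |]//= hle h0.
by rewrite prodEFin prodr_const card_ord lee_fin lerXn2r ?nnegrE ?expR_ge0.
Qed.

End upper.

(** * Risk of the sample covariance and of the zero estimator *)

Section upper_bound.
Local Open Scope ereal_scope.
Context (R : realType).

(** Turns an exponential moment into a second moment: up to the threshold [M] the square costs M^2,
    beyond it the excess costs exp (v - M). *)
Lemma sqr_le_exp_excess (v M : R) : (0 <= v)%R -> (0 <= M)%R ->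
  (v ^+ 2 <= 2 * M ^+ 2 + 8 * (expR v / expR M))%R.
Proof.
move=> v0 M0; rewrite -expRB; have [vM|vM] := lerP v M.
  have := expR_ge0 (v - M); nra.
have := @sqr_le_4expR _ (v - M)%R; rewrite subr_ge0 (ltW vM) => /(_ isT).
have := sqr_ge0 (v - 2 * M)%R; nra.
Qed.

Lemma sample_cov_risk n k (lambda : R) (tau : 'rV[R]_k -> R) (S : 'M[R]_k) :
  (0 < k)%N -> (k <= n)%N -> (0 < lambda)%R -> symmetric_gauge tau ->
  Xi k lambda S ->
  risk tau (@sample_cov R n k) S <=
  (24 ^+ 2 * (2 * 34 ^+ 2 + 16) * (k%:R / n%:R) * lambda ^+ 2 * tau (const_mx 1) ^+ 2)%:E.
Proof.
move=> k0 kn l0 tauP SX; have n0 : (0 < n)%N by exact: leq_trans kn.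
have [[symS _] _] := SX.
have kR : (0 < k%:R :> R)%R by rewrite ltr0n.
have nR : (0 < n%:R :> R)%R by rewrite ltr0n.
have kn0 : (0 <= k%:R / n%:R :> R)%R by rewrite divr_ge0.
pose sq := Num.sqrt (k%:R / n%:R : R).
have sq2 : (sq ^+ 2 = k%:R / n%:R)%R by rewrite sqr_sqrtr.
have sq0 : (0 < sq)%R by rewrite sqrtr_gt0 divr_gt0.
(* The assumption k <= n keeps t <= 1/8, and 1024 t^2 n = 16 k makes each exponential moment
   comparable with the size of the net. *)
pose t := (sq / 8)%R.
have t0 : (0 < t)%R by rewrite divr_gt0.
have t8 : (`|t| <= 8^-1)%R.
  rewrite gtr0_norm// /t -[leRHS]mul1r ler_wpM2r//.
  by rewrite -(@ler_sqr _ _ 1%R) ?nnegrE ?(ltW sq0)// sq2 expr1n ler_pdivrMr// mul1r ler_nat.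
have t2n : (t ^+ 2 * n%:R = k%:R / 64)%R.
  by rewrite /t expr_div_n sq2; field; rewrite gt_eqF.
pose ka := (t * n%:R / lambda)%R.
have ka0 : (0 < ka)%R by rewrite divr_gt0// mulr_gt0.
pose dX (f : {ffun 'I_k -> bool * 'I_(4 * k).+1}) (X : 'M[R]_(n, k)) : R :=
  dot (netpt R f) ((sample_cov X - S)%R *m netpt R f).
(* 34 k = 18 k + 16 k: logarithm of the net size plus logarithm of the bound for one exponential
   moment. *)
pose M := (34 * k%:R : R)%R.
have M0 : (0 <= M)%R by rewrite mulr_ge0.
(* A sum in place of the maximum over the net: it is integrated term by term and dominates the
   exponential at whichever point [sym_quad_net] selects for [X]. *)
pose T (X : 'M[R]_(n, k)) : R :=
  (\sum_(f in net k) (expR (ka * dX f X) + expR (- ka * dX f X)))%R.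
have mdX f : measurable_fun setT (dX f) by exact: measurable_sample_cov_quad.
have me c f : measurable_fun setT (fun X => expR (c * dX f X)).
  by apply: measurableT_comp => //; exact: measurable_funM.
have T0 X : (0 <= T X)%R by apply: sumr_ge0 => f _; rewrite addr_ge0// expR_ge0.
have mT : measurable_fun setT T.
  rewrite (_ : T = (fun X => \sum_(f <- enum (net k))
      (expR (ka * dX f X) + expR (- ka * dX f X)))%R).
    by apply: measurable_sum => f; exact: measurable_funD.
  by apply/funext => X; rewrite big_enum.
have intT : \int[gaussian_sample n S]_X (T X)%:E <= (2 * expR M)%:E.
  rewrite (eq_integral (fun X => \sum_(f <- enum (net k))
      ((expR (ka * dX f X))%:E + (expR (- ka * dX f X))%:E))); last first.
    by move=> X _; rewrite /T -big_enum sumEFin.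
  rewrite ge0_integral_sum//; last 2 first.
  - by move=> f; apply: emeasurable_funD; apply/measurable_EFinP; exact: me.
  - by move=> f X _; rewrite adde_ge0// lee_fin expR_ge0.
  apply: (@le_trans _ _ (\sum_(f <- enum (net k)) (2 * expR (16 * k%:R))%:E)); last first.
    rewrite sumEFin big_enum sumr_const /= lee_fin -[leLHS]mulr_natr.
    have -> : (M = 18 * k%:R + 16 * k%:R)%R by rewrite /M; ring.
    by rewrite expRD; have := net_card R k; have := expR_gt0 (16 * k%:R : R); nra.
  rewrite !big_enum; apply: lee_sum => f fN.
  rewrite ge0_integralD//; try exact/measurable_EFinP.
  have bd u : (`|u| <= 8^-1)%R -> (u ^+ 2 = t ^+ 2)%R ->
      \int[gaussian_sample n S]_X (expR (u * n%:R / lambda * dX f X))%:E <=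
      (expR (16 * k%:R))%:E.
    move=> u8 u2.
    apply: le_trans (sample_cov_mgf n0 l0 SX (netpt_dot_le1 R k0 fN) u8) _.
    by rewrite lee_fin ler_expR u2 -mulrA t2n; lra.
  rewrite mulr_natl mulr2n EFinD; apply: leeD; first exact: bd.
  rewrite /ka -2!mulNr; apply: bd; first by rewrite normrN.
  by rewrite sqrrN.
have ptw X : (ui_norm tau (sample_cov X - S) ^+ 2 <=
   9 / ka ^+ 2 * tau (const_mx 1) ^+ 2 * (2 * M ^+ 2 + 8 * (T X / expR M)))%R.
  have symA : ((sample_cov X - S)^T = sample_cov X - S)%R.
    by rewrite linearB /= symS /sample_cov linearZ /= trmx_mul trmxK.
  have [f fN fQ] := sym_quad_net k0 symA.
  set d := `|_|%R in fQ; have d0 : (0 <= d)%R by exact: normr_ge0.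
  have q0 : (0 <= 3 * d)%R by rewrite mulr_ge0.
  have := ui_norm_le tauP q0 (sym_quad_op symA q0 fQ).
  have u0 := ui_norm_ge0 (sample_cov X - S)%R tauP.
  have g0 := gauge_ge0 tauP (const_mx 1%R).
  move=> h; apply: (@le_trans _ _ ((3 * d * tau (const_mx 1)) ^+ 2)%R).
    by rewrite lerXn2r ?nnegrE// mulr_ge0.
  have -> : ((3 * d * tau (const_mx 1)) ^+ 2 =
      9 / ka ^+ 2 * tau (const_mx 1) ^+ 2 * (ka * d) ^+ 2)%R.
    by field; rewrite gt_eqF.
  rewrite ler_wpM2l//.
    by rewrite mulr_ge0 ?sqr_ge0// mulr_ge0// invr_ge0 sqr_ge0.
  have kd0 : (0 <= ka * d)%R by rewrite mulr_ge0// ltW.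
  apply: le_trans (sqr_le_exp_excess kd0 M0) _.
  rewrite lerD2l ler_wpM2l// ler_wpM2r ?invr_ge0 ?expR_ge0//.
  rewrite /T (bigD1 f)//=.
  apply: (@le_trans _ _ (expR (ka * dX f X) + expR (- ka * dX f X))%R); last first.
    by rewrite lerDl sumr_ge0// => g _; rewrite addr_ge0 ?expR_ge0.
  rewrite /d -/(dX f X); case: (ger0P (dX f X)) => _.
    by rewrite lerDl expR_ge0.
  by rewrite mulrN -mulNr lerDr expR_ge0.
rewrite /risk unlock.
set c1 := (9 / ka ^+ 2 * tau (const_mx 1) ^+ 2)%R in ptw.
have c10 : (0 <= c1)%R by rewrite /c1 mulr_ge0 ?sqr_ge0// mulr_ge0// invr_ge0 sqr_ge0.
apply: (@le_trans _ _ (\int[gaussian_sample n S]_X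
   (c1%:E * ((2 * M ^+ 2)%:E + (8 / expR M)%:E * (T X)%:E)))).
  apply: ge0_le_integral_nm => X; first by rewrite lee_fin sqr_ge0.
  rewrite -!(EFinM, EFinD) lee_fin; apply: le_trans (ptw X) _.
  by rewrite le_eqVlt; apply/orP; left; apply/eqP; congr (_ * (_ + _))%R; ring.
have M20 : (0 <= 2 * M ^+ 2)%R by rewrite mulr_ge0// sqr_ge0.
have e80 : (0 <= 8 / expR M)%R by rewrite mulr_ge0// invr_ge0 expR_ge0.
have meT : measurable_fun setT (fun X => (8 / expR M)%:E * (T X)%:E).
  by apply: measurable_funeM; exact/measurable_EFinP.
have eT0 X : 0 <= (8 / expR M)%:E * (T X)%:E by rewrite mule_ge0// lee_fin.
rewrite ge0_integralZl//; last 2 first.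
- exact: emeasurable_funD.
- by move=> X _; rewrite adde_ge0// lee_fin.
rewrite ge0_integralD// integral_cst_probability ge0_integralZl//; last 2 first.
- exact/measurable_EFinP.
- by move=> X _; rewrite lee_fin.
apply: (@le_trans _ _ (c1%:E * ((2 * M ^+ 2)%:E + (8 / expR M)%:E * (2 * expR M)%:E))).
  by rewrite lee_wpmul2l ?lee_fin// leeD2l// lee_wpmul2l ?lee_fin.
rewrite -!(EFinM, EFinD) lee_fin.
have k1 : (1 <= k%:R :> R)%R by rewrite ler1n.
have -> : (8 / expR M * (2 * expR M) = 16)%R by field; rewrite gt_eqF ?expR_gt0.
apply: (@le_trans _ _ (c1 * ((2 * 34 ^+ 2 + 16) * k%:R ^+ 2))%R).
  rewrite ler_wpM2l// /M; have : (1 <= k%:R ^+ 2 :> R)%R by rewrite exprn_ege1.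
  by set k2 := (k%:R ^+ 2)%R; rewrite exprMn -/k2; lra.
rewrite le_eqVlt; apply/orP; left; apply/eqP; rewrite /c1.
have -> : (ka ^+ 2 = k%:R * n%:R / (64 * lambda ^+ 2))%R.
  rewrite /ka expr_div_n exprMn (_ : n%:R ^+ 2 = n%:R * n%:R)%R// mulrA t2n.
  by field; rewrite gt_eqF.
by field; rewrite !gt_eqF.
Qed.

Lemma zero_estimator_risk n k (lambda : R) (tau : 'rV[R]_k -> R) (S : 'M[R]_k) :
  (0 < lambda)%R -> symmetric_gauge tau -> Xi k lambda S ->
  risk tau (fun _ : 'M[R]_(n, k) => 0%R) S <=
  (lambda ^+ 2 * tau (const_mx 1) ^+ 2)%:E.
Proof.
move=> l0 tauP SX; rewrite /risk unlock sub0r.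
have op (x : 'cV[R]_k) : (dot (- S *m x) (- S *m x) <= lambda ^+ 2 * dot x x)%R.
  by rewrite mulNmx dotNl dotNr opprK; exact: (Xi_op (ltW l0) SX).
have := ui_norm_le tauP (ltW l0) op.
have := ui_norm_ge0 (- S)%R tauP; have g0 := gauge_ge0 tauP (const_mx 1%R).
move=> u0 h; rewrite integral_cst_probability lee_fin -exprMn.
by rewrite lerXn2r ?nnegrE// mulr_ge0// ltW.
Qed.

Lemma minimax_upper n k (lambda : R) (tau : 'rV[R]_k -> R) :
  (0 < n)%N -> (0 < k)%N -> (0 < lambda)%R -> symmetric_gauge tau ->
  minimax_risk n lambda tau <=
  (24 ^+ 2 * (2 * 34 ^+ 2 + 16) * Num.min (k%:R / n%:R) 1 * lambda ^+ 2
     * tau (const_mx 1) ^+ 2)%:E.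
Proof.
move=> n0 k0 l0 tauP; have nR : (0 < n%:R :> R)%R by rewrite ltr0n.
have [kn|nk] := leqP k n.
  rewrite min_l; last by rewrite ler_pdivrMr// mul1r ler_nat.
  apply: (@le_trans _ _ (ereal_sup [set risk tau (@sample_cov R n k) S | S in Xi k lambda])).
    apply: ereal_inf_lbound; exists (@sample_cov R n k) => //.
    exact: measurable_sample_cov.
  apply: ge_ereal_sup => _ [S SX <-]; exact: sample_cov_risk.
rewrite min_r; last by rewrite ler_pdivlMr// mul1r ler_nat ltnW.
apply: (@le_trans _ _ (ereal_sup
    [set risk tau (fun _ : 'M[R]_(n, k) => 0%R) S | S in Xi k lambda])).
  by apply: ereal_inf_lbound; exists (fun=> 0%R) => //; exact: measurable_cst.
apply: ge_ereal_sup => _ [S SX <-].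
apply: le_trans (zero_estimator_risk n l0 tauP SX) _.
have K0 : (0 <= lambda ^+ 2 * tau (const_mx 1) ^+ 2)%R by apply: mulr_ge0; exact: sqr_ge0.
have a : (1 <= (24 : R) ^+ 2)%R by rewrite exprn_ege1//; lra.
have b : (1 <= 2 * (34 : R) ^+ 2 + 16)%R by have := sqr_ge0 (34 : R); lra.
rewrite lee_fin mulr1 -[leRHS]mulrA; apply: ler_peMl K0 _.
by apply: le_trans (ler_pM _ _ a b); rewrite ?mulr1.
Qed.

End upper_bound.

(** * Lower bound *)

(** The positive corner entry is recovered from its square and divided out of the first column; the
    remaining blocks satisfy the same equation. Only a nonnegative diagonal is asked of [L'], as
    [is_cholesky] provides. *)
Lemma trig_mul_tr_inj (R : realType) k (L L' : 'M[R]_k) :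
  is_trig_mx L -> is_trig_mx L' -> (forall i, 0 < L i i) -> (forall i, 0 <= L' i i) ->
  L *m L^T = L' *m L'^T -> L = L'.
Proof.
elim: k L L' => [|k IHk] L L'; first by move=> *; apply/matrixP => -[].
rewrite -[k.+1]/(1 + k)%N in L L' *.
rewrite -[L]submxK -[L']submxK !is_trig_block_mx//.
set a := ulsubmx L; set w := dlsubmx L; set M := drsubmx L.
set a' := ulsubmx L'; set w' := dlsubmx L'; set M' := drsubmx L'.
move=> /and3P[/eqP -> _ trigM] /and3P[/eqP -> _ trigM'] pL pL'.
have a0 : 0 < a 0 0 by have := pL (lshift k 0); rewrite block_mxEul.
have a'0 : 0 <= a' 0 0 by have := pL' (lshift k 0); rewrite block_mxEul.
rewrite !tr_block_mx !mulmx_block !trmx0 !(mulmx0, mul0mx, addr0).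
move=> /eq_block_mx[eaa _ ewa eMM].
have sq (x : 'M[R]_1) : (x *m x^T) 0 0 = x 0 0 ^+ 2.
  by rewrite mxE big_ord1 [X in _ * X]mxE expr2.
have ea : a = a'.
  apply/matrixP => i j; rewrite !ord1; apply/eqP.
  rewrite -(@eqrXn2 _ 2)//; last exact: ltW.
  by rewrite -!sq eaa.
have ew : w = w'.
  apply/matrixP => i j; have /matrixP/(_ i 0) := ewa; rewrite -ea ord1.
  have wa (x : 'cV[R]_k) : (x *m a^T) i 0 = x i 0 * a 0 0.
    by rewrite [LHS]mxE big_ord1 [X in _ * X]mxE.
  by rewrite !wa; exact: (mulIf (lt0r_neq0 a0)).
rewrite ea ew; congr block_mx; apply: IHk => //.
- by move=> i; have := pL (rshift 1 i); rewrite block_mxEdr.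
- by move=> i; have := pL' (rshift 1 i); rewrite block_mxEdr.
- by move: eMM; rewrite ew => /addrI.
Qed.

(** Identifies the chosen factor in [gaussian S] with an explicit one. *)
Lemma cholesky_unique (R : realType) k (S L : 'M[R]_k) :
  is_trig_mx L -> (forall i, 0 < L i i) -> L *m L^T = S -> cholesky S = L.
Proof.
move=> trigL pL defS; have pS : psd S.
  split; first by rewrite -defS trmx_mul trmxK.
  move=> x; rewrite -defS; have := dot_ge0 (L^T *m x).
  by rewrite /dot trmx_mul trmxK !mulmxA.
have [trigC pC defC] := choleskyP pS.
by apply/esym/trig_mul_tr_inj => //; rewrite defC.
Qed.

(** The weighted variance of [u] about its mean is nonnegative. *)
Lemma jensen_dot (R : realType) k (I : finType) (G : {set I}) (c : I -> R)
    (u : I -> 'cV[R]_k) :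
  (forall i, 0 <= c i) -> \sum_(i in G) c i = 1 ->
  dot (\sum_(i in G) c i *: u i) (\sum_(i in G) c i *: u i) <=
  \sum_(i in G) c i * dot (u i) (u i).
Proof.
move=> c0 c1; set m := \sum_(i in G) _.
have lin v : dot m v = \sum_(i in G) c i * dot (u i) v.
  rewrite /m; elim/big_rec2: _ => [|i y x _ IH]; first by rewrite /dot trmx0 mul0mx mxE.
  by rewrite dotDl dotZl IH.
have : 0 <= \sum_(i in G) c i * dot (u i - m) (u i - m).
  by apply: sumr_ge0 => i _; rewrite mulr_ge0// dot_ge0.
have -> : \sum_(i in G) c i * dot (u i - m) (u i - m) =
    \sum_(i in G) c i * dot (u i) (u i) - 2 * (\sum_(i in G) c i * dot (u i) m)
    + (\sum_(i in G) c i) * dot m m.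
  rewrite mulr_sumr mulr_suml -sumrB -big_split/=; apply: eq_bigr => i _.
  by rewrite !(dotDl, dotDr, dotNl, dotNr) (dotC m (u i)); ring.
by rewrite c1 -lin; lra.
Qed.

(** * From Hellinger affinity to the overlap of two densities *)

Section affinity.
Local Open Scope ereal_scope.
Context d (T : measurableType d) (R : realType) (mu : probability T R).

(** Since f g <= min (f, g) * (f + g), the arithmetic-geometric inequality gives h <= 2 min (f, g) +
    (f + g) / 8. The weight 1/8 makes the last term integrate to 1/4, half of the affinity. *)
Lemma affinity_min (f g h : T -> R) :
  measurable_fun setT f -> measurable_fun setT g ->
  (forall x, 0 < f x)%R -> (forall x, 0 < g x)%R -> (forall x, 0 <= h x)%R ->
  (forall x, h x ^+ 2 = f x * g x)%R ->
  \int[mu]_x (f x)%:E = 1 -> \int[mu]_x (g x)%:E = 1 ->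
  (2^-1)%:E <= \int[mu]_x (h x)%:E ->
  (8^-1)%:E <= \int[mu]_x (Num.min (f x) (g x))%:E.
Proof.
move=> mf mg f0 g0 h0 hfg intf intg inth.
have mm : measurable_fun setT (fun x => Num.min (f x) (g x)) by exact: measurable_minr.
have pt x : (h x <= 2 * Num.min (f x) (g x) + (f x + g x) / 8)%R.
  rewrite -ler_sqr ?nnegrE ?h0//; last first.
    by rewrite addr_ge0 ?mulr_ge0 ?le_min ?addr_ge0 ?(ltW (f0 x)) ?(ltW (g0 x)).
  rewrite hfg; have := f0 x; have := g0 x.
  case: (lerP (f x) (g x)) => fg a b.
    have := sqr_ge0 (2 * f x - (f x + g x) / 8)%R; nra.
  have := sqr_ge0 (2 * g x - (f x + g x) / 8)%R; nra.
have m0 x : 0 <= (Num.min (f x) (g x))%:E.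
  by rewrite lee_fin le_min (ltW (f0 x)) (ltW (g0 x)).
have fE x : 0 <= (f x)%:E by rewrite lee_fin ltW.
have gE x : 0 <= (g x)%:E by rewrite lee_fin ltW.
have mfE : measurable_fun setT (fun x => (f x)%:E) by exact/measurable_EFinP.
have mgE : measurable_fun setT (fun x => (g x)%:E) by exact/measurable_EFinP.
have mmE : measurable_fun setT (fun x => (Num.min (f x) (g x))%:E) by exact/measurable_EFinP.
have : (2^-1)%:E <= \int[mu]_x (2%:E * (Num.min (f x) (g x))%:E
     + (8^-1)%:E * ((f x)%:E + (g x)%:E)).
  apply: le_trans inth _; apply: ge0_le_integral_nm => x; first by rewrite lee_fin.
  by rewrite -!(EFinM, EFinD) lee_fin mulrC; apply: le_trans (pt x) _; lra.
rewrite ge0_integralD//; last 4 first.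
- by move=> x _; rewrite mule_ge0.
- exact: measurable_funeM.
- by move=> x _; rewrite mule_ge0// adde_ge0.
- by apply: measurable_funeM; exact: emeasurable_funD.
rewrite !ge0_integralZl//; last 2 first.
- exact: emeasurable_funD.
- by move=> x _; rewrite adde_ge0.
rewrite ge0_integralD// intf intg.
set I := integral _ _ _; have : 0 <= I by exact: integral_ge0.
case: I => [r| |]//=; last by move=> _ _; rewrite leey.
by rewrite -!(EFinM, EFinD) !lee_fin => _ h1; lra.
Qed.

End affinity.

(** * Assouad's method on the cube of signs *)

Section hypercube.
Context (R : realType) (J : finType).
Local Notation cube := {ffun J -> bool}.

Definition flip (j : J) (w : cube) : cube := [ffun i => (i == j) (+) w i].

Lemma flipK j : involutive (flip j).
Proof. by move=> w; apply/ffunP => i; rewrite !ffunE addbA addbb. Qed.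

Definition sgn (w : cube) j : R := (-1) ^+ w j.

Lemma sgn_flip w j : sgn (flip j w) j = - sgn w j.
Proof. by rewrite /sgn ffunE eqxx addTb; case: (w j); rewrite ?opprK. Qed.

Lemma sgn_sqr w j : sgn w j ^+ 2 = 1.
Proof. by rewrite /sgn sqrr_sign. Qed.

(** Patterns are paired with their flips: for any centre [m], (m - s)^2 + (m + s)^2 >= 2 when s^2 =
    1, and both weights are at least their minimum. *)
Lemma flip_variance (G : {set cube}) (p : cube -> R) j m :
  (forall w, 0 <= p w) ->
  \sum_(w in G | flip j w \in G) Num.min (p w) (p (flip j w)) <=
  \sum_(w in G) p w * (m - sgn w j) ^+ 2.
Proof.
move=> p0; pose V w := p w * (m - sgn w j) ^+ 2.
have V0 w : 0 <= V w by rewrite mulr_ge0// sqr_ge0.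
apply: (@le_trans _ _ (\sum_(w in G | flip j w \in G) V w)); last first.
  rewrite [leRHS](bigID (fun w => flip j w \in G))/= lerDl.
  by apply: sumr_ge0 => w _; exact: V0.
have refl : \sum_(w in G | flip j w \in G) V w =
    \sum_(w in G | flip j w \in G) V (flip j w).
  rewrite (reindex_inj (inv_inj (flipK j))); apply: eq_bigl => w.
  by rewrite flipK andbC.
suff : 2 * \sum_(w in G | flip j w \in G) Num.min (p w) (p (flip j w)) <=
    \sum_(w in G | flip j w \in G) V w + \sum_(w in G | flip j w \in G) V (flip j w).
  by rewrite -refl; lra.
rewrite mulr_sumr -big_split/=; apply: ler_sum => w _.
rewrite /V sgn_flip opprK.
have := p0 w; have := p0 (flip j w); have := sgn_sqr w j.
set s := sgn w j; set x := p w; set y := p _ => ss y0 x0.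
have h1 : Num.min x y * (m - s) ^+ 2 <= x * (m - s) ^+ 2.
  by rewrite ler_wpM2r ?sqr_ge0// ge_min lexx.
have h2 : Num.min x y * (m + s) ^+ 2 <= y * (m + s) ^+ 2.
  by rewrite ler_wpM2r ?sqr_ge0// ge_min lexx orbT.
have m0 : 0 <= Num.min x y by rewrite le_min x0.
have h3 : 0 <= Num.min x y * m ^+ 2 by rewrite mulr_ge0// sqr_ge0.
have h4 : Num.min x y * ((m - s) ^+ 2 + (m + s) ^+ 2) = 2 * Num.min x y * m ^+ 2 + 2 * Num.min x y.
  have -> : (m - s) ^+ 2 + (m + s) ^+ 2 = 2 * m ^+ 2 + 2 * s ^+ 2 by ring.
  by rewrite ss; ring.
lra.
Qed.

End hypercube.

Section assouad_pointwise.
Context (R : realType) (k : nat) (J : finType) (P : pred J).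
Local Notation cube := {ffun J -> bool}.
Variables (D : J -> 'M[R]_k) (S : cube -> 'M[R]_k) (G : {set cube}).
Variables (a b : R) (c : J -> R).
Hypotheses (a0 : 0 <= a) (b0 : 0 < b).
Hypothesis trS : forall w j, w \in G -> P j -> \tr ((S w)^T *m D j) = c j + a * sgn R w j.
Hypothesis opB : forall w x, w \in G ->
  let B := \sum_(j | P j) sgn R w j *: D j in dot (B *m x) (B *m x) <= b ^+ 2 * dot x x.

(** Posterior mean of the sign [j] for the uniform prior on [G] and likelihoods [p]. *)
Definition post_mean (p : cube -> R) j : R :=
  (\sum_(w in G) p w * sgn R w j) / \sum_(w in G) p w.

(* For [w] in [G] this is the pairing of [A - S w] with [T / (2 * b)], where [T] is the
   matrix of [witness_op]. *)
Definition witness (p : cube -> R) (A : 'M[R]_k) (w : cube) : R :=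
  (\sum_(j | P j) (post_mean p j - sgn R w j) *
     (\tr (A^T *m D j) - c j - a * sgn R w j)) / (2 * b).

Variable p : cube -> R.
Hypothesis p0 : forall w, 0 < p w.
Variable w0 : cube.
Hypothesis w0G : w0 \in G.

Let W := \sum_(w in G) p w.

Let W0 : 0 < W.
Proof.
rewrite /W (bigD1 w0)//= ltr_pwDl ?p0//.
by apply: sumr_ge0 => w _; exact: ltW.
Qed.

Lemma post_mean_center j : \sum_(w in G) p w * (post_mean p j - sgn R w j) = 0.
Proof.
under eq_bigr do rewrite mulrBr.
by rewrite sumrB -mulr_suml /post_mean -/W mulrC divfK ?gt_eqF// subrr.
Qed.

(** The centred signs have posterior mean zero, so every term free of [w], in particular that of the
    estimate [A], drops out; the posterior variances remain. *)
Lemma sum_witness A : \sum_(w in G) p w * witness p A w =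
  a / (2 * b) * \sum_(j | P j) \sum_(w in G) p w * (post_mean p j - sgn R w j) ^+ 2.
Proof.
transitivity ((2 * b)^-1 * \sum_(j | P j) \sum_(w in G) p w *
   ((post_mean p j - sgn R w j) * (\tr (A^T *m D j) - c j - a * sgn R w j))).
  rewrite exchange_big/= mulr_sumr; apply: eq_bigr => w _.
  by rewrite /witness -mulr_sumr mulrA mulrC.
rewrite [a / _]mulrC -[RHS]mulrA; congr (_ * _); rewrite mulr_sumr.
apply: eq_bigr => j _; set v := \tr _ - c j; set m := post_mean p j.
transitivity ((v - a * m) * \sum_(w in G) p w * (m - sgn R w j)
    + a * \sum_(w in G) p w * (m - sgn R w j) ^+ 2).
  rewrite !mulr_sumr -big_split/=; apply: eq_bigr => w _; ring.
by rewrite post_mean_center mulr0 add0r.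
Qed.

Lemma sum_witness_ge A :
  a / (2 * b) * \sum_(j | P j)
    \sum_(w in G | flip j w \in G) Num.min (p w) (p (flip j w)) <=
  \sum_(w in G) p w * witness p A w.
Proof.
rewrite sum_witness ler_wpM2l ?divr_ge0// ?mulr_ge0 ?(ltW b0)//.
by apply: ler_sum => j _; apply: flip_variance => w; exact: ltW.
Qed.

(** The matrix is the posterior average over v in [G] of B v - B w, and each of these has operator
    norm at most 2 b. Here it matters that the posterior lives on [G]. *)
Lemma witness_op w x : w \in G ->
  let T := \sum_(j | P j) (post_mean p j - sgn R w j) *: D j in
  dot (T *m x) (T *m x) <= (2 * b) ^+ 2 * dot x x.
Proof.
move=> wG /=; pose B v := \sum_(j | P j) sgn R v j *: D j.
have -> : \sum_(j | P j) (post_mean p j - sgn R w j) *: D j =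
    \sum_(v in G) (p v / W) *: (B v - B w).
  have -> : \sum_(v in G) (p v / W) *: (B v - B w) =
      \sum_(v in G) \sum_(j | P j) (p v / W * (sgn R v j - sgn R w j)) *: D j.
    apply: eq_bigr => v _; rewrite /B -sumrB scaler_sumr; apply: eq_bigr => j _.
    by rewrite -scalerBl scalerA.
  rewrite exchange_big/=; apply: eq_bigr => j _; rewrite -scaler_suml; congr (_ *: _).
  under [RHS]eq_bigr do rewrite mulrBr mulrAC.
  rewrite sumrB -!mulr_suml -/W /post_mean -/W mulfV ?gt_eqF// mul1r//.
have c1 : \sum_(v in G) p v / W = 1 by rewrite -mulr_suml -/W mulfV ?gt_eqF.
have c0 v : 0 <= p v / W by rewrite divr_ge0// ltW.
rewrite mulmx_suml; under eq_bigr do rewrite -scalemxAl.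
apply: le_trans (jensen_dot _ c0 c1) _.
apply: (@le_trans _ _ (\sum_(v in G) p v / W * ((2 * b) ^+ 2 * dot x x))); last first.
  by rewrite -mulr_suml c1 mul1r.
apply: ler_sum => v vG; rewrite ler_wpM2l// mulmxBl.
have h1 := opB x vG; have h2 := opB x wG; rewrite /= -/(B _) in h1 h2.
have := dot_ge0 (B v *m x + B w *m x).
rewrite !(dotDl, dotDr, dotNl, dotNr) (dotC (B w *m x) (B v *m x)) => h3.
rewrite exprMn; lra.
Qed.

Lemma witness_le tau A w : symmetric_gauge tau -> w \in G ->
  tau (const_mx 1) * witness p A w <= k%:R * ui_norm tau (A - S w).
Proof.
move=> tauP wG; have b20 : 0 <= 2 * b by rewrite mulr_ge0// ltW.
have := ui_norm_ge (A - S w) tauP b20 (fun x => witness_op x wG).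
rewrite (_ : \tr _ = \sum_(j | P j) (post_mean p j - sgn R w j) *
     (\tr (A^T *m D j) - c j - a * sgn R w j)) => [h|].
  rewrite /witness mulrA ler_pdivrMr ?mulr_gt0//.
  by apply: le_trans h _; rewrite mulrAC.
rewrite mulmx_sumr linear_sum/=; apply: eq_bigr => j Pj.
rewrite -scalemxAr mxtraceZ; congr (_ * _).
by rewrite linearB/= mulmxBl linearB/= trS// opprD addrA.
Qed.

End assouad_pointwise.

Section assouad.
Local Open Scope ereal_scope.
Context (R : realType) (n k : nat) (J : finType) (P : pred J).
Local Notation cube := {ffun J -> bool}.
Variables (lambda : R) (tau : 'rV[R]_k -> R).
Variables (D : J -> 'M[R]_k) (S : cube -> 'M[R]_k) (G : {set cube}).
Variables (a b r : R) (c : J -> R).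
Variables (Q : probability 'rV[R]_k R) (f : cube -> 'rV[R]_k -> R).
Variable h : J -> cube -> 'rV[R]_k -> R.
Hypotheses (k0 : (0 < k)%N) (tauP : symmetric_gauge tau).
Hypotheses (a0 : (0 <= a)%R) (b0 : (0 < b)%R).
Hypothesis trS : forall w j, w \in G -> P j -> \tr ((S w)^T *m D j) = (c j + a * sgn R w j)%R.
Hypothesis opB : forall w x, w \in G ->
  let B := (\sum_(j | P j) sgn R w j *: D j)%R in (dot (B *m x) (B *m x) <= b ^+ 2 * dot x x)%R.
Hypothesis SX : forall w, w \in G -> Xi k lambda (S w).
Hypotheses (mf : forall w, measurable_fun setT (f w)) (f0 : forall w x, (0 < f w x)%R).
Hypothesis fE : forall w (F : 'rV[R]_k -> \bar R), w \in G ->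
  measurable_fun setT F -> (forall x, 0 <= F x) ->
  \int[gaussian (S w)]_x F x = \int[Q]_x (F x * (f w x)%:E).
Hypotheses (mh : forall j w, measurable_fun setT (h j w)) (h0 : forall j w x, (0 <= h j w x)%R).
Hypothesis hE : forall j w x, (h j w x ^+ 2 = f w x * f (flip j w) x)%R.
Hypothesis inth : forall j w, P j -> r%:E <= \int[Q]_x (h j w x)%:E.
Hypotheses (r0 : (0 <= r)%R) (rn : (2^-1 <= r ^+ n)%R).
Hypothesis cardG : forall j, P j ->
  (#|{: cube}| <= 2 * #|finset (fun w => (w \in G) && (flip j w \in G))|)%N.
Variable j0 : J.
Hypothesis Pj0 : P j0.

Let mu := iid Q n.
Let p (t : n.-tuple 'rV[R]_k) (w : cube) : R := (\prod_(i < n) f w (tnth t i))%R.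

Let p0 t w : (0 < p t w)%R. Proof. exact: prodr_gt0. Qed.

Let mp w : measurable_fun setT (p ^~ w).
Proof. exact: (measurable_prod_tnth (fun=> mf w)). Qed.

Let sampleE w (F : 'M[R]_(n, k) -> \bar R) : w \in G ->
  measurable_fun setT F -> (forall x, 0 <= F x) ->
  \int[gaussian_sample n (S w)]_X F X = \int[mu]_t (F (mx_of_rows t) * (p t w)%:E).
Proof.
move=> wG mF F0; rewrite integral_gaussian_sample//.
rewrite (@integral_iid_density _ _ _ (gaussian (S w)) Q (f w))//.
- by move=> x; exact: ltW.
- by move=> F' mF' F'0; exact: fE.
- by apply: (measurableT_comp mF); exact: measurable_funP.
Qed.

Let int_p w : w \in G -> \int[mu]_t (p t w)%:E = 1.
Proof.
move=> wG; have := @sampleE w (cst 1) wG (measurable_cst _) (fun=> lee01).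
rewrite integral_cst_probability => ->.
by apply: eq_integral => t _; rewrite mul1e.
Qed.

Let min_ge j w : P j -> w \in G -> flip j w \in G ->
  (8^-1)%:E <= \int[mu]_t (Num.min (p t w) (p t (flip j w)))%:E.
Proof.
move=> Pj wG fwG.
apply: (@affinity_min _ _ _ mu (p ^~ w) (p ^~ (flip j w))
  (fun t => \prod_(i < n) h j w (tnth t i))%R) => //.
- by move=> t; apply: prodr_ge0.
- by move=> t; rewrite -prodrXl -big_split/=; apply: eq_bigr => i _; exact: hE.
- exact: int_p.
- exact: int_p.
- rewrite (@integral_iid_prod _ _ _ Q n (fun=> h j w))//.
  have := inth w Pj; case: (\int[_]_x _) => [s| |]//= rs.
    rewrite prodEFin prodr_const card_ord lee_fin (le_trans rn)//.
    by rewrite lerXn2r ?nnegrE// (le_trans r0).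
  (* If the one-observation integral is infinite, so is its power, except for the empty product
     1. *)
  case: (n) rn => [|m] _; first by rewrite big_ord0 lee_fin invf_le1// ler1n.
  rewrite big_ord_recl; elim: m => [|m IH]; first by rewrite big_ord0 mule1 leey.
  by rewrite big_ord_recl gt0_mulye ?leey//= (lt_le_trans _ IH)// lte_fin.
Qed.

(** The square is linearised, y^2 >= 2 ka y - ka^2, at the value [ka] that bounds the average
    witness from below. The sum over [G] of the integrated witnesses is at least a / (2 b) * #|P| *
    (1/2) * (1/8) times the size of the cube, that is [ka] times this size; as [G] is no larger than
    the cube, 2 ka^2 - ka^2 = ka^2 is left per pattern. *)
Lemma assouad : ((tau (const_mx 1) / k%:R) ^+ 2 * (a * #|P|%:R / (32 * b)) ^+ 2)%:E <=
  minimax_risk n lambda tau.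
Proof.
set al := (tau (const_mx 1) / k%:R)%R; set ka := (a * _ / _)%R.
have kR : (0 < k%:R :> R)%R by rewrite ltr0n.
have al0 : (0 <= al)%R by rewrite divr_ge0// (gauge_ge0 tauP).
have ka0 : (0 <= ka)%R by rewrite divr_ge0// ?mulr_ge0// ltW.
apply: le_ereal_inf_tmp => _ [delta mdelta <-].
set Rs := ereal_sup _.
have [w0 w0G] : exists w0, w0 \in G.
  have := cardG Pj0; rewrite card_ffun card_bool => hc.
  have : (0 < #|finset (fun w => (w \in G) && (flip j0 w \in G))|)%N.
    by rewrite -(ltn_pmul2l (isT : 0 < 2)%N) muln0 (leq_trans _ hc)// expn_gt0.
  by move=> /card_gt0P[w]; rewrite inE => /andP[wG _]; exists w.
pose wit t w := witness P D G a b c (p t) (delta (mx_of_rows t)) w.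
(* A measurable lower bound of the loss. The positive part is squared because [witness_le] bounds
   the witness from above only. *)
pose g t w : R := (al ^+ 2 * Num.max (wit t w) 0 ^+ 2)%R.
have mdl : measurable_fun setT (fun t : n.-tuple 'rV[R]_k => delta (mx_of_rows t)).
  by apply: (measurableT_comp mdelta); exact: measurable_funP.
have mtr j : measurable_fun setT (fun t : n.-tuple 'rV[R]_k =>
    \tr ((delta (mx_of_rows t))^T *m D j)).
  rewrite (_ : (fun t => _) = (fun t : n.-tuple 'rV[R]_k =>
      \sum_i \sum_l (delta (mx_of_rows t)) l i * D j l i)%R); last first.
    apply/funext => t; apply: eq_bigr => i _; rewrite mxE; apply: eq_bigr => l _.
    by rewrite mxE.
  apply: measurable_sum => i; apply: measurable_sum => l; apply: measurable_funM => //.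
  by move/measurable_fun_mxP : mdl; exact.
have sumG F : (forall w, measurable_fun setT (fun t : n.-tuple 'rV[R]_k => F t w : R)) ->
    measurable_fun setT (fun t => \sum_(w in G) F t w)%R.
  move=> mF; rewrite (_ : (fun t => _) = (fun t => \sum_(w <- enum G) F t w)%R).
    exact: measurable_sum.
  by apply/funext => t; rewrite big_enum.
have sumP F : (forall j, measurable_fun setT (fun t : n.-tuple 'rV[R]_k => F t j : R)) ->
    measurable_fun setT (fun t => \sum_(j | P j) F t j)%R.
  move=> mF; rewrite (_ : (fun t => _) = (fun t => \sum_(j <- enum P) F t j)%R).
    exact: measurable_sum.
  by apply/funext => t; rewrite big_enum.
have mW : measurable_fun setT (fun t => (\sum_(w in G) p t w)^-1)%R.
  rewrite (_ : (fun t => _) = (fun t => powR (\sum_(w in G) p t w) (-1))%R).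
    exact: (measurableT_comp (measurable_powR (-1)%R) (sumG p mp)).
  by apply/funext => t; rewrite powR_inv1// sumr_ge0// => w _; exact: ltW.
have mpm j : measurable_fun setT (fun t => post_mean G (p t) j).
  apply: measurable_funM => //; apply: sumG => w; exact: measurable_funM.
have mwit w : measurable_fun setT (wit ^~ w).
  apply: measurable_funM => //; apply: sumP => j; apply: measurable_funM.
    exact: measurable_funB.
  by do 2 apply: measurable_funB => //.
have mg w : measurable_fun setT (g ^~ w).
  apply: measurable_funM => //; apply: measurable_funX.
  exact: measurable_maxr.
have g0 t w : (0 <= g t w)%R by rewrite mulr_ge0// sqr_ge0.
have c00 : (0 <= al ^+ 2 * (2 * ka))%R.
  by apply: mulr_ge0; [exact: sqr_ge0|exact: mulr_ge0].
have key t : (al ^+ 2 * (2 * ka) * (a / (2 * b) * \sum_(j | P j)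
      \sum_(w in G | flip j w \in G) Num.min (p t w) (p t (flip j w))) <=
    \sum_(w in G) (p t w * g t w + al ^+ 2 * ka ^+ 2 * p t w))%R.
  apply: (@le_trans _ _ (al ^+ 2 * (2 * ka) * \sum_(w in G) p t w * wit t w))%R.
    rewrite ler_wpM2l//.
    exact: (sum_witness_ge P D c a0 b0 (p0 t) w0G (delta (mx_of_rows t))).
  rewrite mulr_sumr; apply: ler_sum => w _.
  rewrite (_ : _ * (p t w * wit t w) = p t w * (al ^+ 2 * (2 * ka * wit t w)))%R; last ring.
  rewrite (_ : _ + _ = p t w * (al ^+ 2 * (Num.max (wit t w) 0 ^+ 2 + ka ^+ 2)))%R; last first.
    by rewrite /g; ring.
  rewrite ler_wpM2l ?(ltW (p0 t w))// ler_wpM2l ?sqr_ge0//.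
  case: (lerP (wit t w) 0) => hw.
    by have := sqr_ge0 ka; nra.
  by have := sqr_ge0 (wit t w - ka)%R; nra.
pose rows (X : 'M[R]_(n, k)) : n.-tuple 'rV[R]_k := [tuple row i X | i < n].
have rowsK t : rows (mx_of_rows t) = t.
  by apply: eq_from_tnth => i; rewrite tnth_mktuple; apply/rowP => j; rewrite !mxE.
have mxK X : mx_of_rows (rows X) = X.
  by apply/matrixP => i j; rewrite !mxE tnth_mktuple mxE.
have mrows : measurable_fun setT rows.
  apply/measurable_fun_tnthP => i; apply/measurable_fun_mxP => j l.
  rewrite (_ : (fun X => _) = (fun X : 'M[R]_(n, k) => X i l)); last first.
    by apply/funext => X; rewrite /= tnth_mktuple mxE.
  exact: measurable_mx_entry.
have int_g w : w \in G -> \int[mu]_t (p t w * g t w)%:E <= Rs.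
  move=> wG; apply: (@le_trans _ _ (risk tau delta (S w))); last first.
    by apply: ereal_sup_ubound; exists (S w) => //; exact: SX.
  have mF : measurable_fun setT (fun X => (g (rows X) w)%:E).
    by apply/measurable_EFinP; exact: (measurableT_comp (mg w) mrows).
  have -> : \int[mu]_t (p t w * g t w)%:E =
      \int[gaussian_sample n (S w)]_X (g (rows X) w)%:E.
    rewrite sampleE//; last by move=> X; rewrite lee_fin.
    by apply: eq_integral => t _; rewrite rowsK mulrC EFinM.
  rewrite /risk unlock; apply: ge0_le_integral_nm => X; rewrite lee_fin// /g /wit mxK.
  have := witness_le b0 trS opB (p0 (rows X)) w0G (delta X) tauP wG.
  set y := witness _ _ _ _ _ _ _ _ _ => hy.
  have u0 := ui_norm_ge0 (delta X - S w)%R tauP.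
  have y0 : (0 <= al * Num.max y 0)%R by apply: mulr_ge0 al0 _; rewrite le_max lexx orbT.
  rewrite -exprMn lerXn2r ?nnegrE//.
  case: (lerP y 0) => _; first by rewrite mulr0.
  by rewrite /al mulrAC ler_pdivrMr// [leRHS]mulrC.
have mpg w : measurable_fun setT (fun t => (p t w * g t w)%:E).
  by apply/measurable_EFinP; exact: measurable_funM.
have pg0 t w : 0 <= (p t w * g t w)%:E by rewrite lee_fin mulr_ge0// ltW.
have mpE w : measurable_fun setT (fun t => (p t w)%:E) by exact/measurable_EFinP.
have pE0 t w : 0 <= (p t w)%:E by rewrite lee_fin ltW.
have ak0 : (0 <= al ^+ 2 * ka ^+ 2)%R by apply: mulr_ge0; exact: sqr_ge0.
have rhs : \int[mu]_t (\sum_(w in G) (p t w * g t w + al ^+ 2 * ka ^+ 2 * p t w))%:E <=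
    \sum_(w in G) (Rs + (al ^+ 2 * ka ^+ 2)%:E).
  rewrite (eq_integral (fun t => \sum_(w <- enum G)
      ((p t w * g t w)%:E + (al ^+ 2 * ka ^+ 2)%:E * (p t w)%:E))); last first.
    by move=> t _; rewrite -big_enum -sumEFin.
  rewrite ge0_integral_sum//; last 2 first.
  - by move=> w; apply: emeasurable_funD => //; exact: measurable_funeM.
  - by move=> w t _; rewrite adde_ge0// mule_ge0.
  rewrite big_enum; apply: lee_sum => w wG.
  rewrite ge0_integralD//; last 2 first.
  - by move=> t _; rewrite mule_ge0.
  - exact: measurable_funeM.
  rewrite ge0_integralZl// int_p// mule1 leeD2r//; exact: int_g.
have [c1 c1E] : exists c1 : R, c1 = (al ^+ 2 * (2 * ka) * (a / (2 * b)))%R by eexists.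
have c10 : (0 <= c1)%R.
  by rewrite c1E; apply: mulr_ge0 c00 _; rewrite divr_ge0// mulr_ge0// ltW.
have mmin j w : measurable_fun setT (fun t => (Num.min (p t w) (p t (flip j w)))%:E).
  by apply/measurable_EFinP; exact: measurable_minr.
have min0 j w t : 0 <= (Num.min (p t w) (p t (flip j w)))%:E.
  by rewrite lee_fin le_min !ltW.
pose Gf j := finset (fun w => (w \in G) && (flip j w \in G)).
have lhs : c1%:E * \sum_(j | P j) \sum_(w in Gf j) (8^-1)%:E <=
    \int[mu]_t (\sum_(w in G) (p t w * g t w + al ^+ 2 * ka ^+ 2 * p t w))%:E.
  apply: (@le_trans _ _ (\int[mu]_t (c1%:E * \sum_(j <- enum P) \sum_(w <- enum (Gf j))
      (Num.min (p t w) (p t (flip j w)))%:E))).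
    have ms j : measurable_fun setT (fun t => \sum_(w <- enum (Gf j))
        (Num.min (p t w) (p t (flip j w)))%:E) by exact: emeasurable_sum.
    have s0 j t : 0 <= \sum_(w <- enum (Gf j)) (Num.min (p t w) (p t (flip j w)))%:E.
      by apply: sume_ge0.
    rewrite ge0_integralZl//; last 2 first.
    - exact: emeasurable_sum.
    - by move=> t _; apply: sume_ge0.
    rewrite lee_wpmul2l ?lee_fin// ge0_integral_sum// big_enum.
    apply: lee_sum => j Pj; rewrite ge0_integral_sum// big_enum.
    by apply: lee_sum => w; rewrite inE => /andP[wG fwG]; exact: min_ge.
  apply: ge0_le_integral_nm => t.
    rewrite mule_ge0 ?lee_fin//; apply: sume_ge0 => j _; exact: sume_ge0.
  apply: le_trans (_ : _ <= (al ^+ 2 * (2 * ka) * (a / (2 * b) * \sum_(j | P j)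
      \sum_(w in G | flip j w \in G) Num.min (p t w) (p t (flip j w))))%:E) _; last first.
    by rewrite lee_fin; exact: key.
  rewrite [leRHS](_ : _ = (c1 * \sum_(j | P j) \sum_(w in G | flip j w \in G)
      Num.min (p t w) (p t (flip j w)))%:E); last by rewrite [in LHS]mulrA c1E.
  rewrite EFinM lee_wpmul2l ?lee_fin// big_enum -sumEFin.
  apply: lee_sum => j _; rewrite -sumEFin big_enum le_eqVlt; apply/orP; left; apply/eqP.
  by apply: eq_bigl => w; rewrite inE.
have := le_trans lhs rhs; have : 0 <= Rs.
  apply: (@le_trans _ _ (risk tau delta (S w0))).
    by rewrite /risk unlock; apply: integral_ge0 => X _; rewrite lee_fin sqr_ge0.
  by apply: ereal_sup_ubound; exists (S w0) => //; exact: SX.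
case: Rs {rhs int_g} => [s| |]//= s0; last by rewrite leey.
rewrite (eq_bigr (fun j => (8^-1 *+ #|Gf j|)%:E)); last first.
  by move=> j _; rewrite sumEFin sumr_const.
rewrite !sumEFin -EFinM sumr_const !lee_fin => hs.
have h2 : (c1 * (\sum_(j | P j) (16^-1 * #|{: cube}|%:R)) <= (s + al ^+ 2 * ka ^+ 2) *+ #|G|)%R.
  apply: le_trans hs; rewrite ler_wpM2l//; apply: ler_sum => j Pj.
  have : (#|{: cube}|%:R <= 2 * #|Gf j|%:R :> R)%R by rewrite -natrM ler_nat cardG.
  by move=> hc; rewrite -[leRHS]mulr_natr; lra.
rewrite sumr_const in h2.
have GO : (#|G|%:R <= #|{: cube}|%:R :> R)%R by rewrite ler_nat max_card.
have G0 : (0 < #|G|%:R :> R)%R by rewrite ltr0n; apply/card_gt0P; exists w0.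
have e : (c1 * (16^-1 * #|{: cube}|%:R *+ #|P|) = 2 * (al ^+ 2 * ka ^+ 2) * #|{: cube}|%:R)%R.
  by rewrite -[(_ *+ #|P|)%R]mulr_natr c1E /ka; field; rewrite gt_eqF.
rewrite e -[((s + _) *+ _)%R]mulr_natr in h2.
rewrite -(ler_pM2r G0).
have : (2 * (al ^+ 2 * ka ^+ 2) * #|G|%:R <= 2 * (al ^+ 2 * ka ^+ 2) * #|{: cube}|%:R)%R.
  by rewrite ler_wpM2l// mulr_ge0.
lra.
Qed.

End assouad.

(** * Scalar covariances and the case of dimension one *)

Section one_dimensional.
Local Open Scope ereal_scope.
Context (R : realType).
Local Notation gam := (normal_prob (0 : R) 1).

Lemma gaussian_mapE k (S L : 'M[R]_k) z : is_trig_mx L -> (forall i, (0 < L i i)%R) ->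
  (L *m L^T = S)%R -> gaussian_map S z = (\row_i tnth z i) *m L^T.
Proof. by move=> tL pL LS; rewrite /gaussian_map (cholesky_unique tL pL LS). Qed.

Lemma gaussian_map_scalar k (v : R) z : (0 < v)%R ->
  gaussian_map (v ^+ 2)%:M z = v *: \row_(i < k) tnth z i.
Proof.
move=> v0; rewrite (@gaussian_mapE _ _ v%:M); first last.
- by rewrite tr_scalar_mx -scalar_mxM expr2.
- by move=> i; rewrite mxE eqxx mulr1n.
- exact: scalar_mx_is_trig.
- by rewrite tr_scalar_mx mul_mx_scalar.
Qed.

Lemma measurable_scale_row k (v : R) :
  measurable_fun setT (fun z : k.-tuple (measurableTypeR R) =>
    (v *: \row_(i < k) tnth z i)%R : 'rV[R]_k).
Proof.
apply/measurable_fun_mxP => i j.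
rewrite (_ : (fun z => _) = (fun z : k.-tuple (measurableTypeR R) => v * tnth z j)%R).
  by apply: measurable_funM => //; exact: (@measurable_tnth _ (measurableTypeR R)).
by apply/funext => z; rewrite !mxE.
Qed.

Lemma integral_iid_coord k (l : 'I_k) (F : R -> R) :
  measurable_fun setT F -> (forall x, 0 <= F x)%R ->
  \int[iid gam k]_z (F (tnth z l))%:E = \int[gam]_x (F x)%:E.
Proof.
move=> mF F0; pose f (i : 'I_k) (x : R) : R := if i == l then F x else 1%R.
have mf i : measurable_fun setT (f i).
  by rewrite /f; case: (i == l) => //; exact: measurable_cst.
have f0 i x : (0 <= f i x)%R by rewrite /f; case: ifP.
transitivity (\int[iid gam k]_z (\prod_(i < k) f i (tnth z i))%:E).
  apply: eq_integral => z _; rewrite (bigD1 l)//= {1}/f eqxx big1 ?mulr1// => i il.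
  by rewrite /f (negbTE il).
rewrite (integral_iid_prod gam mf f0) (bigD1 l)//= big1 => [|i il].
  by rewrite mule1; apply: eq_integral => x _; rewrite /f eqxx.
rewrite /f (negbTE il); exact: integral_cst_probability.
Qed.

Lemma integral_iid1 (F : 1.-tuple (measurableTypeR R) -> \bar R) :
  measurable_fun setT F -> (forall z, 0 <= F z) ->
  \int[iid gam 1]_z F z = \int[gam]_x F [tuple x].
Proof.
move=> mF F0; rewrite integral_iidS//; apply: eq_integral => x _.
rewrite integral_iid0; last exact: (measurableT_comp mF (@measurable_cons_tuple_r _ _ _ _)).
by congr F; exact: val_inj.
Qed.

Lemma Xi_scalar k (lambda v : R) : (0 <= v <= lambda)%R -> Xi k lambda v%:M.
Proof.
move=> /andP[v0 vl]; apply: Xi_intro; first exact: le_trans vl.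
  split; first by rewrite tr_scalar_mx.
  by move=> x; rewrite mul_mx_scalar -scalemxAl mxE mulr_ge0// dot_ge0.
move=> x; rewrite mul_scalar_mx dotZl dotZr mulrA -expr2 ler_wpM2r ?dot_ge0//.
by rewrite lerXn2r ?nnegrE// (le_trans v0).
Qed.

Lemma bernoulli n (x : R) : (0 <= x <= 1)%R -> (1 - n%:R * x <= (1 - x) ^+ n)%R.
Proof.
move=> /andP[x0 x1]; elim: n => [|n IH]; first by rewrite mul0r subr0 expr0.
rewrite exprS -natr1; apply: le_trans (ler_wpM2l _ IH); last by lra.
have : (0 <= n%:R * (x * x))%R by rewrite mulr_ge0// mulr_ge0.
lra.
Qed.

(* the two variances [lambda] and [lambda / B ^ 2] with [B = 1 + n ^ (- 1 / 2)] *)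
Lemma minimax_lower1 n (lambda : R) (tau : 'rV[R]_1 -> R) :
  (0 < n)%N -> (0 < lambda)%R -> symmetric_gauge tau ->
  ((128 ^+ 2)^-1 * n%:R^-1 * lambda ^+ 2 * tau (const_mx 1) ^+ 2)%:E <=
  minimax_risk n lambda tau.
Proof.
move=> n0 l0 tauP; have nR : (0 < n%:R :> R)%R by rewrite ltr0n.
pose be : R := ((Num.sqrt n%:R)^-1)%R; pose B : R := (1 + be)%R.
have be0 : (0 < be)%R by rewrite invr_gt0 sqrtr_gt0.
have be2 : (be ^+ 2 = n%:R^-1)%R by rewrite exprVn sqr_sqrtr// ltW.
have be1 : (be <= 1)%R.
  rewrite -(@ler_sqr _ _ 1%R) ?nnegrE ?(ltW be0)// be2 expr1n invf_le1//.
  by rewrite ler1n.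
have B1 : (1 < B)%R by rewrite /B; lra.
have B0 : (0 < B)%R by exact: lt_trans B1.
pose s (w : {ffun unit -> bool}) : R := if w tt then (B^-1)%R else 1%R.
have s0 w : (0 < s w)%R by rewrite /s; case: ifP => _; rewrite ?invr_gt0.
have s1 w : (s w <= 1)%R by rewrite /s; case: ifP => _; rewrite ?invf_le1 ?(ltW B1).
pose sl : R := Num.sqrt lambda.
have sl0 : (0 < sl)%R by rewrite sqrtr_gt0.
have sl2 : (sl ^+ 2 = lambda)%R by rewrite sqr_sqrtr// ltW.
pose S (w : {ffun unit -> bool}) : 'M[R]_1 := ((sl * s w) ^+ 2)%:M%R.
pose Q := gaussian ((sl ^+ 2)%:M%R : 'M[R]_1).
pose z (x : 'rV[R]_1) : R := (x 0%R 0%R / sl)%R.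
have mz : measurable_fun setT z.
  by apply: measurable_funM => //; exact: measurable_mx_entry.
have zK (t : 1.-tuple (measurableTypeR R)) : z (sl *: \row_(i < 1) tnth t i)%R = tnth t ord0.
  by rewrite /z !mxE mulrC mulKf ?gt_eqF.
pose f (w : {ffun unit -> bool}) x : R :=
  if w tt then (B * expR ((1 - B ^+ 2) / 2 * z x ^+ 2))%R else 1%R.
pose h (j : unit) (w : {ffun unit -> bool}) x : R :=
  (Num.sqrt B * expR ((1 - B ^+ 2) / 4 * z x ^+ 2))%R.
(* Chosen so that (1 - e^2) / 2 = (1 - B^2) / 4: the affinity of the two laws is then sqrt B / e by
   [normal_exp_sqr]. *)
pose e : R := (Num.sqrt ((1 + B ^+ 2) / 2))%R.
have e0 : (0 < e)%R by rewrite sqrtr_gt0 divr_gt0// addr_gt0// exprn_gt0.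
have e2 : (e ^+ 2 = (1 + B ^+ 2) / 2)%R.
  by rewrite sqr_sqrtr// divr_ge0// addr_ge0// sqr_ge0.
have mex (c : R) : measurable_fun setT (fun x => expR (c * z x ^+ 2))%R.
  by apply: measurableT_comp => //; apply: measurable_funM => //; exact: measurable_funX.
have sb0 : (0 < Num.sqrt B)%R by rewrite sqrtr_gt0.
have sb2 : (Num.sqrt B ^+ 2 = B)%R by rewrite sqr_sqrtr// ltW.
have intQ (F : 'rV[R]_1 -> \bar R) : measurable_fun setT F -> (forall x, 0 <= F x) ->
    \int[Q]_x F x = \int[gam]_t F (sl *: \row_(i < 1) t)%R.
  move=> mF F0; rewrite (integral_gaussian _ mF F0).
  under eq_integral do rewrite gaussian_map_scalar//.
  rewrite (integral_iid1 (F := fun t => F (sl *: \row_(i < 1) tnth t i)%R))//.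
    apply: eq_integral => x _; congr (F (_ *: _)).
    by apply/rowP => i; rewrite !mxE ord1.
  by apply: (measurableT_comp mF); exact: measurable_scale_row.
have Bi : (0 < (B ^+ 2)^-1 < 1)%R.
  by rewrite invr_gt0 exprn_gt0//= invf_lt1 ?exprn_gt0// exprn_egt1.
(* Half the difference of the two variances; their midpoint is the constant passed to [assouad] as
   [c]. *)
pose a : R := (lambda * (1 - (B ^+ 2)^-1) / 2)%R.
have a_ge : (lambda * be / 4 <= a)%R.
  rewrite /a -[leRHS]mulrA -[leLHS]mulrA ler_pM2l//.
  rewrite -(@ler_pM2r _ (B ^+ 2)) ?exprn_gt0// -mulrA [in leRHS]mulrAC mulrBl mul1r.
  rewrite mulVf ?gt_eqF ?exprn_gt0//.
  rewrite /B; nra.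
have a0 : (0 <= a)%R by apply: le_trans a_ge; rewrite divr_ge0// mulr_ge0// ltW.
have trS w j : w \in finset.setT -> xpredT j -> \tr ((S w)^T *m (1%:M : 'M[R]_1)) =
    (lambda * (1 + (B ^+ 2)^-1) / 2 + a * sgn R w j)%R.
  move=> _ _; rewrite mulmx1 mxtrace_tr mxtrace_scalar mulr1n exprMn sl2 /s /sgn; case: j.
  by case: (w tt); rewrite ?expr1n ?exprVn /a /=; field; rewrite gt_eqF.
have opB (w : {ffun unit -> bool}) (x : 'cV[R]_1) : w \in finset.setT ->
    let T := (\sum_(j | xpredT j) sgn R w j *: (1%:M : 'M[R]_1))%R in
    (dot (T *m x) (T *m x) <= 1 ^+ 2 * dot x x)%R.
  move=> _ /=; rewrite (bigD1 tt)//= big1 => [|[]//]; rewrite addr0.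
  by rewrite -scalemxAl mul1mx dotZl dotZr mulrA -expr2 sgn_sqr expr1n.
have SX w : w \in finset.setT -> Xi 1 lambda (S w).
  move=> _; apply: Xi_scalar; rewrite sqr_ge0/= exprMn sl2 ler_piMr ?(ltW l0)//.
  by rewrite expr_le1 ?(ltW (s0 w)).
have mf w : measurable_fun setT (f w).
  by rewrite /f; case: (w tt); [exact: measurable_funM|exact: measurable_cst].
have f0 w x : (0 < f w x)%R by rewrite /f; case: (w tt); rewrite ?mulr_gt0 ?expR_gt0.
have fE w (F : 'rV[R]_1 -> \bar R) : w \in finset.setT ->
    measurable_fun setT F -> (forall x, 0 <= F x) ->
    \int[gaussian (S w)]_x F x = \int[Q]_x (F x * (f w x)%:E).
  move=> _ mF F0.
  pose F' (t : R) := F (sl *: \row_(i < 1) t)%R.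
  have mF' : measurable_fun setT F'.
    apply: (measurableT_comp mF); apply/measurable_fun_mxP => i j.
    rewrite (_ : (fun t => _) = (fun t : R => sl * t)%R); first exact: measurable_funM.
    by apply/funext => t; rewrite !mxE.
  apply: (etrans (integral_gaussian (S w) mF F0)).
  under eq_integral do rewrite gaussian_map_scalar ?mulr_gt0//.
  rewrite (integral_iid1 (F := fun t => F ((sl * s w) *: \row_(i < 1) tnth t i)%R))//; last first.
    by apply: (measurableT_comp mF); exact: measurable_scale_row.
  transitivity (\int[gam]_t F' (s w * t)%R).
    apply: eq_integral => t _; congr F; rewrite -scalerA; congr (_ *: _)%R.
    by apply/rowP => i; rewrite !mxE ord1.
  rewrite intQ; last 2 first.
  - by apply: emeasurable_funM => //; exact/measurable_EFinP.
  - by move=> x; rewrite mule_ge0// lee_fin ltW.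
  have zr t : z (sl *: \row_(i < 1) t)%R = t by rewrite /z !mxE mulrC mulKf ?gt_eqF.
  rewrite /s /f; case: (w tt); last first.
    by apply: eq_integral => t _; rewrite mul1r mule1.
  transitivity (\int[gam]_t F' (t / B)%R).
    by apply: eq_integral => t _; rewrite mulrC.
  apply: (etrans (integral_normal_scale B0 mF' (fun=> F0 _))).
  apply: eq_integral => t _.
  by rewrite zr.
have mh j w : measurable_fun setT (h j w) by exact: measurable_funM.
have h0 j w x : (0 <= h j w x)%R by rewrite mulr_ge0 ?expR_ge0// ltW.
have hE j w x : (h j w x ^+ 2 = f w x * f (flip j w) x)%R.
  rewrite /h exprMn sb2 -expRM_natl /f ffunE; case: j => /=.
  have -> : (2%:R * ((1 - B ^+ 2) / 4 * z x ^+ 2) = (1 - B ^+ 2) / 2 * z x ^+ 2)%R by field.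
  by case: (w tt); rewrite /= ?mulr1 ?mul1r.
pose r : R := (Num.sqrt B / e)%R.
have r0 : (0 <= r)%R by rewrite divr_ge0// ltW.
have inth j w : xpredT j -> r%:E <= \int[Q]_x (h j w x)%:E.
  move=> _; rewrite intQ; last 2 first.
  - exact/measurable_EFinP.
  - by move=> x; rewrite lee_fin.
  have zr t : z (sl *: \row_(i < 1) t)%R = t by rewrite /z !mxE mulrC mulKf ?gt_eqF.
  rewrite (eq_integral (fun t : measurableTypeR R =>
      (Num.sqrt B)%:E * (expR ((1 - e ^+ 2) / 2 * (t : R) ^+ 2))%:E)); last first.
    move=> t _; by rewrite /h zr -EFinM; congr (_ * expR _)%:E; rewrite e2; field.
  rewrite ge0_integralZl//; last first.
    apply/measurable_EFinP; apply: measurableT_comp => //.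
    by apply: measurable_funM => //; exact: measurable_funX.
  by rewrite normal_exp_sqr.
have rn : (2^-1 <= r ^+ n)%R.
  (* The squared affinity is 2 B / (1 + B^2) = 1 - be^2 / (1 + B^2), with be^2 = 1 / n and 1 + B^2
     >= 2. *)
  have r2 : (1 - (2 * n%:R)^-1 <= r ^+ 2)%R.
    rewrite /r expr_div_n sb2 e2 invfM -be2 ler_pdivlMr ?divr_gt0 ?addr_gt0 ?exprn_gt0//.
    by rewrite /B; nra.
  have n2 : (0 <= (2 * n%:R : R)^-1 <= 1)%R.
    rewrite invr_ge0 mulr_ge0//= invf_le1 ?mulr_gt0//.
    have : (1 <= n%:R :> R)%R by rewrite ler1n.
    lra.
  have h1 := bernoulli n n2.
  rewrite -(@ler_sqr _ 2^-1%R) ?nnegrE ?exprn_ge0// -exprM mulnC exprM.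
  apply: (@le_trans _ _ ((1 - (2 * n%:R)^-1) ^+ n)%R); last first.
    rewrite lerXn2r ?nnegrE ?exprn_ge0//.
    by move/andP: n2 => [_]; lra.
  apply: le_trans h1; rewrite invfM mulrCA mulfV ?gt_eqF//; lra.
have cG j : xpredT j -> (#|{: {ffun unit -> bool}}| <=
    2 * #|finset (fun w : {ffun unit -> bool} =>
      (w \in finset.setT) && (flip j w \in finset.setT))|)%N.
  move=> _; rewrite (_ : finset _ = finset.setT); last first.
    by apply/setP => w; rewrite !inE.
  by rewrite cardsT leq_pmull.
have := @assouad R n 1 unit xpredT lambda tau (fun=> 1%:M%R) S finset.setT a 1%R r
  (fun=> (lambda * (1 + (B ^+ 2)^-1) / 2)%R) Q f h isT tauP a0 ltr01 trS opB SX mf f0 fE mh h0 hE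
  inth r0 rn cG tt isT.
apply: le_trans; rewrite lee_fin card_unit divr1 mulr1 mulr1.
rewrite -be2 -mulrA -[leLHS]mulrA.
(* 128 = 4 * 32: 4 from [a_ge] and 32 from [assouad]. *)
rewrite [leLHS](_ : _ = tau (const_mx 1) ^+ 2 * (lambda * be / 128) ^+ 2)%R; last first.
  by field.
rewrite ler_wpM2l ?sqr_ge0// lerXn2r ?nnegrE;
  [|by rewrite divr_ge0// mulr_ge0// ltW|by rewrite divr_ge0|lra].
by [].
Qed.

End one_dimensional.

(** * Covariances perturbed in the lower left block *)

Section block.
Context (R : realType) (k k1 : nat).
Local Notation J := ('I_k * 'I_k)%type.
Local Notation cube := {ffun J -> bool}.

Definition low (j : J) : bool := (j.2 < k1)%N && (k1 <= j.1)%N.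

Definition pert (d : R) (w : cube) (i l : 'I_k) : R :=
  if low (i, l) then d * sgn R w (i, l) else 0.

Definition pert_mx (d : R) (w : cube) : 'M[R]_k := \matrix_(i, l) pert d w i l.

(** Symmetrised so that [sign_mx] is symmetric and its operator norm can be read off its quadratic
    form on the net. *)
Definition sym_delta (j : J) : 'M[R]_k := 2^-1 *: (delta_mx j.1 j.2 + delta_mx j.2 j.1).

Definition sign_mx (w : cube) : 'M[R]_k := \sum_(j | low j) sgn R w j *: sym_delta j.

Lemma pert_lower d w (i l : 'I_k) : (i <= l)%N -> pert d w i l = 0.
Proof.
rewrite /pert /low /=; case: ifP => // /andP[lk ki] il.
by have := leq_ltn_trans (leq_trans ki il) lk; rewrite ltnn.
Qed.

Lemma pert_row0 d w (i l : 'I_k) : (i < k1)%N -> pert d w i l = 0.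
Proof. by move=> ik; rewrite /pert /low /= [(k1 <= i)%N]leqNgt ik andbF. Qed.

(** Nonzero entries have column below [k1] and row at least [k1]. Two different patterns are
    allowed, as the affinity involves the mean of two perturbations. *)
Lemma pert_mul d d' w w' (i l m : 'I_k) : pert d w i l * pert d' w' l m = 0.
Proof.
rewrite {1}/pert /low /=; case: ifP => [/andP[lk _]|_]; last by rewrite mul0r.
by rewrite pert_row0// mulr0.
Qed.

Lemma pert_mx_scale d w : pert_mx d w = d *: pert_mx 1 w.
Proof. by apply/matrixP => i l; rewrite !mxE /pert; case: ifP; rewrite ?mulr0 ?mul1r. Qed.

Lemma sign_mxE w : sign_mx w = 2^-1 *: (pert_mx 1 w + (pert_mx 1 w)^T).
Proof.
have defN : pert_mx 1 w = \sum_(j | low j) sgn R w j *: delta_mx j.1 j.2.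
  apply/matrixP => i l; rewrite !mxE summxE /pert mul1r big_mkcond (bigD1 (i, l))//=.
  rewrite big1 ?addr0 => [|[i' l'] /= ne]; last first.
    case: ifP => // _; rewrite !mxE; case: eqP => [e|]; last by rewrite mulr0.
    by case: eqP => [e'|]; rewrite ?mulr0// -e -e' eqxx in ne *.
  by case: ifP => // _; rewrite !mxE !eqxx mulr1.
rewrite {2}defN linear_sum/= defN -big_split/= scaler_sumr; apply: eq_bigr => j _.
have -> : (sgn R w j *: (delta_mx j.1 j.2 : 'M[R]_k))^T = sgn R w j *: delta_mx j.2 j.1.
  by rewrite linearZ/= trmx_delta.
by rewrite -scalerDr /sym_delta !scalerA mulrC.
Qed.

Lemma tr_sym_delta (A : 'M[R]_k) j : A^T = A -> \tr (A^T *m sym_delta j) = A j.1 j.2.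
Proof.
move=> symA; have tr_delta i l : \tr (A *m delta_mx i l) = A l i.
  rewrite -(mul_delta_mx (0 : 'I_1)) mulmxA mxtrace_mulC /mxtrace big_ord1.
  by rewrite -rowE -colE !mxE.
rewrite symA /sym_delta -scalemxAr mulmxDr mxtraceZ mxtraceD !tr_delta.
have -> : A j.2 j.1 = A j.1 j.2 by rewrite -{1}symA mxE.
by field.
Qed.

Definition proj (p : pred 'I_k) (x : 'cV[R]_k) : 'cV[R]_k :=
  \col_i (if p i then x i 0 else 0).

Lemma proj_dot p x : dot (proj p x) (proj p x) <= dot x x.
Proof.
rewrite !dot_sqrE; apply: ler_sum => i _; rewrite mxE.
by case: ifP; rewrite ?lexx// expr0n sqr_ge0.
Qed.

Section op.
Variables (d b : R) (w : cube).
Hypotheses (d0 : 0 <= d) (b0 : 0 <= b) (db : 2 * d * b <= 1).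
Hypothesis opB : forall x, dot (sign_mx w *m x) (sign_mx w *m x) <= b ^+ 2 * dot x x.

Let M := pert_mx d w + (pert_mx d w)^T.

Let opM x : dot (M *m x) (M *m x) <= dot x x.
Proof.
have -> : M = (2 * d) *: sign_mx w.
  rewrite sign_mxE scalerA /M pert_mx_scale linearZ/= -scalerDr; congr (_ *: _).
  by field.
rewrite -scalemxAl dotZl dotZr mulrA -expr2.
apply: (@le_trans _ _ ((2 * d) ^+ 2 * (b ^+ 2 * dot x x))).
  by rewrite ler_wpM2l ?sqr_ge0.
rewrite mulrA -exprMn ler_piMl ?dot_ge0// expr_le1// mulr_ge0// mulr_ge0//.
Qed.

(** The perturbation is a corner of N + N^T = 2 d * [sign_mx], cut out by two coordinate
    projections, and 2 d b <= 1 makes that matrix a contraction. *)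
Lemma pert_op x : dot (pert_mx d w *m x) (pert_mx d w *m x) <= dot x x.
Proof.
have -> : pert_mx d w *m x =
    proj (fun i : 'I_k => (k1 <= i)%N) (M *m proj (fun i : 'I_k => (i < k1)%N) x).
  apply/matrixP => i z; rewrite [z]ord1 !mxE; case: ifP => ki.
    apply: eq_bigr => l _; rewrite !mxE; case: ifP => lk.
      by rewrite (pert_row0 _ _ _ lk) addr0.
    by rewrite /pert /low /= lk mul0r mulr0.
  by rewrite big1// => l _; rewrite !mxE pert_row0 ?mul0r// ltnNge ki.
apply: le_trans (proj_dot _ _) _; apply: le_trans (opM _) _; exact: proj_dot.
Qed.

Lemma pert_op_tr x : dot ((pert_mx d w)^T *m x) ((pert_mx d w)^T *m x) <= dot x x.
Proof.
have -> : (pert_mx d w)^T *m x =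
    proj (fun i : 'I_k => (i < k1)%N) (M *m proj (fun i : 'I_k => (k1 <= i)%N) x).
  apply/matrixP => i z; rewrite [z]ord1 !mxE; case: ifP => ki.
    apply: eq_bigr => l _; rewrite !mxE; case: ifP => lk.
      by rewrite (pert_row0 _ _ _ ki) add0r.
    by rewrite /pert /low /= lk andbF mul0r mulr0.
  by rewrite big1// => l _; rewrite !mxE /pert /low /= ki mul0r.
apply: le_trans (proj_dot _ _) _; apply: le_trans (opM _) _; exact: proj_dot.
Qed.

Lemma add_id_op (N : 'M[R]_k) x : dot (N *m x) (N *m x) <= dot x x ->
  dot ((1%:M + N) *m x) ((1%:M + N) *m x) <= 4 * dot x x.
Proof.
rewrite mulmxDl mul1mx => h; have := dot_ge0 (x - N *m x).
by rewrite !(dotDl, dotDr, dotNl, dotNr) (dotC (N *m x) x); lra.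
Qed.

Variable v : R.
Hypothesis v0 : 0 < v.

Definition block_chol : 'M[R]_k := v *: (1%:M + pert_mx d w).
Definition block_cov : 'M[R]_k := block_chol *m block_chol^T.

Lemma block_chol_trig : is_trig_mx block_chol.
Proof.
apply/is_trig_mxP => i l il; rewrite !mxE (pert_lower _ _ (ltnW il)) addr0.
by rewrite -val_eqE /= (ltn_eqF il) mulr0.
Qed.

Lemma block_chol_diag i : 0 < block_chol i i.
Proof. by rewrite !mxE pert_lower// eqxx addr0 mulr1. Qed.

Lemma block_cov_sym : block_cov^T = block_cov.
Proof. by rewrite /block_cov trmx_mul trmxK. Qed.

(** The perturbation and its transpose are contractions, so the factor and its transpose have norm
    at most 2 v. *)
Lemma block_cov_Xi : Xi k (4 * v ^+ 2) block_cov.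
Proof.
apply: Xi_intro; first by rewrite mulr_ge0// sqr_ge0.
  split; first exact: block_cov_sym.
  move=> x; have := dot_ge0 (block_chol^T *m x).
  by rewrite /dot trmx_mul trmxK /block_cov !mulmxA.
move=> x.
have h1 y : dot (block_chol *m y) (block_chol *m y) <= v ^+ 2 * (4 * dot y y).
  rewrite /block_chol -scalemxAl dotZl dotZr mulrA -expr2 ler_wpM2l ?sqr_ge0//.
  by apply: add_id_op; exact: pert_op.
have h2 y : dot (block_chol^T *m y) (block_chol^T *m y) <= v ^+ 2 * (4 * dot y y).
  rewrite /block_chol linearZ/= linearD/= trmx1.
  rewrite -scalemxAl dotZl dotZr mulrA -expr2 ler_wpM2l ?sqr_ge0//.
  by apply: add_id_op; exact: pert_op_tr.
rewrite /block_cov -mulmxA; apply: le_trans (h1 _) _.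
rewrite [leRHS](_ : _ = v ^+ 2 * (4 * (v ^+ 2 * (4 * dot x x)))); last by ring.
by rewrite ler_wpM2l ?sqr_ge0// ler_wpM2l.
Qed.

(** In (1 + N) (1 + N)^T only N itself reaches the lower left block: N^T fills the upper right and N
    N^T the lower right one. The pairing is thus exactly linear in the sign. *)
Lemma block_cov_tr j : low j -> \tr (block_cov^T *m sym_delta j) = 0 + v ^+ 2 * d * sgn R w j.
Proof.
move=> lj; rewrite tr_sym_delta ?block_cov_sym// add0r.
rewrite /block_cov /block_chol linearZ/= -scalemxAl -scalemxAr scalerA -expr2 mxE -mulrA.
congr (_ * _); rewrite linearD/= trmx1 mulmxDl mul1mx mulmxDr mulmx1 !mxE.
case/andP: (lj) => l2 l1.
have -> : (j.1 == j.2) = false.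
  by apply/negbTE; apply: contraTneq l1 => ->; rewrite -ltnNge.
rewrite add0r (pert_row0 _ _ _ l2) add0r big1 ?addr0 => [|m _]; last first.
  by rewrite !mxE (pert_row0 _ _ _ l2) mulr0.
by rewrite /pert -surjective_pairing lj.
Qed.

End op.

End block.

(** * Likelihood ratios and affinities of the block covariances *)

Section block_density.
Local Open Scope ereal_scope.
Context (R : realType) (k : nat).
Local Notation gam := (normal_prob (0 : R) 1).
Local Notation tup := (k.-tuple (measurableTypeR R)).
Local Notation zero := (fun _ : 'I_k => 0%R : R).

Definition scaled_tuple (c : R) (x : 'rV[R]_k) : tup := [tuple (c * x 0%R i)%R | i < k].

Lemma measurable_scaled_tuple c : measurable_fun setT (scaled_tuple c).
Proof.
apply/measurable_fun_tnthP => i.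
rewrite (_ : _ \o _ = fun x : 'rV[R]_k => (c * x 0%R i)%R); last first.
  by apply/funext => x; rewrite /= tnth_mktuple.
by apply: measurable_funM => //; exact: measurable_mx_entry.
Qed.

Lemma scaled_tupleK (v : R) (z : tup) : (v != 0)%R ->
  scaled_tuple v^-1 (v *: \row_i tnth z i)%R = z.
Proof.
by move=> v0; apply: eq_from_tnth => i; rewrite tnth_mktuple !mxE mulKf.
Qed.

Lemma integral_gaussian_scalar (v : R) (F : 'rV[R]_k -> \bar R) : (0 < v)%R ->
  measurable_fun setT F -> (forall x, 0 <= F x) ->
  \int[gaussian ((v ^+ 2)%:M)%R]_x F x = \int[iid gam k]_z F (v *: \row_i tnth z i)%R.
Proof.
move=> v0 mF F0; apply: (etrans (integral_gaussian _ mF F0)).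
by apply: eq_integral => z _; rewrite gaussian_map_scalar.
Qed.

(** In standardised coordinates the factor v (1 + N) acts as the shift z |-> z + N z. *)
Lemma gaussian_shift_density (v : R) (N : 'I_k -> 'I_k -> R) (L : 'M[R]_k)
    (F : 'rV[R]_k -> \bar R) : (0 < v)%R ->
  (forall i l : 'I_k, (i <= l)%N -> N i l = 0%R) ->
  (forall i l p : 'I_k, N i l * N l p = 0)%R ->
  L = (v *: (1%:M + \matrix_(i, l) N i l))%R -> is_trig_mx L -> (forall i, 0 < L i i)%R ->
  measurable_fun setT F -> (forall x, 0 <= F x) ->
  \int[gaussian (L *m L^T)]_x F x =
  \int[gaussian ((v ^+ 2)%:M)%R]_x (F x * (shift_density zero N (scaled_tuple v^-1 x))%:E).
Proof.
move=> v0 Nlow NN defL tL pL mF F0.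
have mden : measurable_fun setT
    (fun x : 'rV[R]_k => (shift_density zero N (scaled_tuple v^-1 x))%:E).
  apply/measurable_EFinP.
  exact: (measurableT_comp (measurable_shift_density _ _) (measurable_scaled_tuple _)).
rewrite (@integral_gaussian_scalar v)//; last 2 first.
- exact: emeasurable_funM.
- by move=> x; rewrite mule_ge0// lee_fin ltW// shift_density_gt0.
apply: (etrans (integral_gaussian _ mF F0)).
pose F' (z : tup) := F (v *: \row_i tnth z i)%R.
have mF' : measurable_fun setT F'.
  by apply: (measurableT_comp mF); exact: measurable_scale_row.
transitivity (\int[iid gam k]_z F' (shift_tuple zero N z)).
  apply: eq_integral => z _; rewrite /F' (gaussian_mapE z tL pL erefl) defL; congr F.
  rewrite linearZ/= -scalemxAr; congr (_ *: _)%R.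
  rewrite linearD/= trmx1 mulmxDr mulmx1; apply/rowP => i.
  rewrite !mxE tnth_mktuple; congr (_ + _)%R; rewrite /shift_by add0r.
  by apply: eq_bigr => l _; rewrite !mxE mulrC.
apply: (etrans (gauss_shift (m := zero) Nlow (fun i l => mulr0 _) NN mF' (fun=> F0 _))).
apply: eq_integral => z _; rewrite scaled_tupleK//.
by rewrite gt_eqF.
Qed.

(* By the parallelogram identity, the geometric mean of two shift densities is the density
   of the mean shift times a Gaussian factor in the difference of the shifts. *)
Definition shift_affinity (N N' : 'I_k -> 'I_k -> R) (z : tup) : R :=
  (shift_density zero (fun i l => (N i l + N' i l) / 2) z *
  expR (- \sum_i shift_by zero (fun i l => N i l - N' i l) z i ^+ 2 / 8))%R.

Lemma shift_affinity_sqr N N' z :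
  (shift_affinity N N' z ^+ 2 = shift_density zero N z * shift_density zero N' z)%R.
Proof.
rewrite /shift_affinity /shift_density -!expRD -expRM_natl; congr expR.
rewrite -big_split/= -sumrN -big_split/= mulr_sumr; apply: eq_bigr => i _.
have -> : shift_by zero (fun i l => (N i l + N' i l) / 2)%R z i =
    ((shift_by zero N z i + shift_by zero N' z i) / 2)%R.
  by rewrite /shift_by !add0r -big_split/= mulr_suml; apply: eq_bigr => l _; field.
have -> : shift_by zero (fun i l => N i l - N' i l)%R z i =
    (shift_by zero N z i - shift_by zero N' z i)%R.
  by rewrite /shift_by !add0r -sumrB; apply: eq_bigr => l _; rewrite mulrBl.
by field.
Qed.

Lemma measurable_shift_affinity N N' : measurable_fun setT (shift_affinity N N').
Proof.
apply: measurable_funM; first exact: measurable_shift_density.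
apply: measurableT_comp => //; apply: measurableT_comp => //.
apply: measurable_sum => i; apply: measurable_funM => //; apply: measurable_funX.
exact: measurable_shift_by.
Qed.

(** The mean of the two perturbations is again triangular with square zero, so [gauss_shift] removes
    its density. The remaining factor depends only on the coordinate [l0], which the shift fixes
    because l0 < k1. There the perturbations differ by 2 d in absolute value, and (2 d)^2 / 8 = d^2
    / 2 leaves a one-dimensional Gaussian integral. *)
Lemma integral_shift_affinity (k1 : nat) (d : R) (w : {ffun 'I_k * 'I_k -> bool}) j :
  low k1 j ->
  \int[iid gam k]_z (shift_affinity (pert k1 d w) (pert k1 d (flip j w)) z)%:E =
  ((Num.sqrt (1 + d ^+ 2))^-1)%:E.
Proof.
move=> lj; set N := pert k1 d w; set N' := pert k1 d (flip j w).
pose Nb i l := ((N i l + N' i l) / 2)%R; pose dN i l := (N i l - N' i l)%R.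
pose G (z : tup) := (expR (- \sum_i shift_by zero dN z i ^+ 2 / 8))%:E.
have mG : measurable_fun setT G.
  apply/measurable_EFinP; apply: measurableT_comp => //; apply: measurableT_comp => //.
  apply: measurable_sum => i; apply: measurable_funM => //; apply: measurable_funX.
  exact: measurable_shift_by.
have G0 z : 0 <= G z by rewrite lee_fin expR_ge0.
have Nblow (i l : 'I_k) : (i <= l)%N -> Nb i l = 0%R.
  by move=> il; rewrite /Nb /N /N' !pert_lower// addr0 mul0r.
have NbNb (i l p : 'I_k) : (Nb i l * Nb l p = 0)%R.
  by rewrite /Nb mulf_div mulrDl !mulrDr /N /N' !pert_mul !addr0 mul0r.
transitivity (\int[iid gam k]_z (G z * (shift_density zero Nb z)%:E)).
  by apply: eq_integral => z _; rewrite /G -EFinM mulrC.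
rewrite -(gauss_shift (m := zero) Nblow (fun i l => mulr0 _) NbNb mG G0).
case: j lj @N' @Nb @dN @G mG G0 Nblow NbNb => i0 l0 lj N' Nb dN G mG G0 Nblow NbNb.
have l0k : (l0 < k1)%N by case/andP: (lj).
have dNE i l : dN i l = (if (i == i0) && (l == l0) then 2 * d * sgn R w (i0, l0) else 0)%R.
  rewrite /dN /N /N' /pert; have [[-> ->]|ne] := eqVneq (i, l) (i0, l0).
    by rewrite lj !eqxx sgn_flip/=; ring.
  rewrite -[_ && _]/((i, l) == (i0, l0)) (negbTE ne); case: ifP => _; last exact: subrr.
  by rewrite /sgn ffunE (negbTE ne) addFb subrr.
have sh z : tnth (shift_tuple zero Nb z) l0 = tnth z l0.
  rewrite tnth_mktuple /shift_by add0r big1 ?addr0// => l _.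
  by rewrite /Nb /N /N' !pert_row0// addr0 !mul0r.
have sby z i : shift_by zero dN z i =
    (if i == i0 then 2 * d * sgn R w (i0, l0) * tnth z l0 else 0)%R.
  rewrite /shift_by add0r (bigD1 l0)//= dNE eqxx andbT big1 => [|l ll0]; last first.
    by rewrite dNE (negbTE ll0) andbF mul0r.
  by case: (i == i0); rewrite ?mul0r addr0.
pose bb : R := Num.sqrt (1 + d ^+ 2).
have bb0 : (0 < bb)%R by rewrite sqrtr_gt0 ltr_pwDl// sqr_ge0.
have bb2 : (bb ^+ 2 = 1 + d ^+ 2)%R by rewrite sqr_sqrtr// addr_ge0// sqr_ge0.
rewrite -(normal_exp_sqr bb0).
rewrite -(@integral_iid_coord _ k l0 (fun x => expR ((1 - bb ^+ 2) / 2 * x ^+ 2)))//; last first.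
  apply: measurableT_comp => //; apply: measurable_funM => //; exact: measurable_funX.
apply: eq_integral => z _; rewrite /G; congr (expR _)%:E.
rewrite (bigD1 i0)//= big1 => [|i ii0]; last first.
  by rewrite sby (negbTE ii0) expr0n /= mul0r.
by rewrite sby eqxx sh addr0 !exprMn sgn_sqr bb2; field.
Qed.

End block_density.

(** * Random sign matrices *)

Section good_signs.
Context (R : realType).

(** The sum over the cube factors over the signs, and [cosh_le] bounds each factor. *)
Lemma sum_expR_signs (J : finType) (P : pred J) (u : J -> R) :
  \sum_(w : {ffun J -> bool}) expR (\sum_(j | P j) sgn R w j * u j) <=
  #|{: {ffun J -> bool}}|%:R * expR (4 * \sum_(j | P j) u j ^+ 2).
Proof.
pose F j (b : bool) : R := expR (if P j then (-1) ^+ b * u j else 0).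
rewrite (eq_bigr (fun w : {ffun J -> bool} => \prod_j F j (w j))); last first.
  by move=> w _; rewrite -expR_sum -big_mkcond.
rewrite -(bigA_distr_bigA F) card_ffun card_bool natrX mulr_sumr expR_sum.
rewrite [X in _ * X]big_mkcond/= -prodr_const -big_split/=.
apply: ler_prod => j _; rewrite big_bool /F/=.
case: (P j); last by rewrite expR0 mulr1 addr_ge0//=; lra.
rewrite addr_ge0 ?expR_ge0//= expr1 expr0 mul1r mulN1r addrC; exact: cosh_le.
Qed.

Variables k k1 : nat.
Local Notation cube := {ffun 'I_k * 'I_k -> bool}.

Lemma sign_mx_quad (w : cube) (y : 'cV[R]_k) :
  dot y (sign_mx R k1 w *m y) = \sum_(j | low k1 j) sgn R w j * (y j.1 0 * y j.2 0).
Proof.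
have -> : dot y (sign_mx R k1 w *m y) = dot y (pert_mx k1 1 w *m y).
  rewrite sign_mxE -scalemxAl dotZr mulmxDl dotDr [dot y (_^T *m y)]dot_mulmx trmxK.
  by rewrite [dot (_ *m y) y]dotC; field.
rewrite dotE; under eq_bigr do rewrite mxE mulr_sumr.
rewrite pair_bigA [RHS]big_mkcond/=; apply: eq_bigr => -[i l] _ /=.
by rewrite mxE /pert mul1r; case: ifP => _; rewrite ?mul0r ?mulr0// mulrCA.
Qed.

(** The quadratic form is linear in the signs with coefficients y_i y_l, whose squares add up to at
    most |y|^4 <= 1. *)
Lemma sum_expR_sign_mx (t : R) (y : 'cV[R]_k) : dot y y <= 1 ->
  \sum_(w : cube) expR (t * dot y (sign_mx R k1 w *m y)) <=
  #|{: cube}|%:R * expR (4 * t ^+ 2).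
Proof.
move=> y1; under eq_bigr do rewrite sign_mx_quad mulr_sumr.
under eq_bigr do under eq_bigr do rewrite mulrCA.
apply: le_trans (sum_expR_signs _ _) _; rewrite ler_wpM2l// ler_expR ler_wpM2l//.
apply: (@le_trans _ _ (\sum_(j : 'I_k * 'I_k) t ^+ 2 * (y j.1 0 ^+ 2 * y j.2 0 ^+ 2))).
  rewrite big_mkcond; apply: ler_sum => j _; rewrite -!exprMn.
  by case: ifP => _; rewrite ?lexx// sqr_ge0.
rewrite -mulr_sumr ler_piMr ?sqr_ge0//.
rewrite -(pair_bigA _ (fun i l => y i 0 ^+ 2 * y l 0 ^+ 2))/=.
under eq_bigr do rewrite -mulr_sumr -dot_sqrE.
by rewrite -mulr_suml -dot_sqrE; have := dot_ge0 y; nra.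
Qed.

(** 75 = 3 * 25: the factor 3 is lost between net and ball, and 25 is large enough for the union
    bound of [card_bad_signs]. The condition is stated on the net, where it can be counted. *)
Definition good_signs : {set cube} :=
  finset (fun w => [forall f in net k,
    3 * `|dot (netpt R f) (sign_mx R k1 w *m netpt R f)| <= 75 * Num.sqrt k%:R]).

Hypothesis k0 : (0 < k)%N.

Lemma good_signs_op w (x : 'cV[R]_k) : w \in good_signs ->
  dot (sign_mx R k1 w *m x) (sign_mx R k1 w *m x) <= (75 * Num.sqrt k%:R) ^+ 2 * dot x x.
Proof.
rewrite inE => /forall_inP wG.
have symB : (sign_mx R k1 w)^T = sign_mx R k1 w.
  by rewrite sign_mxE linearZ/= linearD/= trmxK addrC.
have [f fN Bq] := sym_quad_net k0 symB.
have q0 : 0 <= 75 * Num.sqrt k%:R :> R by exact: mulr_ge0.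
apply: (sym_quad_op symB q0) => y; apply: le_trans (Bq y) _.
by rewrite ler_wpM2r ?dot_ge0//; exact: wG.
Qed.

(** Exponential Markov inequality at sqrt k and a union bound: a bad pattern weighs at least exp (25
    k), against exp (18 k) net points of weight 2 exp (4 k) each. The spare exp (3 k) >= 8 brings
    the proportion down to 1/4. *)
Lemma card_bad_signs : (4 * #|~: good_signs| <= #|{: cube}|)%N.
Proof.
rewrite -(ler_nat R) natrM.
pose s : R := Num.sqrt k%:R; have s0 : 0 < s by rewrite sqrtr_gt0 ltr0n.
have s2 : s ^+ 2 = k%:R by rewrite sqr_sqrtr ?ler0n.
pose q f (w : cube) : R := dot (netpt R f) (sign_mx R k1 w *m netpt R f).
have bad : #|~: good_signs|%:R * expR (25 * k%:R) <=
    #|net k|%:R * (2 * (#|{: cube}|%:R * expR (4 * k%:R))) :> R.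
  rewrite -sum1_card natr_sum mulr_suml.
  apply: (@le_trans _ _
      (\sum_(w : cube) \sum_(f in net k) (expR (s * q f w) + expR ((- s) * q f w)))).
    rewrite big_mkcond; apply: ler_sum => w _.
    case: ifP => [|_]; last by apply: sumr_ge0 => f _; rewrite addr_ge0 ?expR_ge0.
    rewrite !inE negb_forall => /existsP[f]; rewrite negb_imply -ltNge => /andP[fN qf].
    rewrite mul1r (bigD1 f)//=; apply: (@le_trans _ _ (expR (s * q f w) + expR ((- s) * q f w))).
      rewrite -/s -/(q f w) in qf.
      have h : 25 * k%:R <= s * `|q f w| by rewrite -s2; nra.
      have e1 := expR_ge0 (s * q f w); have e2 := expR_ge0 ((- s) * q f w).
      case: (ger0P (q f w)) h => _ h.
        apply: (@le_trans _ _ (expR (s * q f w))); last by rewrite lerDl.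
        by rewrite ler_expR.
      apply: (@le_trans _ _ (expR ((- s) * q f w))); last by rewrite lerDr.
      by rewrite ler_expR mulNr -mulrN.
    by rewrite lerDl; apply: sumr_ge0 => g _; rewrite addr_ge0 ?expR_ge0.
  rewrite exchange_big/= [leRHS]mulr_natl -sumr_const; apply: ler_sum => f fN.
  have y1 := netpt_dot_le1 R k0 fN.
  rewrite big_split/= mulr_natl mulr2n -s2; apply: lerD.
    exact: sum_expR_sign_mx.
  by apply: le_trans (sum_expR_sign_mx _ y1) _; rewrite sqrrN.
have cN := net_card R k; set c : R := #|{: cube}|%:R in bad *.
have c0 : 0 <= c by exact: ler0n.
set m : R := _%:R in bad *.
have h1 : m * expR (25 * k%:R) <= 2 * c * expR (22 * k%:R).
  apply: le_trans bad _; apply: le_trans (ler_wpM2r _ cN) _.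
    by rewrite mulr_ge0// mulr_ge0// expR_ge0.
  have -> : 22 * k%:R = 18 * k%:R + 4 * k%:R :> R by ring.
  by rewrite expRD le_eqVlt; apply/orP; left; apply/eqP; ring.
have e8 : 8 <= expR (3 * k%:R) :> R.
  apply: (@le_trans _ _ (expR 3)); last by rewrite ler_expR ler_pMr// ler1n.
  have -> : (3 : R) = 1 + 1 + 1 by lra.
  by rewrite !expRD; have := expR1_ge2 R; nra.
have h2 : m * expR (3 * k%:R) <= 2 * c.
  rewrite -(ler_pM2r (expR_gt0 (22 * k%:R))) -mulrA -expRD.
  by have -> : 3 * k%:R + 22 * k%:R = 25 * k%:R :> R by ring.
have m0 : 0 <= m by exact: ler0n.
nra.
Qed.

(** Flipping is a bijection, so at most 1/4 + 1/4 of the patterns are bad themselves or have a bad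
    flip. *)
Lemma card_good_signs_flip j :
  (#|{: cube}| <= 2 * #|finset (fun w => (w \in good_signs) && (flip j w \in good_signs))|)%N.
Proof.
set A := finset _.
have cA : (#|~: A| <= #|~: good_signs| + #|~: good_signs|)%N.
  have -> : ~: A = ~: good_signs :|: flip j @^-1: (~: good_signs).
    by apply/setP => w; rewrite !inE negb_and.
  apply: leq_trans (leq_card_setU _ _) _; rewrite leq_add2l.
  rewrite -(card_imset _ (can_inj (flipK j))); apply: subset_leq_card.
  by apply/fintype.subsetP => _ /imsetP[w + ->]; rewrite inE.
by move: card_bad_signs cA; rewrite -(cardsC A) -!(ler_nat R) !(natrM, natrD); lra.
Qed.

End good_signs.

(** * Choice of parameters in the lower bound *)

Section lower_bound.
Context (R : realType).

Lemma card_low k k1 : (k1 <= k)%N -> #|@low k k1| = (k1 * (k - k1))%N.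
Proof.
move=> k1k; pose A := [pred i : 'I_k | (i < k1)%N].
have cA : #|A| = k1.
  rewrite -sum1_card -(big_ord_widen k (fun=> 1%N) k1k).
  by rewrite sum_nat_const card_ord muln1.
have cAC : #|[predC A]| = (k - k1)%N.
  by rewrite -[X in (X - _)%N](card_ord k) -(cardC A) cA addKn.
rewrite mulnC -cAC -[X in (_ * X)%N]cA -cardX; apply: eq_card => -[i l].
by rewrite !inE /low /= -leqNgt andbC.
Qed.

Lemma low_half_card k : (1 < k)%N -> (k ^ 2 <= 6 * #|@low k k./2|)%N.
Proof.
move=> k2; have m0 : (0 < k./2)%N by rewrite half_gt0.
rewrite card_low ?half_leqif; last by rewrite -{2}(odd_double_half k) -addnn; lia.
set m := k./2 in m0 *; have -> : k = (odd k + (m + m))%N by rewrite addnn odd_double_half.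
by case: (odd k); nia.
Qed.

(** After squaring, (1 + d^2)^n <= exp (n d^2) <= exp 1 <= 4. *)
Lemma affinity_pow n (d : R) : n%:R * d ^+ 2 <= 1 ->
  2^-1 <= (Num.sqrt (1 + d ^+ 2))^-1 ^+ n.
Proof.
move=> nd; have d0 := sqr_ge0 d.
have q0 : 0 < 1 + d ^+ 2 by lra.
rewrite -(@ler_sqr _ 2^-1) ?nnegrE ?exprn_ge0 ?invr_ge0 ?sqrtr_ge0//.
rewrite -exprM mulnC exprM !exprVn sqr_sqrtr ?(ltW q0)// lef_pV2 ?posrE ?exprn_gt0//.
have -> : (2 : R) ^+ 2 = 4 by ring.
apply: (@le_trans _ _ (expR (d ^+ 2) ^+ n)).
  by rewrite lerXn2r ?nnegrE ?expR_ge0 ?(ltW q0)// expR_ge1Dx.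
by rewrite -expRM_natl; apply: le_trans (expR1_le4 R); rewrite ler_expR.
Qed.

Variables (n k : nat) (lambda : R) (tau : 'rV[R]_k -> R).
Hypotheses (n0 : (0 < n)%N) (k2 : (1 < k)%N) (l0 : 0 < lambda).
Hypothesis tauP : symmetric_gauge tau.

Let k0 : (0 < k)%N. Proof. exact: ltnW. Qed.
Let k1 := k./2.
Let s : R := Num.sqrt k%:R.
Let s0 : 0 < s. Proof. by rewrite sqrtr_gt0 ltr0n. Qed.
Let s2 : s ^+ 2 = k%:R. Proof. by rewrite sqr_sqrtr// ler0n. Qed.
(** Halved because the block covariances have norm up to 4 v^2. *)
Let v : R := Num.sqrt lambda / 2.
Let v0 : 0 < v. Proof. by rewrite divr_gt0// sqrtr_gt0. Qed.
Let v2 : 4 * v ^+ 2 = lambda.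
Proof. by rewrite /v expr_div_n sqr_sqrtr ?(ltW l0)//; field. Qed.
Let m : R := Num.min (k%:R / n%:R) 1.
Let m0 : 0 <= m. Proof. by rewrite le_min ler01 divr_ge0 ?ler0n. Qed.
(** With b = 75 s this makes 2 d b = sqrt m, at most 1 because m <= 1, while m <= k / n bounds n
    d^2. *)
Let d : R := Num.sqrt m / (150 * s).
Let d0 : 0 <= d. Proof. by rewrite divr_ge0 ?sqrtr_ge0// mulr_ge0// ltW. Qed.
Let b : R := 75 * s.
Let b0 : 0 < b. Proof. by rewrite mulr_gt0. Qed.

Let db : 2 * d * b <= 1.
Proof.
have -> : 2 * d * b = Num.sqrt m by rewrite /d /b; field; rewrite gt_eqF.
by rewrite -[leRHS]sqrtr1 ler_wsqrtr// ge_min lexx orbT.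
Qed.

Let nd2 : n%:R * d ^+ 2 <= 1.
Proof.
rewrite /d expr_div_n exprMn s2 sqr_sqrtr// mulrA ler_pdivrMr ?mul1r; last first.
  by rewrite mulr_gt0 ?ltr0n// exprn_gt0.
apply: (@le_trans _ _ k%:R).
  by rewrite -ler_pdivlMl ?ltr0n// mulrC ge_min lexx.
by rewrite ler_peMl ?ler0n//; lra.
Qed.

Local Notation cube := {ffun 'I_k * 'I_k -> bool}.
Let Q := gaussian ((v ^+ 2)%:M : 'M[R]_k).
Let f (w : cube) x : R := shift_density (fun=> 0) (pert k1 d w) (scaled_tuple v^-1 x).
Let h j (w : cube) x : R :=
  shift_affinity (pert k1 d w) (pert k1 d (flip j w)) (scaled_tuple v^-1 x).

Lemma minimax_lower_block :
  (((tau (const_mx 1) / k%:R) ^+ 2 * (v ^+ 2 * d * #|@low k k1|%:R / (32 * b)) ^+ 2)%:E <=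
   minimax_risk n lambda tau)%E.
Proof.
have i1 : (k1 < k)%N by rewrite /k1 -{2}(odd_double_half k) -addnn; have := half_gt0 k; lia.
have lowj0 : low k1 (Ordinal i1, Ordinal k0).
  by rewrite /low /= leqnn andbT half_gt0.
apply: (@assouad R n k _ (@low k k1) lambda tau (@sym_delta R k) (fun w => block_cov k1 d w v)
  (good_signs R k k1) (v ^+ 2 * d) b ((Num.sqrt (1 + d ^+ 2))^-1) (fun=> 0) Q f h k0 tauP
  _ b0 _ _ _ _ _ _ _ _ _ _ _ (affinity_pow nd2) _ _ lowj0).
- by rewrite mulr_ge0// sqr_ge0.
- by move=> w j _ lj; exact: block_cov_tr.
- by move=> w x wG; exact: good_signs_op.
- move=> w wG; rewrite -v2; apply: (block_cov_Xi d0 (ltW b0) db) => x.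
  exact: good_signs_op.
- move=> w.
  exact: (measurableT_comp (measurable_shift_density _ _) (measurable_scaled_tuple _)).
- by move=> w x; exact: shift_density_gt0.
- move=> w F _ mF F0; apply: gaussian_shift_density => //.
  + exact: pert_lower.
  + by move=> *; exact: pert_mul.
  + exact: block_chol_trig.
  + exact: block_chol_diag.
- move=> j w.
  exact: (measurableT_comp (measurable_shift_affinity _ _) (measurable_scaled_tuple _)).
- by move=> j w x; rewrite mulr_ge0 ?expR_ge0// ltW// shift_density_gt0.
- by move=> j w x; exact: shift_affinity_sqr.
- move=> j w lj; rewrite /Q integral_gaussian_scalar//; last 2 first.
  + apply/measurable_EFinP.
    exact: (measurableT_comp (measurable_shift_affinity _ _) (measurable_scaled_tuple _)).
  + by move=> x; rewrite lee_fin mulr_ge0 ?expR_ge0// ltW// shift_density_gt0.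
  rewrite -(integral_shift_affinity d w lj) le_eqVlt; apply/orP; left; apply/eqP.
  by apply: eq_integral => z _; rewrite /h scaled_tupleK// gt_eqF.
- by rewrite invr_ge0 sqrtr_ge0.
- by move=> j _; exact: card_good_signs_flip.
Qed.

Lemma minimax_lower2 :
  (((150 ^+ 2 * (24 * 32 * 75) ^+ 2)^-1 * Num.min (k%:R / n%:R) 1 * lambda ^+ 2 *
     tau (const_mx 1) ^+ 2)%:E <= minimax_risk n lambda tau)%E.
Proof.
apply: le_trans minimax_lower_block; rewrite lee_fin -/m.
have kR : 0 < k%:R :> R by rewrite ltr0n.
(* 150 comes from [d], 75 from [b], 32 from [assouad], and 24 = 4 * 6 from v^2 = lambda / 4 and the
   size of the block, at least k^2 / 6. *)
pose K : R := 150 * (24 * 32 * 75).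
have K0 : 0 < K by rewrite /K !mulr_gt0.
have -> : (150 ^+ 2 * (24 * 32 * 75) ^+ 2)^-1 * m * lambda ^+ 2 * tau (const_mx 1) ^+ 2 =
    (tau (const_mx 1) / k%:R) ^+ 2 * (lambda * Num.sqrt m * k%:R / K) ^+ 2 :> R.
  rewrite -exprMn !expr_div_n !exprMn sqr_sqrtr// -exprMn -/K; field.
  by rewrite !gt_eqF.
have lK : 0 <= lambda * Num.sqrt m / K.
  by apply: divr_ge0; [apply: mulr_ge0; [exact: ltW|exact: sqrtr_ge0]|exact: ltW].
rewrite [lambda * _ * _ / K]mulrAC; apply: ler_wpM2l; first exact: sqr_ge0.
rewrite lerXn2r ?nnegrE//; [exact: mulr_ge0| | ].
  apply: divr_ge0; last by rewrite mulr_ge0// ltW.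
  by rewrite mulr_ge0// mulr_ge0// sqr_ge0.
have -> : v ^+ 2 * d * #|@low k k1|%:R / (32 * b) =
    lambda * Num.sqrt m / K * (6 * #|@low k k1|%:R / k%:R).
  rewrite -v2 -s2 /d /b /K; field; by rewrite gt_eqF.
apply: ler_wpM2l lK _ _ _.
by rewrite ler_pdivlMr// -expr2 -natrX -natrM ler_nat low_half_card.
Qed.

End lower_bound.

Theorem theorem6 (R : realType) :
  exists c C : R, [/\ 0 < c, c <= C &
    forall (n k : nat) (lambda : R) (tau : 'rV[R]_k -> R),
      (0 < n)%N -> (0 < k)%N -> 0 < lambda -> symmetric_gauge tau ->
      ((c * Num.min (k%:R / n%:R) 1 * lambda ^+ 2
          * tau (const_mx 1) ^+ 2)%:E <= minimax_risk n lambda tau)%E /\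
      (minimax_risk n lambda tau <= (C * Num.min (k%:R / n%:R) 1 * lambda ^+ 2
          * tau (const_mx 1) ^+ 2)%:E)%E].
Proof.
have c1 : (150 ^+ 2 * (24 * 32 * 75) ^+ 2)^-1 <= 1 :> R.
  rewrite invf_le1 ?mulr_gt0 ?exprn_gt0 ?mulr_gt0//.
  by rewrite -exprMn exprn_ege1//; lra.
exists (150 ^+ 2 * (24 * 32 * 75) ^+ 2)^-1, (24 ^+ 2 * (2 * 34 ^+ 2 + 16)).
split.
- by rewrite invr_gt0 mulr_gt0 ?exprn_gt0 ?mulr_gt0.
- by apply: le_trans c1 _; lra.
move=> n k lambda tau n0 k0 l0 tauP; split; last exact: minimax_upper.
(* For k = 1 the lower left block is empty, hence the separate bound; the minimum is then 1 / n. *)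
case: k tau tauP k0 => [//|[|k]] tau tauP k0; last exact: minimax_lower2.
apply: le_trans (minimax_lower1 n0 l0 tauP); rewrite lee_fin.
rewrite min_l ?ler_pdivrMr ?ltr0n ?mul1r ?ler1n//.
rewrite ler_wpM2r ?sqr_ge0// ler_wpM2r ?sqr_ge0// ler_wpM2r ?invr_ge0//.
by rewrite lef_pV2 ?posrE ?mulr_gt0 ?exprn_gt0 ?mulr_gt0// -exprMn lerXn2r ?nnegrE//; lra.
Qed.
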